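(* Let $p_1,p_2$ be primes with $p_1\equiv p_2\equiv 1\pmod 4$ such that at least two of $\left(\frac{p_1}{p_2}\right),\left(\frac{2}{p_1}\right),\left(\frac{2}{p_2}\right)$ equal $-1$. Let $k=\mathbb{Q}(\sqrt{2p_1p_2},i)$ and $\mathbb{K}_3=k(\sqrt2)=\mathbb{Q}(\sqrt2,\sqrt{p_1p_2},i)$. Write $p_1=e^2+(2f)^2$, $\pi_1=e+2if$, $\pi_2=e-2if$, and let $\mathcal{H}_0,\mathcal{H}_1,\mathcal{H}_2$ be the prime ideals of $k$ above $1+i,\pi_1,\pi_2$. Let $Q$ be the unit index of $\mathbb{Q}(\sqrt2,\sqrt{p_1p_2})$ defined in the context. Then: (1) if $Q=1$, exactly four classes of $\mathbf{C}_{k,2}$ capitulate in $\mathbb{K}_3$ and $\ker j_{\mathbb{K}_3}=\langle[\mathcal{H}_0],[\mathcal{H}_1\mathcal{H}_2]\rangle$; (2) if $Q=2$, exactly two classes of $\mathbf{C}_{k,2}$ capitulate in $\mathbb{K}_3$ and $\ker j_{\mathbb{K}_3}=\langle[\mathcal{H}_0]\rangle$.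
   Context: Let $\varepsilon_1,\varepsilon_2,\varepsilon_3$ be the fundamental units of $\mathbb{Q}(\sqrt2)$, $\mathbb{Q}(\sqrt{p_1p_2})$, $\mathbb{Q}(\sqrt{2p_1p_2})$. $Q$ denotes the index $[E:\langle -1,\varepsilon_1,\varepsilon_2,\varepsilon_3\rangle]$ where $E$ is the unit group of $\mathbb{Q}(\sqrt2,\sqrt{p_1p_2})$; thus $Q=2$ exactly when $\varepsilon_2$ has norm $-1$ and $\varepsilon_1\varepsilon_2\varepsilon_3$ is a square in $\mathbb{Q}(\sqrt2,\sqrt{p_1p_2})$, and $Q=1$ otherwise. $\mathbf{C}_{k,2}$ is the $2$-Sylow subgroup of the class group of $k$. For an unramified extension $K/k$, $j_K:\mathbf{C}_{k,2}\to\mathbf{C}_{K,2}$ is induced by extension of ideals; its kernel consists of the classes that capitulate in $K$. *)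

(* Defs.v *)
(* number fields are realised as subfields of algC. *)
From HB Require Import structures.
From mathcomp Require Import all_boot all_order all_algebra all_field.
Set Implicit Arguments. Unset Strict Implicit. Unset Printing Implicit Defensive.
Import Order.TTheory GRing.Theory Num.Theory.
Local Open Scope ring_scope.

Definition legendre (a p : nat) : int :=
  if (p %| a)%N then 0
  else if [exists x : 'I_p, (x * x == a %[mod p])%N] then 1 else -1.

Definition is_subfield (F : algC -> Prop) : Prop :=
  F 0 /\ F 1 /\ (forall x y, F x -> F y -> F (x + y)) /\ (forall x, F x -> F (- x))
  /\ (forall x y, F x -> F y -> F (x * y)) /\ (forall x, F x -> F x^-1).

Definition Qgen (S : seq algC) (x : algC) : Prop :=
  forall F, is_subfield F -> (forall s, s \in S -> F s) -> F x.

Definition OK (F : algC -> Prop) (x : algC) : Prop := F x /\ x \in Aint.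

Definition is_ideal (F : algC -> Prop) (I : algC -> Prop) : Prop :=
  (forall x, I x -> OK F x) /\ I 0 /\ (forall x y, I x -> I y -> I (x + y))
  /\ (forall a x, OK F a -> I x -> I (a * x)).

Definition nz_ideal (F : algC -> Prop) (I : algC -> Prop) : Prop :=
  is_ideal F I /\ exists x, I x /\ x != 0.

Definition prime_ideal (F : algC -> Prop) (P : algC -> Prop) : Prop :=
  nz_ideal F P /\ ~ P 1 /\
  forall a b, OK F a -> OK F b -> P (a * b) -> P a \/ P b.

Definition ideal_gen (F : algC -> Prop) (S : algC -> Prop) (x : algC) : Prop :=
  forall J, is_ideal F J -> (forall s, S s -> J s) -> J x.

Definition ideal_mul (F : algC -> Prop) (I J : algC -> Prop) : algC -> Prop :=
  ideal_gen F (fun z => exists x y, I x /\ J y /\ z = x * y).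

Definition ideal_pow (F : algC -> Prop) (I : algC -> Prop) (n : nat) : algC -> Prop :=
  iter n (ideal_mul F I) (OK F).

Definition principal (F : algC -> Prop) (I : algC -> Prop) : Prop :=
  exists a, OK F a /\ forall x, I x <-> exists y, OK F y /\ x = a * y.

Definition ideal_equiv (F : algC -> Prop) (I J : algC -> Prop) : Prop :=
  exists alpha, F alpha /\ alpha != 0 /\ forall x, J x <-> exists y, I y /\ x = alpha * y.

Definition in_2part (F : algC -> Prop) (I : algC -> Prop) : Prop :=
  exists n, principal F (ideal_pow F I (2 ^ n)).

Definition capitulates (K : algC -> Prop) (I : algC -> Prop) : Prop :=
  principal K (ideal_gen K I).

Definition num_classes (F : algC -> Prop) (P : (algC -> Prop) -> Prop) (n : nat) : Prop :=
  exists c : 'I_n -> (algC -> Prop),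
    (forall i, nz_ideal F (c i) /\ P (c i)) /\
    (forall i j, ideal_equiv F (c i) (c j) -> i = j) /\
    (forall I, nz_ideal F I -> P I -> exists i, ideal_equiv F I (c i)).

Definition is_unit (F : algC -> Prop) (u : algC) : Prop :=
  u != 0 /\ OK F u /\ OK F u^-1.

Definition fund_unit (d : nat) (eps : algC) : Prop :=
  let F := Qgen [:: sqrtC d%:R] in
  is_unit F eps /\ 1 < eps /\
  forall u, is_unit F u -> exists (s : bool) (n : int), u = (-1) ^+ s * eps ^ n.

Definition unit_subgroup (e1 e2 e3 : algC) (u : algC) : Prop :=
  exists (s : bool) (a b c : int), u = (-1) ^+ s * e1 ^ a * e2 ^ b * e3 ^ c.

Definition unit_index (F : algC -> Prop) (W : algC -> Prop) (n : nat) : Prop :=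
  exists c : 'I_n -> algC,
    (forall i, is_unit F (c i)) /\
    (forall i j, W (c i / c j) -> i = j) /\
    (forall u, is_unit F u -> exists i, W (u / c i)).

(* Main.v *)
(** Write [K0] for the real subfield of [K3] and [sigma] for the generator of Gal(K3/k).
If [I] becomes principal in [K3], with generator [g], then [u = sigma g / g] is a unit of relative norm 1, and [w = u / conj u] has absolute value 1 and [w + conj w] lies in [Q(sqrt (2 p1 p2))]. A size estimate leaves only [w^3 = 1], [w^3 = -1] or [w^2 = -1], the last being excluded. Hence [(g / u)^2 = g (sigma g) u^-3] is an element of [k] times a unit of [K0], so the kernel is governed by the units of [K0] modulo squares.

Every unit of [K0] has square [eps1^a eps2^b eps3^c]. Signs of relative norms show that, modulo squares of the [eps_i], the only nontrivial candidate for a square is [theta = eps1 eps2 eps3] (if [eps2] has norm -1) or [theta = eps2] (if it has norm 1). An explicit element of [K0] has square [M theta] with [M] a positive integer, and ramification shows that [theta] or [p1 theta] is a square. The second case is [Q = 1]. For [Q = 2] only [eps1 eps2 eps3] is possible.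

The two potential classes are produced by [alpha0 = 1 + zeta8], where [alpha0^2 = (1 + i)(1 + sqrt 2)], which generates the extension of the ideal above [1 + i], and, for [Q = 1], by [beta] with [beta^2 = p1 theta], which generates the extension of the product of the ideals above [pi1] and [pi2]. They are independent by the same parity argument on norm signs. The Legendre symbol hypothesis enters only through the fact that [eps3] has norm -1. *)

Require Import Defs.
From HB Require Import structures.
From mathcomp Require Import all_boot all_order all_algebra all_field.
From mathcomp Require Import cyclic.
From mathcomp Require Import ring lra zify.
Import Order.TTheory GRing.Theory Num.Theory.
Local Open Scope ring_scope.

(** * Splittings of the Pell equation *)

(** Ideals are treated without unique factorisation. An ideal [J] of [k] whose square is principal
    is encoded by an element [g], usually outside [k]: [J] consists of the integers of [k] divisible
    by [g], and [g ^ 2] is, up to a unit, an element of [J ^ 2]. Equivalence of ideals then asks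
    whether a quotient is a unit, and capitulation whether [g] lies in [K3]. Conversely, a
    capitulating ideal of the 2-part is recovered from its generator, because having a principal
    power makes it invertible. The cube of [u] occurs because [conj (u ^ 3) = u ^ 3 / w ^ 3] with
    [w ^ 3] a sign: [u ^ 3] or [i u ^ 3] is real. Cubing keeps exponents modulo 2, so parity
    arguments survive it. If [eps3] had norm 1, its trace would give [h (h + 1) = 2 p1 p2 b ^ 2].
    The primes 2, [p1], [p2] are shared by two coprime consecutive factors; quadratic symbols and
    congruences modulo 8 leave only the sharing that makes [eps3] or its inverse a square. No
    fundamental unit is computed: of [eps1] it is only needed that [1 + sqrt 2] is an odd power of
    it. *)

Lemma coprime_mul_sqr (x y z : nat) :
  (coprime x y -> x * y = z ^ 2 -> exists r, x = r ^ 2)%N.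
Proof.
move=> co e; exists (gcdn x z).
have [x0|xp] := posnP x.
  by move: e; rewrite x0 mul0n => /esym/eqP; rewrite expn_eq0 andbT => /eqP ->.
have [y0|yp] := posnP y.
  by move: co e; rewrite y0 /coprime gcdn0 => /eqP -> _; rewrite gcd1n.
have zp : (0 < z)%N by move: e; case: (z) => // /eqP; rewrite muln_eq0 => /orP [] /eqP h; lia.
(* At each prime one of [x], [y] has valuation 0, so [x] has valuation 0 or twice that of [z];
   either way it is twice that of the gcd. *)
apply: eqn_from_log => //; first by rewrite expn_gt0 gcdn_gt0 xp.
move=> p; rewrite lognX logn_gcd //.
have := congr1 (logn p) e; rewrite lognM // lognX.
have : (logn p x == 0%N) || (logn p y == 0%N).
  rewrite -[_ || _]negbK negb_or -!lt0n; apply/negP.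
  rewrite !logn_gt0 !mem_primes => /andP [/and3P [pp _ dx] /and3P [_ _ dy]].
  have := dvdn_gcd p x y; rewrite dx dy (eqP co) dvdn1 => /eqP p1.
  by rewrite p1 in pp.
by move=> /orP [] /eqP ->; lia.
Qed.

Lemma coprime_mul_prime (p x y n : nat) : prime p -> coprime x y -> (x * y = p * n)%N ->
  (exists2 x', x = p * x' & x' * y = n /\ coprime x' y)%N \/
  (exists2 y', y = p * y' & x * y' = n /\ coprime x y')%N.
Proof.
move=> pp co e; have pp0 := prime_gt0 pp.
have : (p %| x * y)%N by rewrite e dvdn_mulr.
rewrite Euclid_dvdM // => /orP [] /dvdnP [w ew]; [left | right]; exists w; rewrite 1?mulnC //.
  split; last by apply: coprime_dvdl co; rewrite ew dvdn_mulr.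
  by apply/eqP; rewrite -(eqn_pmul2l pp0) -e ew; apply/eqP; ring.
split; last by apply: coprime_dvdr co; rewrite ew dvdn_mulr.
by apply/eqP; rewrite -(eqn_pmul2l pp0) -e ew; apply/eqP; ring.
Qed.

Definition is_sq (p a : nat) : Prop := exists x : 'F_p, x ^+ 2 = a%:R.

Lemma is_sq_legendre p a : prime p -> ~~ (p %| a)%N -> legendre a p != -1 -> is_sq p a.
Proof.
move=> pp na; rewrite /legendre (negPf na); case: ifP => // /existsP [x hx] _.
exists (x : nat)%:R; rewrite -natrX expnS expn1; apply/eqP.
by rewrite -(Fp_nat_mod pp) -[a%:R](Fp_nat_mod pp) (eqP hx).
Qed.

Lemma legendre_not_sq p a : prime p -> legendre a p = -1 -> ~ is_sq p a.
Proof.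
move=> pp; rewrite /legendre; case: ifP => // na; case: ifP => // /existsP ne _ [x hx].
have hlt : (x < p)%N by rewrite -[X in (_ < X)%N](Fp_cast pp); exact: ltn_ord.
apply: ne; exists (Ordinal hlt) => /=.
have : (x : nat)%:R ^+ 2 = a%:R :> 'F_p by rewrite natr_Zp.
by rewrite -natrX expnS expn1 => /(congr1 val); rewrite /= !val_Fp_nat // => ->.
Qed.

Lemma Fp_prim_root p n : prime p -> (n %| p.-1)%N -> exists z : 'F_p, n.-primitive_root z.
Proof.
move=> pp dn; have p1 : (0 < p.-1)%N by have := prime_gt1 pp; lia.
have : has p.-1.-primitive_root (enum [pred x : 'F_p | x != 0]).
  apply: has_prim_root => //; last 2 first.
  - exact: enum_uniq.
  - by rewrite -cardE cardC1 card_Fp.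
  apply/allP => x; rewrite mem_enum inE => nx; rewrite unity_rootE.
  apply/eqP; apply: (mulfI nx); rewrite mulr1 -exprS prednK ?prime_gt0 //.
  by have := expf_card x; rewrite card_Fp.
by case/hasP => z _ hz; exists (z ^+ (p.-1 %/ n)); exact: dvdn_prim_root.
Qed.

Lemma sqr_neg1 p : prime p -> (p %% 4 = 1)%N -> exists i : 'F_p, i ^+ 2 = -1.
Proof.
move=> pp h; have [|z hz] := @Fp_prim_root p 4 pp; first by apply/dvdnP; exists (p %/ 4)%N; lia.
exists z; have := prim_expr_order hz; have n1 : z ^+ 2 != 1.
  by rewrite -(expr0 z) (eq_prim_root_expr hz).
move/eqP; rewrite (exprM z 2 2) sqrf_eq1 (negPf n1) /= => /eqP //.
Qed.

(** If [z] is a primitive eighth root of unity, then [z ^ 4 = -1] makes [z ^ 2 + z ^ -2] vanish, so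
    [z + z ^ -1] is a square root of 2. *)
Lemma sqr_two p : prime p -> (p %% 8 = 1)%N -> is_sq p 2.
Proof.
move=> pp h; have [|z hz] := @Fp_prim_root p 8 pp; first by apply/dvdnP; exists (p %/ 8)%N; lia.
have n1 : z ^+ 4 != 1 by rewrite -(expr0 z) (eq_prim_root_expr hz).
have nz : z != 0 by apply/eqP => z0; have := prim_expr_order hz; rewrite z0 expr0n => /eqP; rewrite eq_sym oner_eq0.
have e4 : z ^+ 4 = -1.
  by have /eqP := prim_expr_order hz; rewrite (exprM z 4 2) sqrf_eq1 (negPf n1) /= => /eqP.
exists (z + z^-1); have -> : (z + z^-1) ^+ 2 = (z ^+ 4 + 1) / z ^+ 2 + 2 by field.
by rewrite e4 addNr mul0r add0r.
Qed.

Lemma legendre2_mod8 p : prime p -> (p %% 4 = 1)%N -> legendre 2 p = -1 -> (p %% 8 = 5)%N.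
Proof.
move=> pp h4 hl; have : (p %% 8 = 1 \/ p %% 8 = 5)%N by lia.
by case=> // h1; case: (legendre_not_sq _ _ pp hl); exact: sqr_two.
Qed.

(** Modulo [p] the equation says that [a r ^ 2] is 1 or -1, and -1 is a square because [p] is 1
    modulo 4. *)
Lemma is_sq_unit p a r n : prime p -> (p %% 4 = 1)%N ->
  (a%:R * r ^+ 2 = 1 + p%:R * n \/ a%:R * r ^+ 2 + 1 = p%:R * n :> 'F_p) -> is_sq p a.
Proof.
move=> pp h4; have -> : p%:R = 0 :> 'F_p by rewrite pchar_Fp_0.
have [i hi] := sqr_neg1 p pp h4.
have nr (b : 'F_p) : b != 0 -> a%:R * r ^+ 2 = b -> r != 0.
  by move=> nb e; apply/eqP => r0; move: e; rewrite r0 expr0n mulr0 => /esym/eqP; rewrite (negPf nb).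
case=> e.
  have e1 : a%:R * r ^+ 2 = 1 by rewrite e mul0r addr0.
  have rn := nr 1 (oner_neq0 _) e1.
  exists r^-1; apply: (mulIf (expf_neq0 2 rn)); rewrite e1; by field.
have e1 : a%:R * r ^+ 2 = -1 by apply/eqP; rewrite -subr_eq0 opprK e mul0r.
have rn : r != 0 by apply: (nr (-1)) => //; rewrite oppr_eq0 oner_neq0.
exists (i / r); apply: (mulIf (expf_neq0 2 rn)); rewrite e1 -hi; by field.
Qed.

Lemma is_sq_unit_nat p a r n : prime p -> (p %% 4 = 1)%N ->
  (a * r ^ 2 = 1 + p * n \/ a * r ^ 2 + 1 = p * n)%N -> is_sq p a.
Proof.
move=> pp h4 e; apply: (@is_sq_unit p a r%:R n%:R) => //.
case: e => /(congr1 (fun k : nat => k%:R : 'F_p)); rewrite !(natrD, natrM, natrX) => ->; [left|right] => //.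
Qed.

Lemma mod8_sqr (r : nat) : [\/ r ^ 2 %% 8 = 0, r ^ 2 %% 8 = 1 | r ^ 2 %% 8 = 4]%N.
Proof.
have -> : (r ^ 2 %% 8 = (r %% 8) ^ 2 %% 8)%N by rewrite modnXm.
have : (r %% 8 < 8)%N by rewrite ltn_mod.
by case: (r %% 8)%N => [|[|[|[|[|[|[|[|]]]]]]]] // _; [constructor 1|constructor 2|constructor 3|constructor 2|constructor 1|constructor 2|constructor 3|constructor 2].
Qed.

(** For squares [R], [T] the residue of [5 R - 2 T] modulo 8 is one of 0, 2, 3, 4, 5, 6, never 1 or
    -1. *)
Lemma mod8_unsolvable (A B R T : nat) :
  ([\/ R %% 8 = 0, R %% 8 = 1 | R %% 8 = 4] -> [\/ T %% 8 = 0, T %% 8 = 1 | T %% 8 = 4] ->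
   ~ (A * 8 + 5 * R = 1 + (B * 8 + 2 * T) \/ A * 8 + 5 * R + 1 = B * 8 + 2 * T) /\
   ~ (B * 8 + 2 * T = 1 + (A * 8 + 5 * R) \/ B * 8 + 2 * T + 1 = A * 8 + 5 * R))%N.
Proof.
rewrite (divn_eq R 8) (divn_eq T 8) !modnMDl !modn_mod.
move: (R %/ 8)%N (T %/ 8)%N => q q'.
case=> ->; case=> ->; split => - []; lia.
Qed.

Section Split.
Variables p1 p2 : nat.
Hypotheses (pr1 : prime p1) (pr2 : prime p2) (h1 : (p1 %% 4 = 1)%N) (h2 : (p2 %% 4 = 1)%N).
Hypothesis hne : p1 != p2.
Hypothesis hleg :
  (2 <= (legendre p1 p2 == -1%R) + (legendre 2 p1 == -1%R) + (legendre 2 p2 == -1%R))%N.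

Let nd2 : ~~ (p2 %| 2)%N.
Proof. by apply/negP => /dvdn_leq; have := prime_gt1 pr2; lia. Qed.

(** The equation makes 2 a square modulo both [p1] and [p2], while at most one of the three symbols
    may differ from -1. *)
Lemma no_split_2 r s : ~ (2 * r ^ 2 = 1 + p1 * p2 * s ^ 2 \/ 2 * r ^ 2 + 1 = p1 * p2 * s ^ 2)%N.
Proof.
move=> e.
have s1 : is_sq p1 2 by apply: (@is_sq_unit_nat p1 2 r (p2 * s ^ 2)) => //; rewrite mulnA.
have s2 : is_sq p2 2 by apply: (@is_sq_unit_nat p2 2 r (p1 * s ^ 2)) => //; rewrite mulnCA mulnA.
move: hleg; case: eqP => _; case: eqP => [/legendre_not_sq|_]; case: eqP => [/legendre_not_sq|_] //; try (by move=> h; case: (h _)); by move=> _ h; case: h.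
Qed.

(** Here [p1] is a square modulo [p2], so the other two symbols must be -1. Then [p1] is 5 modulo 8,
    and the equation has no solution modulo 8. *)
Lemma no_split_p1 r s : ~ (p1 * r ^ 2 = 1 + 2 * p2 * s ^ 2 \/ p1 * r ^ 2 + 1 = 2 * p2 * s ^ 2)%N.
Proof.
move=> e.
have s2 : is_sq p2 p1.
  by apply: (@is_sq_unit_nat p2 p1 r (2 * s ^ 2)) => //; rewrite mulnCA mulnA.
have h8 : (p1 %% 8 = 5)%N.
  apply: legendre2_mod8 => //; move: hleg; case: eqP => [/legendre_not_sq h|_]; first by case: h.
  by case: eqP => //; case: eqP.
have e8 : (p1 * r ^ 2 = p1 %/ 8 * r ^ 2 * 8 + 5 * r ^ 2)%N by rewrite {1}(divn_eq p1 8) h8; ring.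
have e2 : (2 * p2 * s ^ 2 = p2 %/ 4 * s ^ 2 * 8 + 2 * s ^ 2)%N by rewrite {1}(divn_eq p2 4) h2; ring.
rewrite e8 e2 in e.
exact: (mod8_unsolvable _ _ _ _ (mod8_sqr r) (mod8_sqr s)).1 e.
Qed.

(** Here [2 p1] is a square modulo [p2], so 2 and [p1] have the same quadratic character there. Two
    symbols differing from -1 is too many, so 2 is not a square, [p2] is 5 modulo 8, and the
    equation fails modulo 8. *)
Lemma no_split_2p1 r s : ~ (2 * p1 * r ^ 2 = 1 + p2 * s ^ 2 \/ 2 * p1 * r ^ 2 + 1 = p2 * s ^ 2)%N.
Proof.
move=> e.
have s2 : is_sq p2 (2 * p1) by apply: (@is_sq_unit_nat p2 (2 * p1) r (s ^ 2)).
have h8 : (p2 %% 8 = 5)%N.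
  apply: legendre2_mod8 => //; apply/eqP; apply: contraT => nC.
  have [x hx] := is_sq_legendre _ _ pr2 nd2 nC.
  have [y hy] := s2.
  have nx : x != 0.
    apply/eqP => x0; move: hx; rewrite x0 expr0n /= => /esym/eqP.
    by rewrite -(dvdn_pcharf (pchar_Fp pr2)) (negPf nd2).
  have : is_sq p2 p1.
    exists (y / x); apply: (mulIf (expf_neq0 2 nx)); rewrite -exprMn divfK // hy hx natrM; ring.
  move=> hs; move: hleg; rewrite (negPf nC).
  by case: eqP => [hl|_]; [case: (legendre_not_sq _ _ pr2 hl hs) | case: eqP].
have e8 : (p2 * s ^ 2 = p2 %/ 8 * s ^ 2 * 8 + 5 * s ^ 2)%N by rewrite {1}(divn_eq p2 8) h8; ring.
have e2 : (2 * p1 * r ^ 2 = p1 %/ 4 * r ^ 2 * 8 + 2 * r ^ 2)%N by rewrite {1}(divn_eq p1 4) h1; ring.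
rewrite e8 e2 in e.
exact: (mod8_unsolvable _ _ _ _ (mod8_sqr s) (mod8_sqr r)).2 e.
Qed.
End Split.

Lemma pell_split p1 p2 h b : prime p1 -> prime p2 -> (p1 %% 4 = 1)%N -> (p2 %% 4 = 1)%N ->
  p1 != p2 ->
  (2 <= (legendre p1 p2 == -1%R) + (legendre 2 p1 == -1%R) + (legendre 2 p2 == -1%R))%N ->
  (h * h.+1 = 2 * p1 * p2 * b ^ 2)%N ->
  exists r s, (h = r ^ 2 /\ h.+1 = 2 * p1 * p2 * s ^ 2)%N \/ (h = 2 * p1 * p2 * s ^ 2 /\ h.+1 = r ^ 2)%N.
Proof.
move=> pr1 pr2 h1 h2 hne hleg e.
have key x y : coprime x y -> (x * y = 2 * (p1 * (p2 * b ^ 2)) -> x = y + 1 \/ x + 1 = y ->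
  exists r s, (x = r ^ 2 /\ y = 2 * p1 * p2 * s ^ 2) \/ (x = 2 * p1 * p2 * s ^ 2 /\ y = r ^ 2))%N.
  move=> co exy d.
  have sqs u v : coprime u v -> (u * v = b ^ 2 -> exists r s, u = r ^ 2 /\ v = s ^ 2)%N.
    move=> cuv euv; have [r ->] := coprime_mul_sqr _ _ _ cuv euv.
    rewrite coprime_sym in cuv; rewrite mulnC in euv.
    by have [s ->] := coprime_mul_sqr _ _ _ cuv euv; exists r, s.
  (* The eight cases record which of the two factors receives 2, [p1] and [p2]. Only the two in
     which one factor receives all three primes survive. *)
  case: (coprime_mul_prime _ _ _ _ (isT : prime 2) co exy) => [[u eu [{}exy {}co]]|[u eu [{}exy {}co]]];
  case: (coprime_mul_prime _ _ _ _ pr1 co exy) => [[u1 eu1 [{}exy {}co]]|[u1 eu1 [{}exy {}co]]];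
  case: (coprime_mul_prime _ _ _ _ pr2 co exy) => [[u2 eu2 [{}exy {}co]]|[u2 eu2 [{}exy {}co]]];
  have [r [s [er es]]] := sqs _ _ co exy; subst.
  - by exists s, r; right; split; [ring | ring].
  - exfalso; apply: (@no_split_2p1 p1 p2 pr1 pr2 h1 h2 hne hleg r s).
    by case: d => d; [left | right]; move: d; lia.
  - exfalso; apply: (@no_split_p1 p1 p2 pr1 pr2 h1 h2 hleg s r).
    by case: d => d; [right | left]; move: d; lia.
  - exfalso; apply: (@no_split_2 p1 p2 pr1 pr2 h1 h2 hleg r s).
    by case: d => d; [left | right]; move: d; lia.
  - exfalso; apply: (@no_split_2 p1 p2 pr1 pr2 h1 h2 hleg s r).
    by case: d => d; [right | left]; move: d; lia.
  - exfalso; apply: (@no_split_p1 p1 p2 pr1 pr2 h1 h2 hleg r s).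
    by case: d => d; [left | right]; move: d; lia.
  - exfalso; apply: (@no_split_2p1 p1 p2 pr1 pr2 h1 h2 hne hleg s r).
    by case: d => d; [right | left]; move: d; lia.
  - by exists r, s; left; split; [ring | ring].
have [||r [s hrs]] := key h h.+1 (coprimenS h); rewrite ?e; [ring | lia |].
by exists r, s.
Qed.

(** * Subfields of the algebraic numbers *)

Implicit Types (S : seq algC) (x y z : algC).

Section Subfields.
Variable F : algC -> Prop.
Hypothesis hF : is_subfield F.

Lemma subfield0 : F 0. Proof. by case: hF. Qed.
Lemma subfield1 : F 1. Proof. by case: hF => _ []. Qed.
Lemma subfieldD x y : F x -> F y -> F (x + y). Proof. by case: hF => _ [_ [h _]]; apply: h. Qed.
Lemma subfieldN x : F x -> F (- x). Proof. by case: hF => _ [_ [_ [h _]]]; apply: h. Qed.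
Lemma subfieldM x y : F x -> F y -> F (x * y). Proof. by case: hF => _ [_ [_ [_ [h _]]]]; apply: h. Qed.
Lemma subfieldV x : F x -> F x^-1. Proof. by case: hF => _ [_ [_ [_ [_ h]]]]; apply: h. Qed.
Lemma subfield_div x y : F x -> F y -> F (x / y). Proof. by move=> hx hy; apply: subfieldM => //; apply: subfieldV. Qed.
Lemma subfieldX x n : F x -> F (x ^+ n).
Proof. by move=> hx; elim: n => [|n ih]; [rewrite expr0; exact: subfield1 | rewrite exprS; exact: subfieldM]. Qed.
Lemma subfieldXz x (n : int) : F x -> F (x ^ n).
Proof. by move=> hx; case: n => n; [apply: subfieldX | apply: subfieldV; apply: subfieldX]. Qed.
Lemma subfield_nat n : F n%:R.
Proof. by elim: n => [|n ih]; [exact: subfield0 | rewrite -addn1 natrD; apply: subfieldD => //; exact: subfield1]. Qed.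
Lemma subfield_int (n : int) : F n%:~R.
Proof. by case: n => n; [exact: subfield_nat | rewrite NegzE mulrNz; apply: subfieldN; exact: subfield_nat]. Qed.
Lemma subfield_Crat x : x \in Crat -> F x.
Proof.
by case/CratP => a ->; rewrite -(divq_num_den a) fmorph_div !rmorph_int; apply: subfield_div; exact: subfield_int.
Qed.
End Subfields.

Lemma Qgen_subfield S : is_subfield (Qgen S).
Proof.
split; first by move=> F hF _; exact: subfield0.
split; first by move=> F hF _; exact: subfield1.
split; first by move=> x y hx hy F hF hS; apply: subfieldD => //; [apply: hx | apply: hy].
split; first by move=> x hx F hF hS; apply: subfieldN => //; apply: hx.
split; first by move=> x y hx hy F hF hS; apply: subfieldM => //; [apply: hx | apply: hy].
by move=> x hx F hF hS; apply: subfieldV => //; apply: hx.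
Qed.
#[local] Hint Resolve Qgen_subfield : core.

Lemma Qgen_mem S x : x \in S -> Qgen S x.
Proof. by move=> hx F _; apply. Qed.

Ltac sf_step := match goal with
  | h : ?P |- ?P => exact h
  | |- is_subfield _ => apply Qgen_subfield
  | |- ?F (@GRing.zero _) => refine (subfield0 F _)
  | |- ?F (@GRing.one _) => refine (subfield1 F _)
  | |- ?F (@GRing.add _ _ _) => refine (subfieldD F _ _ _ _ _)
  | |- ?F (@GRing.opp _ _) => refine (subfieldN F _ _ _)
  | |- ?F (@GRing.mul _ _ _) => refine (subfieldM F _ _ _ _ _)
  | |- ?F (@GRing.inv _ _) => refine (subfieldV F _ _ _)
  | |- ?F (@GRing.exp _ _ _) => refine (subfieldX F _ _ _ _)
  | |- ?F (@exprz _ _ _) => refine (subfieldXz F _ _ _ _)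
  | |- ?F (@GRing.natmul _ _ _) => refine (subfield_nat F _ _)
  | |- ?F (@intmul _ _ _) => refine (subfield_int F _ _)
  | |- Qgen _ _ => apply Qgen_mem; rewrite !inE eqxx ?orbT; reflexivity
  end.
Ltac sf := repeat sf_step.

Lemma Qgen_min S F x : is_subfield F -> (forall s, s \in S -> F s) -> Qgen S x -> F x.
Proof. by move=> hF hS; apply. Qed.

Lemma Qgen_sub S S' x : (forall s, s \in S -> Qgen S' s) -> Qgen S x -> Qgen S' x.
Proof. by move=> h; apply: Qgen_min. Qed.

Lemma Qgen_nil x : Qgen [::] x -> x \in Crat.
Proof.
apply: (@Qgen_min [::] (fun x => x \in Crat)) => //.
split; first exact: rpred0. split; first exact: rpred1.
split; first by move=> *; apply: rpredD. split; first by move=> *; rewrite rpredN.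
by split => [*|*]; [apply: rpredM | rewrite rpredV].
Qed.

(** Inverses come from multiplying by the conjugate [a - b r]. As [r] may already lie in [F], this
    conjugate can vanish; then [a + b r] is [2 a]. *)
Lemma adjoin_subfield F r : is_subfield F -> F (r ^+ 2) ->
  is_subfield (fun x => exists a b, F a /\ F b /\ x = a + b * r).
Proof.
move=> hF hr.
split; first by exists 0, 0; split; [sf | split; [sf | ring]].
split; first by exists 1, 0; split; [sf | split; [sf | ring]].
split.
  move=> _ _ [a [b [ha [hb ->]]]] [c [e [hc [he ->]]]].
  by exists (a + c), (b + e); split; [sf | split; [sf | ring]].
split.
  move=> _ [a [b [ha [hb ->]]]].
  by exists (- a), (- b); split; [sf | split; [sf | ring]].
split.
  move=> _ _ [a [b [ha [hb ->]]]] [c [e [hc [he ->]]]].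
  by exists (a * c + b * e * r ^+ 2), (a * e + b * c); split; [sf | split; [sf | ring]].
move=> _ [a [b [ha [hb ->]]]].
have [e0|n0] := eqVneq (a - b * r) 0.
  have -> : a + b * r = 2 * a.
    by have /eqP {1}-> : a == b * r; [rewrite -subr_eq0 e0 | move/eqP: e0; rewrite subr_eq0 => /eqP ->; ring].
  by exists (2 * a)^-1, 0; split; [sf | split; [sf | ring]].
have [e0|n1] := eqVneq (a + b * r) 0.
  by rewrite e0 invr0; exists 0, 0; split; [sf | split; [sf | ring]].
have hn : a ^+ 2 - b ^+ 2 * r ^+ 2 = (a + b * r) * (a - b * r) by ring.
exists (a / (a ^+ 2 - b ^+ 2 * r ^+ 2)), (- b / (a ^+ 2 - b ^+ 2 * r ^+ 2)).
split; [sf | split; [sf |]].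
by rewrite hn; field; rewrite n0 n1.
Qed.

Lemma Qgen_adjoin S r x : Qgen S (r ^+ 2) -> Qgen (r :: S) x ->
  exists a b, Qgen S a /\ Qgen S b /\ x = a + b * r.
Proof.
move=> hr; apply: (Qgen_min _ (fun x => exists a b, Qgen S a /\ Qgen S b /\ x = a + b * r)).
  exact: adjoin_subfield.
move=> s; rewrite inE => /orP [/eqP -> | hs].
  by exists 0, 1; split; [sf | split; [sf | ring]].
by exists s, 0; split; [exact: Qgen_mem | split; [sf | ring]].
Qed.

Lemma Qgen_morph_eq S (f g : {rmorphism algC -> algC}) x :
  (forall s, s \in S -> f s = g s) -> Qgen S x -> f x = g x.
Proof.
apply: (@Qgen_min S (fun x => f x = g x)).
split; first by rewrite !rmorph0. split; first by rewrite !rmorph1.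
split; first by move=> y z; rewrite !rmorphD => -> ->.
split; first by move=> y; rewrite !rmorphN => ->.
split; first by move=> y z; rewrite !rmorphM => -> ->.
by move=> y; rewrite !fmorphV => ->.
Qed.

Lemma Qgen_morph_id S (f : {rmorphism algC -> algC}) x :
  (forall s, s \in S -> f s = s) -> Qgen S x -> f x = x.
Proof. by move=> h; apply: (@Qgen_morph_eq S f idfun). Qed.

Lemma Qgen_morph S (f : {rmorphism algC -> algC}) x :
  (forall s, s \in S -> Qgen S (f s)) -> Qgen S x -> Qgen S (f x).
Proof.
move=> hS hx; refine (Qgen_min S (fun x => Qgen S (f x)) x _ hS hx).
split; first by rewrite rmorph0; sf. split; first by rewrite rmorph1; sf.
split; first by move=> y z hy hz; rewrite rmorphD; sf.
split; first by move=> y hy; rewrite rmorphN; sf.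
split; first by move=> y z hy hz; rewrite rmorphM; sf.
by move=> y hy; rewrite fmorphV; sf.
Qed.

Lemma Qgen_fixed S r (f : {rmorphism algC -> algC}) x :
  Qgen S (r ^+ 2) -> (forall s, s \in S -> f s = s) -> f r = - r -> r != 0 ->
  Qgen (r :: S) x -> f x = x -> Qgen S x.
Proof.
move=> hr hS hfr nr /(Qgen_adjoin _ _ _ hr) [a [b [ha [hb ->]]]].
rewrite rmorphD rmorphM /= (Qgen_morph_id S f a) // (Qgen_morph_id S f b) // hfr => /addrI h.
have h2 : 2 * (b * r) = 0.
  have -> : 2 * (b * r) = b * r - b * - r by ring.
  by rewrite h subrr.
move/eqP: h2; rewrite !mulf_eq0 (negPf nr) orbF pnatr_eq0 /= => /eqP ->.
by rewrite mul0r addr0.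
Qed.

Lemma Qgen_antifixed S r (f : {rmorphism algC -> algC}) x :
  Qgen S (r ^+ 2) -> (forall s, s \in S -> f s = s) -> f r = - r ->
  Qgen (r :: S) x -> f x = - x -> exists2 b, Qgen S b & x = b * r.
Proof.
move=> hr hS hfr /(Qgen_adjoin _ _ _ hr) [a [b [ha [hb ->]]]].
rewrite rmorphD rmorphM /= (Qgen_morph_id S f a) // (Qgen_morph_id S f b) // hfr => h.
have h2 : 2 * a = 0.
  have -> : 2 * a = (a + b * - r) + (a + b * r) by ring.
  by rewrite h; ring.
move/eqP: h2; rewrite mulf_eq0 pnatr_eq0 /= => /eqP ->.
by exists b => //; rewrite add0r.
Qed.

Lemma exist_aut (S : seq algC) (r : algC) : Qgen S (r ^+ 2) -> ~ Qgen S r ->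
  exists nu : {rmorphism algC -> algC}, (forall s, s \in S -> nu s = s) /\ nu r = - r.
Proof.
move=> hr2 hr.
have [Qs [QsC [s1 Ds1 gens1]]] := num_field_exists (r :: S).
case: s1 Ds1 gens1 => [|r1 s1] //= [Dr DS] gen.
pose E := <<1 & s1>>%VS.
have memE (x : Qs) : x \in E -> Qgen S (QsC x).
  rewrite -DS /E; elim/last_ind: s1 x {Dr DS gen E hr2 hr r1} => [|s z ih] x.
    rewrite Fadjoin_nil => /vlineP [a ->]; rewrite alg_num_field fmorph_rat.
    by apply: subfield_Crat => //; exact: Crat_rat.
  rewrite adjoin_rcons => /Fadjoin_polyP [p hp ->].
  rewrite -horner_map horner_coef /=.
  have sub y : Qgen (map QsC s) y -> Qgen (map QsC (rcons s z)) y.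
    apply: Qgen_sub => t ht; apply: Qgen_mem.
    by rewrite map_rcons mem_rcons inE ht orbT.
  apply: (big_ind (Qgen (map QsC (rcons s z)))) => [|y t hy ht|i _]; [sf | sf |].
  have hz : Qgen (map QsC (rcons s z)) (QsC z).
    by apply: Qgen_mem; rewrite map_rcons mem_rcons inE eqxx.
  have hp_i : Qgen (map QsC (rcons s z)) (map_poly QsC p)`_i.
    by rewrite coef_map; apply: sub; apply: ih; apply/polyOverP.
  by sf.
have r1E : r1 \notin E by apply/negP => /memE; rewrite Dr.
have inE2 x : Qgen S x -> exists2 y, y \in E & QsC y = x.
  apply: (@Qgen_min S (fun x => exists2 y, y \in E & QsC y = x)).
    split; first by exists 0; rewrite ?mem0v ?rmorph0.
    split; first by exists 1; rewrite ?rmorph1 ?mem1v.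
    split; first by move=> _ _ [y hy <-] [z hz <-]; exists (y + z); rewrite ?rmorphD ?memvD.
    split; first by move=> _ [y hy <-]; exists (- y); rewrite ?rmorphN ?memvN.
    split; first by move=> _ _ [y hy <-] [z hz <-]; exists (y * z); rewrite ?rmorphM ?memvM.
    by move=> _ [y hy <-]; exists (y^-1); rewrite ?fmorphV ?memvV.
  move=> s; rewrite -DS => /mapP [t ht ->]; exists t => //.
  exact: seqv_sub_adjoin.
have r2E : r1 ^+ 2 \in E.
  have [y hy e] := inE2 _ hr2; suff -> : r1 ^+ 2 = y by [].
  by apply: (fmorph_inj QsC); rewrite rmorphXn /= Dr e.
pose phi := kHomExtend E \1 r1 (- r1).
have homE : kHom 1 E (\1%VF : 'End(Qs)) by rewrite kHom1.
(* The minimal polynomial divides this monic quadratic and has degree at least 2, because [r1] is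
   not in [E]. *)
have hP : minPoly E r1 = 'X^2 - (r1 ^+ 2)%:P.
  have dv : minPoly E r1 %| 'X^2 - (r1 ^+ 2)%:P.
    apply: minPoly_dvdp; first by rewrite rpredB ?rpredX ?polyOverX ?polyOverC.
    by rewrite rootE !hornerE subrr.
  have mon : 'X^2 - (r1 ^+ 2)%:P \is monic by rewrite monicXnsubC.
  apply/eqP; rewrite -eqp_monic ?monic_minPoly //.
  rewrite -dvdp_size_eqp // size_XnsubC // eqn_leq.
  have := dvdp_leq (monic_neq0 mon) dv; rewrite size_XnsubC // => -> /=.
  by rewrite size_minPoly ltnS ltn_neqAle eq_sym adjoin_deg_eq1 r1E /= adjoin_degreeE divn_gt0 ?adim_gt0 // dimvS // subv_adjoin.
have root0 : root (map_poly \1%VF (minPoly E r1)) (- r1).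
  rewrite hP (_ : map_poly _ _ = 'X^2 - (r1 ^+ 2)%:P).
    by rewrite rootE !hornerE sqrrN subrr.
  by rewrite map_poly_id // => c _; rewrite lfunE.
have phim : monoid_morphism phi.
  apply/kHom_monoid_morphism.
  have -> : {:Qs}%VS = <<E; r1>>%VS by rewrite -gen -adjoin_rcons (eq_span (mem_rcons s1 r1)).
  by apply: kHomExtendP => //; exact: sub1v.
pose phimM := GRing.isMonoidMorphism.Build _ _ phi phim.
pose phiRM : {rmorphism _ -> _} := HB.pack (fun_of_lfun phi) phimM.
have [nu Dnu] := extend_algC_subfield_aut QsC phiRM.
exists nu; split.
  move=> s; rewrite -DS => /mapP [t ht ->]; rewrite -Dnu /=; congr (QsC _).
  by rewrite /phi kHomExtend_id ?lfunE //; exact: seqv_sub_adjoin.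
rewrite -Dr -Dnu -rmorphN; congr (QsC _); exact: (kHomExtend_val homE).
Qed.

Implicit Types (g h u v w : algC).

(** * Ideals and capitulation *)

(** A unit of the ring of all algebraic integers, with no reference to a field. Membership in a
    field is tracked separately, so that units of different fields can be multiplied and
    compared. *)
Definition aunit (u : algC) := [&& u != 0, u \in Aint & u^-1 \in Aint].

Lemma aunit_neq0 u : aunit u -> u != 0. Proof. by case/and3P. Qed.
Lemma aunit_int u : aunit u -> u \in Aint. Proof. by case/and3P. Qed.
Lemma aunitV u : aunit u -> aunit u^-1.
Proof. by case/and3P => n h1 h2; apply/and3P; rewrite invr_eq0 invrK. Qed.
Lemma aunitM u v : aunit u -> aunit v -> aunit (u * v).
Proof.
by case/and3P => n1 h1 k1 /and3P [n2 h2 k2]; apply/and3P; rewrite mulf_neq0 // invfM !rpredM.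
Qed.
Lemma aunit1 : aunit 1. Proof. by apply/and3P; rewrite invr1 oner_neq0 !rpred1. Qed.
Lemma aunitX u n : aunit u -> aunit (u ^+ n).
Proof. by move=> hu; elim: n => [|n ih]; [exact: aunit1 | rewrite exprS; exact: aunitM]. Qed.
Lemma aunitXz u (n : int) : aunit u -> aunit (u ^ n).
Proof. by move=> hu; case: n => n; [apply: aunitX | apply: aunitV; apply: aunitX]. Qed.
Lemma aunitN u : aunit u -> aunit (- u).
Proof. by case/and3P => n1 h1 k1; apply/and3P; rewrite oppr_eq0 invrN !rpredN. Qed.
Lemma aunit_div u v : aunit u -> aunit v -> aunit (u / v).
Proof. by move=> hu hv; apply: aunitM => //; exact: aunitV. Qed.
Lemma aunit_aut (f : {rmorphism algC -> algC}) u : aunit u -> aunit (f u).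
Proof. by case/and3P => n1 h1 k1; apply/and3P; rewrite fmorph_eq0 -fmorphV !Aint_aut. Qed.
Lemma aunit_norm u v w : aunit w -> u * v = w -> u \in Aint -> v \in Aint -> aunit u.
Proof.
move=> hw e hu hv; have n := aunit_neq0 _ hw.
have : u * v != 0 by rewrite e.
rewrite mulf_eq0 negb_or => /andP [nu nv].
apply/and3P; split => //; have -> : u^-1 = v * w^-1 by rewrite -e; field; rewrite nu nv.
by apply: rpredM => //; exact/aunit_int/aunitV.
Qed.

(** Substituting ['X^n] in the minimal polynomial of [x ^+ n] gives a monic integral polynomial with
    root [x]. *)
Lemma Aint_root x n : (0 < n)%N -> x ^+ n \in Aint -> x \in Aint.
Proof.
move=> n0 hx; have hp : minCpoly (x ^+ n) \is a polyOver Num.int by [].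
apply: (@root_monic_Aint (minCpoly (x ^+ n) \Po 'X^n)).
- by rewrite /root horner_comp hornerXn; exact: root_minCpoly.
- rewrite monicE lead_coef_comp ?size_polyXn //.
  by rewrite lead_coefXn expr1n mulr1 -monicE minCpoly_monic.
- by rewrite polyOver_comp // rpredX // polyOverX.
Qed.

Lemma aunit_root x n : (0 < n)%N -> aunit (x ^+ n) -> aunit x.
Proof.
move=> n0 /and3P [h1 h2 h3]; apply/and3P; split.
- by apply: contraNneq h1 => ->; rewrite expr0n; case: (n) n0.
- exact: Aint_root h2.
- by apply: (@Aint_root _ n) => //; rewrite exprVn.
Qed.

Existing Class is_subfield.
#[local] Existing Instance Qgen_subfield.

Section Ideals.
Context {F : algC -> Prop} {hF : is_subfield F}.

Lemma OK_D x y : OK F x -> OK F y -> OK F (x + y).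
Proof. by move=> [h1 h2] [h3 h4]; split; [sf | rewrite rpredD]. Qed.
Lemma OK_N x : OK F x -> OK F (- x).
Proof. by move=> [h1 h2]; split; [sf | rewrite rpredN]. Qed.
Lemma OK_M x y : OK F x -> OK F y -> OK F (x * y).
Proof. by move=> [h1 h2] [h3 h4]; split; [sf | rewrite rpredM]. Qed.
Lemma OK0 : OK F 0. Proof. by split; [sf | exact: rpred0]. Qed.
Lemma OK1 : OK F 1. Proof. by split; [sf | exact: rpred1]. Qed.
Lemma OK_int n : OK F n%:~R. Proof. by split; [sf | exact: Aint_int]. Qed.
Lemma OK_ideal : is_ideal F (OK F).
Proof.
split=> //; split; first exact: OK0.
by split; [move=> x y; exact: OK_D | move=> a x; exact: OK_M].
Qed.

Lemma idealN I x : is_ideal F I -> I x -> I (- x).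
Proof. by move=> [_ [_ [_ h]]] hx; rewrite -mulN1r; apply: h => //; apply/OK_N/OK1. Qed.

Lemma ideal_gen_mem (T : algC -> Prop) x : T x -> ideal_gen F T x.
Proof. by move=> hx J _; apply. Qed.
Lemma ideal_gen_min (T J : algC -> Prop) x : is_ideal F J -> (forall s, T s -> J s) -> ideal_gen F T x -> J x.
Proof. by move=> hJ hS; apply. Qed.
Lemma ideal_genP (T : algC -> Prop) : (forall s, T s -> OK F s) -> is_ideal F (ideal_gen F T).
Proof.
move=> hS; split; first by move=> x; apply: ideal_gen_min => //; exact: OK_ideal.
split; first by move=> J [_ []].
split; first by move=> x y hx hy J hJ hs; case: (hJ) => _ [_ [h _]]; apply: h; [apply: hx | apply: hy].
by move=> a x ha hx J hJ hs; case: (hJ) => _ [_ [_ h]]; apply: h => //; apply: hx.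
Qed.

Lemma ideal_mulP I J : is_ideal F I -> is_ideal F J -> is_ideal F (ideal_mul F I J).
Proof.
move=> [hI _] [hJ _]; apply: ideal_genP => s [x [y [hx [hy ->]]]].
by apply: OK_M; [exact: hI | exact: hJ].
Qed.
Lemma ideal_mul_mem I J x y : I x -> J y -> ideal_mul F I J (x * y).
Proof. by move=> hx hy; apply: ideal_gen_mem; exists x, y. Qed.
Lemma ideal_mul_ind I J (P : algC -> Prop) z :
  is_ideal F P -> (forall x y, I x -> J y -> P (x * y)) -> ideal_mul F I J z -> P z.
Proof. by move=> hP h; apply: ideal_gen_min => // s [x [y [hx [hy ->]]]]; exact: h. Qed.

Lemma ideal_mul_OK I J z : is_ideal F I -> is_ideal F J -> ideal_mul F I J z -> OK F z.
Proof. by move=> hI hJ hz; case: (ideal_mulP _ _ hI hJ) => h _; exact: h. Qed.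

Lemma int_ideal w : is_ideal F (fun z => OK F z /\ w * z \in Aint).
Proof.
split; first by move=> x [].
split; first by split; [exact: OK0 | rewrite mulr0 rpred0].
split; first by move=> x y [h1 h2] [h3 h4]; split; [exact: OK_D | rewrite mulrDr rpredD].
move=> a x ha [h1 h2]; split; first exact: OK_M.
by rewrite mulrCA rpredM //; case: ha.
Qed.

(** The typical target of [ideal_mul_ind]: a claim about a sum of products is put in the form
    [J (z * w)] with a fixed factor [w], possibly a fraction, and then checked on single
    products. *)
Lemma colon_ideal K J w : is_ideal K J -> (forall a, OK F a -> OK K a) -> is_ideal F (fun z => OK F z /\ J (z * w)).
Proof.
move=> [hJ [J0 [JD JM]]] hK; split; first by move=> x [].
split; first by split; [exact: OK0 | rewrite mul0r].
split; first by move=> x y [h1 h2] [h3 h4]; split; [exact: OK_D | rewrite mulrDl; exact: JD].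
move=> a x ha [h1 h2]; split; first exact: OK_M.
by rewrite -mulrA; apply: JM => //; exact: hK.
Qed.

(* [represents J g] expresses that [J] becomes the principal ideal [(g)] in any larger ring containing [g], and that [J ^ 2] is principal. *)
Definition represents J g := [/\ is_ideal F J, g != 0, (forall z, J z -> z / g \in Aint)
  & exists2 c, ideal_mul F J J c & aunit (c / g ^+ 2)].

Lemma rep_gen_neq0 c g : g != 0 -> aunit (c / g ^+ 2) -> c != 0.
Proof. by move=> ng /aunit_neq0; rewrite mulf_eq0 negb_or => /andP []. Qed.

(** Write the given [c] of [J ^ 2] as a sum of products [x y]. Then [z] is the sum of the
    [x (y z / c)], and [y z / c] is an integer of [F] because [c] is [g ^ 2] up to a unit. *)
Lemma rep_mem J g z : represents J g -> OK F z -> z / g \in Aint -> J z.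
Proof.
move=> [hJ ng hi [c hc uc]] hz hzg; have nc := rep_gen_neq0 _ _ ng uc.
have [Fc _] := ideal_mul_OK _ _ _ hJ hJ hc.
suff [_] : OK F c /\ J (c * (z / c)) by rewrite mulrC divfK.
apply: (ideal_mul_ind J J (fun w => OK F w /\ J (w * (z / c)))) hc.
  exact: (colon_ideal F).
move=> x y hx hy; case: (hJ) => [J1 [_ [_ JM]]]; split; first by apply: OK_M; exact: J1.
rewrite -mulrA mulrC; apply: JM => //; split.
  have [Fy _] := J1 _ hy; case: hz => Fz _;
  by sf.
have -> : y * (z / c) = (y / g) * (z / g) * (c / g ^+ 2)^-1 by field; rewrite nc ng.
by apply: rpredM; [apply: rpredM => //; exact: hi | exact/aunit_int/aunitV].
Qed.

Lemma rep_int J g : represents J g -> g \in Aint.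
Proof.
move=> [hJ ng hi [c hc uc]]; have nc := rep_gen_neq0 _ _ ng uc.
apply: (@Aint_root _ 2) => //.
have -> : g ^+ 2 = c * (c / g ^+ 2)^-1 by field; rewrite nc ng.
apply: rpredM; last exact/aunit_int/aunitV.
by case: (ideal_mul_OK _ _ _ hJ hJ hc).
Qed.

Lemma rep_mul_int J g J' g' z : represents J g -> represents J' g' -> ideal_mul F J J' z -> z / (g * g') \in Aint.
Proof.
move=> [hJ ng hi _] [hJ' ng' hi' _] hz; rewrite mulrC.
suff [] : OK F z /\ (g * g')^-1 * z \in Aint by [].
apply: (ideal_mul_ind J J' (fun z => OK F z /\ (g * g')^-1 * z \in Aint)) hz; first exact: int_ideal.
move=> x y hx hy; split; first by apply: OK_M; [case: hJ => h _ | case: hJ' => h _]; exact: h.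
have -> : (g * g')^-1 * (x * y) = (x / g) * (y / g') by field; rewrite ng ng'.
by rewrite rpredM ?hi ?hi'.
Qed.

Lemma rep_mul J g J' g' : represents J g -> represents J' g' -> represents (ideal_mul F J J') (g * g').
Proof.
move=> r r'; split; last 1 first.
- case: r r' => [hJ ng hi [c hc uc]] [hJ' ng' hi' [c' hc' uc']].
  have nc := rep_gen_neq0 _ _ ng uc; have nc' := rep_gen_neq0 _ _ ng' uc'.
  exists (c * c'); last first.
    have -> : c * c' / (g * g') ^+ 2 = (c / g ^+ 2) * (c' / g' ^+ 2) by field; rewrite ng ng'.
    exact: aunitM.
  have hM := ideal_mulP _ _ (ideal_mulP _ _ hJ hJ') (ideal_mulP _ _ hJ hJ').
  apply: (proj2 (A := OK F c)).
  apply: (ideal_mul_ind J J (fun w => OK F w /\ ideal_mul F (ideal_mul F J J') (ideal_mul F J J') (w * c'))) hc.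
    exact: (colon_ideal F).
  move=> x y hx hy; split; first by apply: OK_M; case: hJ => h _; exact: h.
  rewrite mulrC; apply: (proj2 (A := OK F c')).
  apply: (ideal_mul_ind J' J' (fun w => OK F w /\ ideal_mul F (ideal_mul F J J') (ideal_mul F J J') (w * (x * y)))) hc'.
    exact: (colon_ideal F).
  move=> x' y' hx' hy'; split; first by apply: OK_M; case: hJ' => h _; exact: h.
  have -> : x' * y' * (x * y) = (x * x') * (y * y') by ring.
  by apply: ideal_mul_mem; apply: ideal_mul_mem.
- by case: r r' => hJ _ _ _ [hJ' _ _ _]; exact: ideal_mulP.
- by case: r r' => _ ng _ _ [_ ng' _ _]; rewrite mulf_neq0.
- by move=> z; exact: rep_mul_int.
Qed.

Lemma rep_one : represents (OK F) 1.
Proof.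
split; [exact: OK_ideal | exact: oner_neq0 | by move=> z [_]; rewrite divr1 |].
exists 1; last by rewrite expr1n divr1 aunit1.
by rewrite -[1]mulr1; apply: ideal_mul_mem; exact: OK1.
Qed.

Lemma rep_pow J g n : represents J g -> represents (ideal_pow F J n) (g ^+ n).
Proof.
move=> r; elim: n => [|n ih]; first exact: rep_one.
by rewrite exprS; exact: rep_mul.
Qed.

Lemma rep_in_2part J g : represents J g -> in_2part F J.
Proof.
move=> r; exists 1%N; have r2 := rep_pow _ _ 2 r.
case: (r) => [hJ ng hi [c hc uc]]; have nc := rep_gen_neq0 _ _ ng uc.
have hc2 : ideal_pow F J 2 c.
  apply: (ideal_mul_ind J J (ideal_pow F J 2)) hc; first by case: r2.
  move=> x y hx hy; apply: ideal_mul_mem => //; rewrite -[y]mulr1.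
  by apply: ideal_mul_mem => //; exact: OK1.
case: r2 => [[h1 [_ [_ hM]]] _ hi2 _].
exists c; split; first exact: h1.
move=> x; split=> [hx|[y [hy ->]]]; last by rewrite mulrC; exact: hM.
exists (x / c); split; last by rewrite mulrC divfK.
split; first by case: (h1 _ hx) (h1 _ hc2) => Fx _ [Fc _]; sf.
have -> : x / c = (x / g ^+ 2) * (c / g ^+ 2)^-1 by field; rewrite nc ng.
by apply: rpredM; [exact: hi2 | exact/aunit_int/aunitV].
Qed.

Lemma rep_scale I J g x : is_ideal F I -> represents J g -> F x -> x != 0 ->
  (forall z, J z <-> exists y, I y /\ z = x * y) -> represents I (g / x).
Proof.
move=> hI [hJ ng hi [c hc uc]] Fx nx hIJ.
have nc := rep_gen_neq0 _ _ ng uc.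
split=> //; first by rewrite mulf_neq0 // invr_eq0.
  move=> z hz; have -> : z / (g / x) = (x * z) / g by field; rewrite ng nx.
  by apply: hi; apply/hIJ; exists z.
have [h1 [h2 [h3 h4]]] := ideal_mulP _ _ hI hI.
have key : OK F c /\ ideal_mul F I I (c / x ^+ 2).
  apply: (ideal_mul_ind J J (fun w => OK F w /\ ideal_mul F I I (w / x ^+ 2))) hc.
    exact: (colon_ideal F).
  move=> _ _ /hIJ [y [hy ->]] /hIJ [y' [hy' ->]].
  have [J1 _] := hJ; split.
    by apply: OK_M; apply: J1; apply/hIJ; [exists y | exists y'].
  have -> : x * y * (x * y') / x ^+ 2 = y * y' by field.
  exact: ideal_mul_mem.
exists (c / x ^+ 2); first by case: key.
by have -> : c / x ^+ 2 / (g / x) ^+ 2 = c / g ^+ 2 by field; rewrite ng nx.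
Qed.

(** An element [c] of [J ^ 2] is divisible by the square of either generator and associate to the
    square of the other, so both quotients have integral squares. *)
Lemma rep_unique J g g' : represents J g -> represents J g' -> aunit (g / g').
Proof.
move=> r r'.
have half h h' : represents J h -> represents J h' -> (h / h') \in Aint.
  move=> q q'; apply: (@Aint_root _ 2) => //.
  case: (q) => [hJ nh hi [c hc uc]]; have nc := rep_gen_neq0 _ _ nh uc.
  have nh' : h' != 0 by case: q'.
  have -> : (h / h') ^+ 2 = (c / (h' * h')) * (c / h ^+ 2)^-1 by field; rewrite nc nh nh'.
  by apply: rpredM; [exact: (rep_mul_int _ _ _ _ _ q' q' hc) | exact/aunit_int/aunitV].
have ng : g != 0 by case: r. have ng' : g' != 0 by case: r'.
apply/and3P; rewrite invf_div; split; [by rewrite mulf_neq0 // invr_eq0 | exact: half | exact: half].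
Qed.

Lemma equiv_rep J g J' g' : represents J g -> represents J' g' -> ideal_equiv F J J' ->
  exists2 x, F x /\ x != 0 & aunit (g' / (x * g)).
Proof.
move=> r r' [x [Fx [nx hx]]]; exists x => //.
have q : represents J (g' / x) by apply: (rep_scale J J' g' x) => //; case: r.
have := rep_unique _ _ _ q r; congr (aunit _).
by have ng : g != 0 by [case: r]; field; rewrite ng nx.
Qed.

Lemma rep_nz J g : represents J g -> nz_ideal F J.
Proof.
move=> r; case: (r) => [hJ ng hi [c hc uc]]; have nc := rep_gen_neq0 _ _ ng uc.
split=> //; exists c; split=> //; apply: (ideal_mul_ind J J J) hc => // x y hx hy.
by case: hJ => h [_ [_ hM]]; apply: hM => //; exact: h.
Qed.

End Ideals.
Arguments represents F J g : clear implicits.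

(** * Extension of ideals to a larger field *)

Section Extension.
Context {F K : algC -> Prop} {hF : is_subfield F} {hK : is_subfield K}.
Hypothesis FK : forall x, F x -> K x.

Let OKFK x : OK F x -> OK K x. Proof. by case=> h1 h2; split => //; exact: FK. Qed.

Lemma gen_ext_ideal I : is_ideal F I -> is_ideal K (ideal_gen K I).
Proof. by move=> [h1 _]; apply: ideal_genP => // s hs; apply/OKFK/h1. Qed.

(** To see that [g] itself lies in the extended ideal, note that [c] is a sum of products [x x']
    from [J], so [c / g] is a sum of the [(x' / g) x]; and [g] is [c / g] up to a unit. *)
Lemma rep_capitulates J g : represents F J g -> K g -> capitulates K J.
Proof.
move=> r Kg; have ag : g \in Aint by exact: rep_int r.
case: (r) => hJ ng hi [c hc uc].
have nc := rep_gen_neq0 _ _ ng uc.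
have [G1 [G0 [GD GM]]] := gen_ext_ideal _ hJ.
exists g; split; first by split.
move=> z; split=> [hz|[y [hy ->]]].
  exists (z / g); split; last by rewrite mulrC divfK.
  have Kz : K z by case: (G1 _ hz).
  split; first by sf.
  suff [] : OK K z /\ g^-1 * z \in Aint by rewrite mulrC.
  apply: (ideal_gen_min J (fun z => OK K z /\ g^-1 * z \in Aint)) hz.
    exact: int_ideal.
  by move=> s hs; split; [case: hJ => h _; apply/OKFK/h | rewrite mulrC; exact: hi].
rewrite mulrC; apply: (GM) => //.
have cg : OK F c /\ ideal_gen K J (c * g^-1).
  apply: (ideal_mul_ind J J (fun w => OK F w /\ ideal_gen K J (w * g^-1))) hc.
    exact: (colon_ideal K _ _ (gen_ext_ideal _ hJ)).
  move=> x x' hx hx'; have [J1 _] := hJ; split; first by apply: OK_M; exact: J1.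
  have -> : x * x' / g = (x' / g) * x by ring.
  apply: (GM); last exact: ideal_gen_mem.
  by split; [case: (J1 _ hx') => h _; have := FK _ h => hh; sf | exact: hi].
have -> : g = (c / g ^+ 2)^-1 * (c / g) by field; rewrite nc ng.
apply: (GM); last by case: cg.
split; last exact/aunit_int/aunitV.
have Kc : K c by case: cg => [[h _] _]; exact: FK.
by sf.
Qed.

Lemma ideal_pow_ideal I n : is_ideal F I -> is_ideal F (ideal_pow F I n).
Proof. by move=> h; elim: n => [|n ih]; [exact: OK_ideal | exact: ideal_mulP]. Qed.

(** The point is that contracting the extended ideal gives [I] back. This needs [I] to be
    invertible, which membership in the 2-part supplies. *)
Lemma capitulates_gen I : nz_ideal F I -> in_2part F I -> capitulates K I ->
  exists g, [/\ OK K g, g != 0, forall z, I z <-> OK F z /\ z / g \in Aint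
    & forall z, ideal_gen K I z <-> OK K z /\ z / g \in Aint].
Proof.
move=> [hI [x0 [hx0 nx0]]] [n [a [ha hpow]]] [g [hg hgen]].
have [G1 [G0 [GD GM]]] := gen_ext_ideal _ hI.
have ng : g != 0.
  have [y [_ e]] := (hgen x0).1 (ideal_gen_mem I x0 hx0).
  by apply: contraNneq nx0 => g0; rewrite e g0 mul0r.
have genP z : ideal_gen K I z <-> OK K z /\ z / g \in Aint.
  split=> [hz|[[Kz hz] hi]].
    by have [y [[_ hy] e]] := (hgen z).1 hz; split; [exact: G1 | rewrite e mulrC mulrA mulVf // mul1r].
  apply/hgen; exists (z / g); split; last by rewrite mulrC divfK.
  by split => //; case: hg => Kg _; sf.
exists g; split=> // z; split.
  by move=> hz; split; [case: hI => h _; exact: h | case: ((genP z).1 (ideal_gen_mem I z hz))].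
(* With [N = 2 ^ n - 1], the power [I ^ N] is an inverse of [I] up to the principal ideal [(a)].
   Writing [a] as a sum of products [x w] expresses [z] as the sum of the [x (z w / a)], where
   [z w / a] is integral. *)
move=> [hz hzg]; have [N eN] : exists N, (2 ^ n = N.+1)%N.
  by exists (2 ^ n).-1; rewrite prednK // expn_gt0.
rewrite eN in hpow.
have hI' : is_ideal F (ideal_pow F I N) by exact: ideal_pow_ideal.
have na : a != 0.
  have xN m : ideal_pow F I m (x0 ^+ m).
    by elim: m => [|m ih]; [exact: OK1 | rewrite exprS; exact: ideal_mul_mem].
  have [y [_ e]] := (hpow _).1 (xN N.+1).
  by apply: contraTneq isT => a0; move/eqP: e; rewrite a0 mul0r expf_eq0 (negPf nx0) andbF.
have ha' : ideal_mul F I (ideal_pow F I N) a.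
  by apply/hpow; exists 1; split; [exact: OK1 | rewrite mulr1].
have pint x w : I x -> ideal_pow F I N w -> x * w / a \in Aint.
  move=> hx hw; have [y [[_ hy] e]] := (hpow _).1 (ideal_mul_mem _ _ _ _ hx hw).
  by rewrite e mulrC mulrA mulVf // mul1r.
have wint w : ideal_pow F I N w -> z * w / a \in Aint.
  move=> hw; have : ideal_gen K I z by apply/genP; split => //; exact: OKFK.
  move=> hzz; suff [] : OK K z /\ w / a * z \in Aint by rewrite mulrC mulrA.
  apply: (ideal_gen_min I (fun z => OK K z /\ w / a * z \in Aint)) hzz.
    exact: int_ideal.
  move=> s hs; split; first by apply: OKFK; case: hI => h _; exact: h.
  by rewrite mulrC mulrA; exact: pint.
have [_] : OK F a /\ I (a * (z / a)).
  apply: (ideal_mul_ind I (ideal_pow F I N) (fun w => OK F w /\ I (w * (z / a)))) ha'.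
    exact: (colon_ideal F).
  move=> x w hx hw; have [I1 [_ [_ IM]]] := hI; have [P1 _] := hI'.
  split; first by apply: OK_M; [exact: I1 | exact: P1].
  have -> : x * w * (z / a) = (z * w / a) * x by ring.
  apply: (IM) => //; split; last exact: wint.
  by case: (P1 _ hw) hz ha => Fw _ [Fz _] [Fa _]; sf.
by rewrite mulrC divfK.
Qed.

(** An extended ideal is stable under automorphisms over [F], so [g] divides [f g]. Applying [f],
    which is an involution on [g], gives the reverse divisibility. *)
Lemma capitulates_aut I g (f : {rmorphism algC -> algC}) :
  is_ideal F I -> OK K g -> g != 0 ->
  (forall z, ideal_gen K I z <-> OK K z /\ z / g \in Aint) ->
  (forall x, F x -> f x = x) -> (forall x, K x -> K (f x)) -> (f (f g) = g) ->
  aunit (f g / g).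
Proof.
move=> hI hg ng genP fF fK ff.
have hgI : ideal_gen K I g by apply/genP; rewrite divff // rpred1.
have [G1 [G0 [GD GM]]] := gen_ext_ideal _ hI.
have OKf z : OK K z -> OK K (f z) by move=> [h1 h2]; split; [exact: fK | rewrite Aint_aut].
have hfg : OK K g /\ ideal_gen K I (f g).
  apply: (ideal_gen_min I (fun z => OK K z /\ ideal_gen K I (f z))) hgI.
    split; first by move=> x [].
    split; first by split; [exact: OK0 | rewrite rmorph0].
    split; first by move=> x y [h1 h2] [h3 h4]; split; [exact: OK_D | rewrite rmorphD; exact: GD].
    move=> a x ha [h1 h2]; split; first exact: OK_M.
    by rewrite rmorphM; apply: (GM) => //; exact: OKf.
  move=> s hs; have [I1 _] := hI; have hsO := I1 _ hs; split; first exact: OKFK.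
  by rewrite fF; [exact: ideal_gen_mem | case: hsO].
have hi : f g / g \in Aint by case: ((genP _).1 hfg.2).
apply/and3P; split => //; first by rewrite mulf_neq0 ?invr_eq0 ?fmorph_eq0.
by rewrite invf_div -(Aint_aut f) fmorph_div ff.
Qed.

(** Both ideals are cut out by divisibility, by [g] and by [h]; since [g] is [x h] up to a unit,
    multiplication by [x^-1] carries [I] onto [J]. *)
Lemma capitulates_equiv I g J h x : nz_ideal F I -> OK K g -> g != 0 ->
  (forall z, I z <-> OK F z /\ z / g \in Aint) ->
  represents F J h -> F x -> x != 0 -> aunit (g / (x * h)) -> ideal_equiv F I J.
Proof.
move=> [hI _] hg ng hIg r Fx nx hu; have nh : h != 0 by case: r.
exists x^-1; split; first by sf.
split; first by rewrite invr_eq0.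
move=> z; split=> [hz|[y [hy ->]]].
  exists (x * z); split; last by field.
  have hi : x * z / g \in Aint.
    have -> : x * z / g = (z / h) * (g / (x * h))^-1 by field; rewrite nh ng nx.
    by apply: rpredM; [case: r => _ _ q _; exact: q | exact/aunit_int/aunitV].
  have Fz : F z by case: r => [[q _] _ _ _]; case: (q _ hz).
  apply/hIg; split=> //; split; first by sf.
  by rewrite -[x * z](divfK ng); apply: rpredM => //; case: hg.
have [[Fy _] hi] := (hIg y).1 hy.
have hi' : x^-1 * y / h \in Aint.
  have -> : x^-1 * y / h = (y / g) * (g / (x * h)) by field; rewrite nh ng nx.
  by apply: rpredM => //; exact: aunit_int.
apply: (rep_mem _ _ _ r) => //; split; first by sf.
by rewrite -[x^-1 * y](divfK nh); apply: rpredM => //; exact: rep_int r.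
Qed.
End Extension.

Arguments aunit_neq0 {u} _.
Arguments aunit_int {u} _.
Arguments aunitV {u} _.
Arguments aunitM {u v} _ _.
Arguments aunit_div {u v} _ _.
Arguments aunit_aut f {u} _.
Arguments Qgen_nil {x} _.
Arguments Qgen_sub {S S' x} _ _ _ _ _.
Arguments aunitX {u} n _.
Arguments aunitXz {u} n _.

(** * The biquadratic field *)

Definition conjr : {rmorphism algC -> algC} := @Num.conj algC.

Lemma conjr_i : conjr 'i = - 'i. Proof. exact: conjCi. Qed.
Lemma conjr_real x : x \is Num.real -> conjr x = x. Proof. by move/CrealP. Qed.

Lemma Qgen_real S x : (forall s, s \in S -> s \is Num.real) -> Qgen S x -> x \is Num.real.
Proof.
move=> hS hx; apply/CrealP; apply: (@Qgen_morph_id S conjr) => // s hs.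
by apply/CrealP; exact: hS.
Qed.

Lemma Aint_nat n : n%:R \in Aint. Proof. by rewrite rpred_nat. Qed.

Lemma Crat_Aint_nat x n : x \in Crat -> x ^+ 2 = n%:R -> exists t, (n = t ^ 2)%N.
Proof.
move=> hx e; have ix : x \in Num.int.
  by apply: Cint_rat_Aint => //; apply: (@Aint_root _ 2) => //; rewrite e Aint_nat.
have := natr_norm_int ix; move/natrP => [t et]; exists t.
apply/eqP; rewrite -(eqr_nat algC) natrX -et -e real_normK //.
by apply: Rreal_int.
Qed.

(** The Kummer dichotomy: the nontrivial automorphism of the quadratic extension preserves [x ^ 2],
    hence sends [x] to [x] or to [- x]. *)
Lemma Qgen_sqr_cases S r x : Qgen S (r ^+ 2) -> ~ Qgen S r -> Qgen (r :: S) x -> Qgen S (x ^+ 2) ->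
  Qgen S x \/ exists2 b, Qgen S b & x = b * r.
Proof.
move=> hr2 hr hx hx2; have [f [fS fr]] := exist_aut S r hr2 hr.
have nr : r != 0 by apply/eqP => r0; apply: hr; rewrite r0; sf.
have : f x ^+ 2 = x ^+ 2 by rewrite -rmorphXn /= (Qgen_morph_id S f).
move/eqP; rewrite eqf_sqr => /orP [] /eqP fx.
  by left; apply: (Qgen_fixed S r f).
by right; apply: (Qgen_antifixed S r f).
Qed.

Lemma logn_sqr_odd p t N : prime p -> (t ^ 2 = p * N)%N -> (0 < N)%N -> ~~ (p %| N)%N -> False.
Proof.
move=> pp e N0 nd; have := congr1 (logn p) e.
rewrite lognX (lognM p (prime_gt0 pp) N0) (lognE p N) pp N0 (negPf nd) /=.
by rewrite (logn_prime p pp) eqxx; lia.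
Qed.

Set Implicit Arguments.
Unset Strict Implicit.

Lemma prime1mod4_ge5 p : prime p -> (p %% 4 = 1)%N -> (5 <= p)%N.
Proof. by move=> pp h; have := prime_gt1 pp; lia. Qed.

Lemma prime1mod4_ndvd2 p : prime p -> (p %% 4 = 1)%N -> ~~ (p %| 2)%N.
Proof. by move=> pp h; apply/negP => /dvdn_leq; have := prime1mod4_ge5 pp h; lia. Qed.

Lemma prime_ndvd p q : prime p -> prime q -> p != q -> ~~ (p %| q)%N.
Proof. by move=> pp pq; rewrite dvdn_prime2. Qed.

(** The automorphisms are taken on all of [algC]; their restrictions generate the Galois group of
    [K3] over Q(i), and each of them changes the sign of [sqrt (2 p1 p2)], so their product fixes
    [k]. *)
Record biquad (p1 p2 : nat) (s1 s2 : {rmorphism algC -> algC}) : Prop := Biquad {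
  bq_p1 : prime p1; bq_p2 : prime p2;
  bq_m1 : (p1 %% 4 = 1)%N; bq_m2 : (p2 %% 4 = 1)%N; bq_ne : p1 != p2;
  s1_2 : s1 (sqrtC 2) = sqrtC 2;
  s1_m : s1 (sqrtC (p1 * p2)%:R) = - sqrtC (p1 * p2)%:R;
  s1_i : s1 'i = 'i;
  s2_2 : s2 (sqrtC 2) = - sqrtC 2;
  s2_m : s2 (sqrtC (p1 * p2)%:R) = sqrtC (p1 * p2)%:R;
  s2_i : s2 'i = 'i }.

Section NonSquares.
Variables p1 p2 : nat.
Hypotheses (pr1 : prime p1) (pr2 : prime p2) (m1 : (p1 %% 4 = 1)%N) (m2 : (p2 %% 4 = 1)%N).
Hypothesis ne : p1 != p2.

Lemma not_sqr_2 t : (2 = t ^ 2)%N -> False.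
Proof. by move=> e; apply: (@logn_sqr_odd 2 t 1). Qed.
Lemma not_sqr_m t : (p1 * p2 = t ^ 2)%N -> False.
Proof.
move=> e; apply: (@logn_sqr_odd p1 t p2) => //; [exact: prime_gt0 | exact: prime_ndvd].
Qed.
Lemma not_sqr_2m t : (2 * p1 * p2 = t ^ 2)%N -> False.
Proof.
move=> e; apply: (@logn_sqr_odd p1 t (2 * p2)) => //; first by rewrite -e; ring.
  by rewrite muln_gt0 /= prime_gt0.
by rewrite Euclid_dvdM // negb_or prime1mod4_ndvd2 // prime_ndvd.
Qed.

Local Notation r2 := (sqrtC 2 : algC).
Local Notation rm := (sqrtC (p1 * p2)%:R : algC).
Local Notation rd := (sqrtC (2 * p1 * p2)%:R : algC).

Lemma rdE : rd = r2 * rm.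
Proof. by rewrite -mulnA natrM rootCMl // ler0n. Qed.

Lemma nat_sqrt_irr n : (forall t, n = (t ^ 2)%N -> False) -> ~ Qgen [::] (sqrtC n%:R).
Proof. by move=> h /Qgen_nil hx; have [t /h] := Crat_Aint_nat _ _ hx (sqrtCK _). Qed.

Lemma sqrt2_notin_m : ~ Qgen [:: rm] r2.
Proof.
have hq : Qgen [::] (rm ^+ 2) by rewrite sqrtCK; sf.
move=> h; case: (Qgen_sqr_cases [::] rm r2 hq (nat_sqrt_irr not_sqr_m) h); first by rewrite sqrtCK; sf.
  exact: (nat_sqrt_irr not_sqr_2).
move=> [b /Qgen_nil hb e].
(* If [sqrt 2] is [b sqrt (p1 p2)] with [b] rational, then [b p1 p2] is a rational square root of
   [2 p1 p2]. *)
have e2 : (b * (p1 * p2)%:R) ^+ 2 = (2 * p1 * p2)%:R.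
  have : r2 ^+ 2 = (b * rm) ^+ 2 by rewrite e.
  by rewrite exprMn !sqrtCK exprMn -mulnA (natrM _ 2) => ->; ring.
have hr : b * (p1 * p2)%:R \in Crat by rewrite rpredM // rpred_nat.
by have [t /not_sqr_2m] := Crat_Aint_nat _ _ hr e2.
Qed.

Lemma sqrtm_notin_2 : ~ Qgen [:: r2] rm.
Proof.
have hq : Qgen [::] (r2 ^+ 2) by rewrite sqrtCK; sf.
move=> h; case: (Qgen_sqr_cases [::] r2 rm hq (nat_sqrt_irr not_sqr_2) h); first by rewrite sqrtCK; sf.
  exact: (nat_sqrt_irr not_sqr_m).
move=> [b /Qgen_nil hb e].
have e2 : (b * 2) ^+ 2 = (2 * p1 * p2)%:R.
  have : rm ^+ 2 = (b * r2) ^+ 2 by rewrite e.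
  by rewrite exprMn !sqrtCK exprMn -mulnA (natrM _ 2) => ->; ring.
have hr : b * 2 \in Crat by rewrite rpredM // rpred_nat.
by have [t /not_sqr_2m] := Crat_Aint_nat _ _ hr e2.
Qed.

Lemma sqrt_nat_real n : sqrtC n%:R \is @Num.real algC.
Proof. by rewrite ger0_real // sqrtC_ge0 ler0n. Qed.

(** The square root is real, so complex conjugation removes ['i] from the generators. *)
Lemma sqrtm_notin_2i : ~ Qgen [:: r2; 'i] rm.
Proof.
move=> h; apply: sqrtm_notin_2.
apply: (@Qgen_fixed [:: r2] 'i conjr); rewrite ?neq0Ci ?conjr_i ?sqrCi //; try by sf.
- by move=> s; rewrite inE => /eqP ->; apply: conjr_real; exact: sqrt_nat_real.
- by apply: (Qgen_sub _ h) => s; rewrite !inE => /orP [] /eqP ->; sf.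
- by apply: conjr_real; exact: sqrt_nat_real.
Qed.

Lemma sqrt2_notin_mi : ~ Qgen [:: rm; 'i] r2.
Proof.
move=> h; apply: sqrt2_notin_m.
apply: (@Qgen_fixed [:: rm] 'i conjr); rewrite ?neq0Ci ?conjr_i ?sqrCi //; try by sf.
- by move=> s; rewrite inE => /eqP ->; apply: conjr_real; exact: sqrt_nat_real.
- by apply: (Qgen_sub _ h) => s; rewrite !inE => /orP [] /eqP ->; sf.
- by apply: conjr_real; exact: sqrt_nat_real.
Qed.

Lemma biquad_exists : exists s1 s2, biquad p1 p2 s1 s2.
Proof.
have [|s1 [h1 h1']] := exist_aut [:: r2; 'i] rm _ sqrtm_notin_2i; first by rewrite sqrtCK; sf.
have [|s2 [h2 h2']] := exist_aut [:: rm; 'i] r2 _ sqrt2_notin_mi; first by rewrite sqrtCK; sf.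
by exists s1, s2; split => //; first [apply: h1 | apply: h2]; rewrite !inE eqxx ?orbT.
Qed.
End NonSquares.

Section Fields.
Variables (p1 p2 : nat) (s1 s2 : {rmorphism algC -> algC}).
Hypothesis H : biquad p1 p2 s1 s2.

Local Notation r2 := (sqrtC 2 : algC).
Local Notation rm := (sqrtC (p1 * p2)%:R : algC).
Local Notation rd := (sqrtC (2 * p1 * p2)%:R : algC).
Local Notation k := (Qgen [:: rd; 'i]).
Local Notation K := (Qgen [:: r2; rm; 'i]).
Local Notation K0 := (Qgen [:: r2; rm]).
Local Notation Q2 := (Qgen [:: r2]).
Local Notation Qm := (Qgen [:: rm]).
Local Notation Qd := (Qgen [:: rd]).

Definition sigma : {rmorphism algC -> algC} := s1 \o s2.
Local Notation sg := sigma.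
Lemma sgE x : sg x = s1 (s2 x). Proof. by []. Qed.

Let rdE' : rd = r2 * rm := rdE p1 p2.
Lemma s1_d : s1 rd = - rd. Proof. by rewrite rdE' rmorphM (s1_2 H) (s1_m H) mulrN. Qed.
Lemma s2_d : s2 rd = - rd. Proof. by rewrite rdE' rmorphM (s2_2 H) (s2_m H) mulNr. Qed.
Lemma sg_d : sg rd = rd. Proof. by rewrite sgE s2_d rmorphN s1_d opprK. Qed.
Lemma sg_2 : sg r2 = - r2. Proof. by rewrite sgE (s2_2 H) rmorphN (s1_2 H). Qed.
Lemma sg_m : sg rm = - rm. Proof. by rewrite sgE (s2_m H) (s1_m H). Qed.
Lemma sg_i : sg 'i = 'i. Proof. by rewrite sgE (s2_i H) (s1_i H). Qed.

Lemma r2_neq0 : r2 != 0. Proof. by rewrite sqrtC_eq0 pnatr_eq0. Qed.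
Lemma m_neq0 : (p1 * p2)%:R != 0 :> algC.
Proof. by rewrite pnatr_eq0 muln_eq0 negb_or -!lt0n !prime_gt0 ?(bq_p1 H) ?(bq_p2 H). Qed.
Lemma rm_neq0 : rm != 0. Proof. by rewrite sqrtC_eq0 m_neq0. Qed.
Lemma rd_neq0 : rd != 0. Proof. by rewrite rdE' mulf_neq0 ?r2_neq0 ?rm_neq0. Qed.

Ltac gens := move=> ?; rewrite ?inE; repeat (case/orP); move=> /eqP ->.

Lemma K_of_k x : k x -> K x.
Proof. by apply: Qgen_sub; gens; rewrite ?rdE'; sf. Qed.
Lemma K_of_K0 x : K0 x -> K x. Proof. by apply: Qgen_sub; gens; sf. Qed.
Lemma K0_of_Q2 x : Q2 x -> K0 x. Proof. by apply: Qgen_sub; gens; sf. Qed.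
Lemma K0_of_Qm x : Qm x -> K0 x. Proof. by apply: Qgen_sub; gens; sf. Qed.
Lemma K0_of_Qd x : Qd x -> K0 x. Proof. by apply: Qgen_sub; gens; rewrite rdE'; sf. Qed.
Lemma k_of_Qd x : Qd x -> k x. Proof. by apply: Qgen_sub; gens; sf. Qed.

Lemma K_gen_k x : K x -> Qgen (r2 :: [:: rd; 'i]) x.
Proof.
apply: Qgen_sub; gens; try by sf.
have -> : rm = rd / r2 by rewrite rdE' mulrAC divff ?r2_neq0 // mul1r.
by sf.
Qed.
Lemma K_gen_K0 x : K x -> Qgen ('i :: [:: r2; rm]) x. Proof. by apply: Qgen_sub; gens; sf. Qed.
Lemma K0_gen_Qd x : K0 x -> Qgen (r2 :: [:: rd]) x.
Proof.
apply: Qgen_sub; gens; try by sf.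
have -> : rm = rd / r2 by rewrite rdE' mulrAC divff ?r2_neq0 // mul1r.
by sf.
Qed.
Lemma K0_gen_Q2 x : K0 x -> Qgen (rm :: [:: r2]) x. Proof. by apply: Qgen_sub; gens; sf. Qed.

Let s12 := s1_2 H. Let s1m := s1_m H. Let s1i := s1_i H.
Let s22 := s2_2 H. Let s2m := s2_m H. Let s2i := s2_i H.

Lemma sg_k x : k x -> sg x = x.
Proof. by apply: Qgen_morph_id; gens; rewrite ?sg_d ?sg_i. Qed.
Lemma sg_Qd x : Qd x -> sg x = x. Proof. by move=> /k_of_Qd; exact: sg_k. Qed.
Lemma s1_Q2 x : Q2 x -> s1 x = x. Proof. by apply: Qgen_morph_id; gens. Qed.
Lemma s2_Qm x : Qm x -> s2 x = x. Proof. by apply: Qgen_morph_id; gens. Qed.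
Lemma s1_s2_Qd x : Qd x -> s2 x = s1 x.
Proof. by apply: Qgen_morph_eq; gens; rewrite s1_d s2_d. Qed.
Lemma K0_real x : K0 x -> x \is Num.real.
Proof. by apply: Qgen_real; gens; exact: sqrt_nat_real. Qed.
Lemma conj_K0 x : K0 x -> conjr x = x. Proof. by move/K0_real; exact: conjr_real. Qed.

Lemma K_s1 x : K x -> K (s1 x).
Proof. by apply: Qgen_morph; gens; rewrite ?s12 ?s1m ?s1i; sf. Qed.
Lemma K_s2 x : K x -> K (s2 x).
Proof. by apply: Qgen_morph; gens; rewrite ?s22 ?s2m ?s2i; sf. Qed.
Lemma K_sg x : K x -> K (sg x). Proof. by move=> h; rewrite sgE; exact: (K_s1 (K_s2 h)). Qed.
Lemma K_conj x : K x -> K (conjr x).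
Proof. by apply: Qgen_morph; gens; rewrite ?conjr_i ?conjr_real ?sqrt_nat_real //; sf. Qed.
Lemma k_conj x : k x -> k (conjr x).
Proof. by apply: Qgen_morph; gens; rewrite ?conjr_i ?conjr_real ?sqrt_nat_real //; sf. Qed.
Lemma K0_s1 x : K0 x -> K0 (s1 x).
Proof. by apply: Qgen_morph; gens; rewrite ?s12 ?s1m; sf. Qed.
Lemma K0_s2 x : K0 x -> K0 (s2 x).
Proof. by apply: Qgen_morph; gens; rewrite ?s22 ?s2m; sf. Qed.
Lemma K0_sg x : K0 x -> K0 (sg x). Proof. by move=> h; rewrite sgE; exact: (K0_s1 (K0_s2 h)). Qed.
Lemma Q2_s2 x : Q2 x -> Q2 (s2 x). Proof. by apply: Qgen_morph; gens; rewrite s22; sf. Qed.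
Lemma Qm_s1 x : Qm x -> Qm (s1 x). Proof. by apply: Qgen_morph; gens; rewrite s1m; sf. Qed.
Lemma Qd_s1 x : Qd x -> Qd (s1 x). Proof. by apply: Qgen_morph; gens; rewrite s1_d; sf. Qed.
Lemma k_s1 x : k x -> k (s1 x). Proof. by apply: Qgen_morph; gens; rewrite ?s1_d ?s1i; sf. Qed.

Lemma s1_s1 x : K x -> s1 (s1 x) = x.
Proof. by apply: (@Qgen_morph_id _ (s1 \o s1)); gens => /=; rewrite ?s12 ?s1m ?s1i ?rmorphN ?s1m ?opprK. Qed.
Lemma s2_s2 x : K x -> s2 (s2 x) = x.
Proof. by apply: (@Qgen_morph_id _ (s2 \o s2)); gens => /=; rewrite ?s22 ?s2m ?s2i ?rmorphN ?s22 ?opprK. Qed.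
Lemma s2_s1 x : K x -> s2 (s1 x) = s1 (s2 x).
Proof.
apply: (@Qgen_morph_eq _ (s2 \o s1) (s1 \o s2)); gens => /=;
by rewrite ?s22 ?s2m ?s2i ?s12 ?s1m ?s1i ?rmorphN ?s12 ?s22 ?s1m ?s2m.
Qed.
Lemma sg_sg x : K x -> sg (sg x) = x.
Proof. by move=> h; rewrite !sgE s2_s1 ?s2_s2 ?s1_s1 //; exact: K_s2. Qed.
Lemma s1_conj x : K x -> s1 (conjr x) = conjr (s1 x).
Proof.
apply: (@Qgen_morph_eq _ (s1 \o conjr) (conjr \o s1)); gens => /=;
by rewrite ?s1i ?conjr_i ?rmorphN ?s1i // ?s12 ?s1m ?conjr_real ?rpredN ?sqrt_nat_real // ?s12 ?s1m.
Qed.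
Lemma s2_conj x : K x -> s2 (conjr x) = conjr (s2 x).
Proof.
apply: (@Qgen_morph_eq _ (s2 \o conjr) (conjr \o s2)); gens => /=;
by rewrite ?s2i ?conjr_i ?rmorphN ?s2i // ?s22 ?s2m ?conjr_real ?rpredN ?sqrt_nat_real // ?s22 ?s2m.
Qed.
Lemma sg_conj x : K x -> sg (conjr x) = conjr (sg x).
Proof. by move=> h; rewrite !sgE s2_conj // s1_conj //; exact: K_s2. Qed.

Lemma fixed_k x : K x -> sg x = x -> k x.
Proof.
move=> /K_gen_k; apply: Qgen_fixed; rewrite ?sqrtCK ?sg_2 ?r2_neq0 //; first by sf.
by gens; rewrite ?sg_d ?sg_i.
Qed.
Lemma antifixed_k x : K x -> sg x = - x -> exists2 b, k b & x = b * r2.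
Proof.
move=> /K_gen_k; apply: Qgen_antifixed; rewrite ?sqrtCK ?sg_2 ?r2_neq0 //; first by sf.
by gens; rewrite ?sg_d ?sg_i.
Qed.
Lemma fixed_K0 x : K x -> conjr x = x -> K0 x.
Proof.
move=> /K_gen_K0; apply: Qgen_fixed; rewrite ?sqrCi ?conjr_i ?neq0Ci //; first by sf.
by gens; rewrite conjr_real ?sqrt_nat_real.
Qed.
Lemma fixed_Q2 x : K0 x -> s1 x = x -> Q2 x.
Proof.
move=> /K0_gen_Q2; apply: Qgen_fixed; rewrite ?sqrtCK ?s1m ?rm_neq0 //; first by sf.
by gens.
Qed.
Lemma fixed_Qm x : K0 x -> s2 x = x -> Qm x.
Proof.
apply: Qgen_fixed; rewrite ?sqrtCK ?s22 ?r2_neq0 //; first by sf.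
by gens.
Qed.
Lemma fixed_Qd x : K0 x -> sg x = x -> Qd x.
Proof.
move=> /K0_gen_Qd; apply: Qgen_fixed; rewrite ?sqrtCK ?sg_2 ?r2_neq0 //; first by sf.
by gens; rewrite sg_d.
Qed.
Lemma fixed_Q_d x : Qd x -> s1 x = x -> x \in Crat.
Proof.
move=> h hx; apply: Qgen_nil; apply: (Qgen_fixed [::] rd s1) => //; rewrite ?sqrtCK ?s1_d ?rd_neq0 //.
by sf.
Qed.
Lemma fixed_Q_m x : Qm x -> s1 x = x -> x \in Crat.
Proof.
move=> h hx; apply: Qgen_nil; apply: (Qgen_fixed [::] rm s1) => //; rewrite ?sqrtCK ?s1m ?rm_neq0 //.
by sf.
Qed.
Lemma fixed_Q_2 x : Q2 x -> s2 x = x -> x \in Crat.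
Proof.
move=> h hx; apply: Qgen_nil; apply: (Qgen_fixed [::] r2 s2) => //; rewrite ?sqrtCK ?s22 ?r2_neq0 //.
by sf.
Qed.
Lemma fixed_Q x : K0 x -> s1 x = x -> s2 x = x -> x \in Crat.
Proof. by move=> h h1; apply: fixed_Q_2; exact: fixed_Q2. Qed.
End Fields.

Implicit Types (a b c n : int).

(** * Fundamental units *)

Lemma is_unitP F u : is_subfield F -> is_unit F u <-> F u /\ aunit u.
Proof.
move=> hF; split; first by move=> [h1 [[h2 h3] [h4 h5]]]; split => //; apply/and3P.
by move=> [h /and3P [h1 h2 h3]]; do !split => //; sf.
Qed.

Lemma Crat_aunit x : x \in Crat -> aunit x -> x = 1 \/ x = -1.
Proof.
move=> hx /and3P [nx ix ivx].
have /intrP [n en] : x \in Num.int by exact: Cint_rat_Aint.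
have /intrP [n' en'] : x^-1 \in Num.int by apply: Cint_rat_Aint => //; rewrite rpredV.
have : n * n' = 1 by apply: (@intr_inj algC); rewrite rmorphM /= -en -en' divff.
move/(congr1 absz)/eqP; rewrite abszM muln_eq1 => /andP [/eqP hn _].
have : n = 1 \/ n = -1 by lia.
by rewrite en => - [] ->; [left | right].
Qed.

Lemma sign_int n : (-1 : algC) ^ n = 1 \/ (-1 : algC) ^ n = -1.
Proof.
have h (k : nat) : (-1 : algC) ^+ k = 1 \/ (-1 : algC) ^+ k = -1.
  by rewrite -signr_odd; case: (odd k); [right | left].
by case: n => k; [exact: h | rewrite NegzE -exprz_inv invrN1; exact: h].
Qed.

Lemma expz2 x : x ^ 2 = x ^+ 2. Proof. by []. Qed.

Lemma int_parity n : exists q (b : bool), n = 2 * q + b%:Z.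
Proof. by exists (n %/ 2)%Z, (n %% 2 == 1)%Z; lia. Qed.

Lemma sign_even n : (-1 : algC) ^ n = 1 -> exists q, n = 2 * q.
Proof.
have [q [b ->]] := int_parity n; rewrite expfzDr ?oppr_eq0 ?oner_neq0 // -exprz_exp.
rewrite expz2 sqrrN expr1n exp1rz mul1r; case: b => [|_]; last by exists q; rewrite addr0.
by move/eqP; rewrite expr1z eqNr oner_eq0.
Qed.

Lemma sign_double q : (-1 : algC) ^ (2 * q) = 1.
Proof. by rewrite -exprz_exp expz2 sqrrN expr1n exp1rz. Qed.

Lemma expz_inj_gt1 x a b : 1 < x -> x ^ a = x ^ b -> a = b.
Proof.
move=> x1 e; have x0 : 0 < x := lt_trans ltr01 x1.
have nx : x != 0 by rewrite gt_eqF.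
have key (n : nat) : x ^+ n.+1 != 1 by rewrite gt_eqF // exprn_egt1.
have : x ^ (a - b) = 1 by rewrite expfzDr // -exprz_inv exprz_inv -invr_expz e divff // expfz_neq0.
case e2: (a - b) => [[|k]|k]; first by move/eqP: e2; rewrite subr_eq0 => /eqP.
  by move/eqP; rewrite (negPf (key k)).
by rewrite NegzE -invr_expz => /eqP; rewrite invr_eq1 (negPf (key k)).
Qed.

Section FundUnit.
Variables (d : nat) (e : algC).
Hypothesis he : fund_unit d e.
Lemma fund_mem : Qgen [:: sqrtC d%:R] e. Proof. by case: he => [[_ [[]]]]. Qed.
Lemma fund_aunit : aunit e.
Proof. by case: he => /is_unitP h _; case: h. Qed.
Lemma fund_gt1 : 1 < e. Proof. by case: he => _ []. Qed.
Lemma fund_gen u : Qgen [:: sqrtC d%:R] u -> aunit u -> exists (s : bool) n, u = (-1) ^+ s * e ^ n.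
Proof. by move=> h1 h2; case: he => _ [_]; apply; apply/is_unitP. Qed.
Lemma fund_neq0 : e != 0. Proof. exact/aunit_neq0/fund_aunit. Qed.
Lemma fund_not_sqr u n : Qgen [:: sqrtC d%:R] u -> u ^+ 2 = e ^ (2 * n + 1) -> False.
Proof.
move=> hu eu; have hu2 : aunit u by apply: (@aunit_root u 2) => //; rewrite eu; apply/aunitXz/fund_aunit.
have [s [j ej]] := fund_gen hu hu2.
move: eu; rewrite ej exprMn -exprM mulnC exprM sqrrN expr1n expr1n mul1r.
rewrite -expz2 exprz_exp => /(expz_inj_gt1 fund_gt1); lia.
Qed.
End FundUnit.

(** For equal primes the field is that of the rationals, whose only units are 1 and -1, and none
    exceeds 1. Distinctness of the primes thus comes from the existence of [eps2]. *)
Lemma fund_unit_ne p1 p2 e : fund_unit (p1 * p2) e -> p1 != p2.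
Proof.
move=> he; apply/eqP => e12; subst p2.
have hx : Qgen [::] e.
  apply: Qgen_sub (fund_mem he) => s; rewrite inE => /eqP ->.
  by rewrite natrM -expr2 sqrCK ?ler0n //; sf.
case: (Crat_aunit (Qgen_nil hx) (fund_aunit he)) => e1; have := fund_gt1 he; rewrite e1 ?ltxx //.
by rewrite lt_gtF // (lt_trans (ltrN10 _)) ?ltr01.
Qed.

Section Units.
Variables (p1 p2 : nat) (s1 s2 : {rmorphism algC -> algC}).
Hypothesis H : biquad p1 p2 s1 s2.
Variables e1 e2 e3 : algC.
Hypotheses (f1 : fund_unit 2 e1) (f2 : fund_unit (p1 * p2) e2) (f3 : fund_unit (2 * p1 * p2) e3).

Local Notation r2 := (sqrtC 2 : algC).
Local Notation rm := (sqrtC (p1 * p2)%:R : algC).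
Local Notation rd := (sqrtC (2 * p1 * p2)%:R : algC).

Lemma aunit_sqrt2p1 : aunit (1 + r2).
Proof.
have h : (1 + r2) * (r2 - 1) = 1.
  have -> : (1 + r2) * (r2 - 1) = r2 ^+ 2 - 1 by ring.
  by rewrite sqrtCK; ring.
have i2 : r2 \in Aint by apply: (@Aint_root _ 2) => //; rewrite sqrtCK Aint_nat.
by apply: (aunit_norm _ _ 1 aunit1 h); [apply: rpredD | apply: rpredB]; rewrite ?rpred1.
Qed.

(** The unit [1 + sqrt 2] has norm -1 and is a power of [e1], so the norm of [e1] cannot be 1 and
    the exponent is odd. *)
Lemma norm_e1_sub : exists2 n, 1 + r2 = e1 ^ n & (-1 : algC) ^ n = -1 /\ s2 e1 = - e1^-1.
Proof.
have [|s [n en]] := fund_gen f1 (u := 1 + r2) _ aunit_sqrt2p1; first by sf.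
have e10 : 0 < e1 := lt_trans ltr01 (fund_gt1 f1).
have ne1 := fund_neq0 f1.
have r2p : 0 < 1 + r2 by rewrite addr_gt0 ?ltr01 // sqrtC_gt0 ltr0n.
have s0 : s = false.
  case: s en => // en; move: r2p; rewrite en expr1 mulN1r oppr_gt0 => h.
  by have := exprz_gt0 n e10; rewrite lt_gtF.
rewrite s0 expr0 mul1r in en.
have hN : (1 + r2) * s2 (1 + r2) = -1.
  rewrite rmorphD rmorph1 (s2_2 H).
  have -> : (1 + r2) * (1 - r2) = 1 - r2 ^+ 2 by ring.
  by rewrite sqrtCK; ring.
have : (e1 * s2 e1) ^ n = -1 by rewrite expfzMl -fmorphXz -en hN.
have hq : e1 * s2 e1 \in Crat.
  apply: (fixed_Q_2 H).
    by have h := fund_mem f1; have h' := Q2_s2 H h; sf.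
  rewrite rmorphM (s2_s2 H) 1?mulrC //.
  exact: (K_of_K0 (K0_of_Q2 (fund_mem f1))).
have hu : aunit (e1 * s2 e1) by apply: aunitM; [|apply: aunit_aut]; exact: (fund_aunit f1).
case: (Crat_aunit hq hu) => eN; rewrite eN.
  by rewrite exp1rz => /eqP; rewrite eq_sym eqNr oner_eq0.
move=> hn; exists n => //; split => //.
by apply: (mulfI ne1); rewrite eN mulrN divff.
Qed.
End Units.

Lemma Crat_Aint_natP x : x \in Crat -> x \in Aint -> 0 <= x -> exists t : nat, x = t%:R.
Proof.
move=> h1 h2 h3; apply/natrP; rewrite natrEint h3 andbT; exact: Cint_rat_Aint.
Qed.

(** Put [d = 2 p1 p2]. It is squarefree, so it divides [D], and [D = d s] gives
    [t ^ 2 - d s ^ 2 = 4]. Parity then makes [t] and [s] even, [t / 2] odd and [s / 2] even. *)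
Lemma pell_descent (p1 p2 D t : nat) : prime p1 -> prime p2 -> (p1 %% 4 = 1)%N -> (p2 %% 4 = 1)%N ->
  p1 != p2 -> (D ^ 2 + 4 * (2 * p1 * p2) = 2 * p1 * p2 * t ^ 2)%N ->
  exists h b : nat, (t = 4 * h + 2 /\ h * h.+1 = 2 * p1 * p2 * b ^ 2)%N.
Proof.
move=> pr1 pr2 m1 m2 ne e.
have o1 : odd p1 by rewrite (divn_eq p1 4) m1 oddD oddM andbF.
have o2 : odd p2 by rewrite (divn_eq p2 4) m2 oddD oddM andbF.
have dq q : prime q -> (q %| 2 * p1 * p2 -> q %| D)%N.
  move=> pq dv; have : (q %| D ^ 2 + 4 * (2 * p1 * p2))%N by rewrite e dvdn_mulr.
  by rewrite (dvdn_addl _ (dvdn_mull 4 dv)) Euclid_dvdX // => /andP [].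
have co1 : coprime 2 p1 by rewrite coprime2n.
have co2 : coprime (2 * p1) p2.
  by rewrite coprimeMl coprime2n o2 prime_coprime // dvdn_prime2.
have /dvdnP [s es] : (2 * p1 * p2 %| D)%N.
  rewrite !Gauss_dvd //; apply/andP; split; [apply/andP; split|]; apply: dq => //.
  - by rewrite -mulnA dvdn_mulr.
  - by rewrite mulnAC dvdn_mull.
  - by rewrite dvdn_mull.
have p0 : (0 < 2 * p1 * p2)%N by rewrite !muln_gt0 !prime_gt0.
have e1 : (2 * p1 * p2 * s ^ 2 + 4 = t ^ 2)%N.
  by apply/eqP; rewrite -(eqn_pmul2l p0) -e es; apply/eqP; ring.
have ot : ~~ odd t.
  by move: (congr1 odd e1); rewrite oddD !oddM ?oddX /=; case: (odd t).
have [a ea] : exists a : nat, t = (2 * a)%N by exists t./2; rewrite mul2n even_halfK.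
have e2 : (p1 * p2 * s ^ 2 + 2 = 2 * a ^ 2)%N.
  by apply/eqP; rewrite -(@eqn_pmul2l 2) // ; apply/eqP; move: e1; rewrite ea; lia.
have os : ~~ odd s.
  by move: (congr1 odd e2); rewrite oddD !oddM ?oddX /= o1 o2; case: (odd s).
have [b eb] : exists b : nat, s = (2 * b)%N by exists s./2; rewrite mul2n even_halfK.
have e3 : (2 * p1 * p2 * b ^ 2 + 1 = a ^ 2)%N by move: e2; rewrite eb; lia.
have oa : odd a.
  by move: (congr1 odd e3); rewrite oddD !oddM ?oddX /=; case: (odd a).
have [h eh] : exists h : nat, a = (2 * h + 1)%N.
  by exists a./2; rewrite -{1}(odd_double_half a) oa mul2n addnC.
have e4 : (p1 * p2 * b ^ 2 = 2 * (h * h.+1))%N by move: e3; rewrite eh; lia.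
have ob : ~~ odd b.
  by move: (congr1 odd e4); rewrite !oddM ?oddX /= o1 o2; case: (odd b).
have [b' eb'] : exists b' : nat, b = (2 * b')%N by exists b./2; rewrite mul2n even_halfK.
exists h, b'; split; first by rewrite ea eh; lia.
by move: e4; rewrite eb'; lia.
Qed.

(** * The norm of the third fundamental unit *)

Section NormMinusOne.
Variables (p1 p2 : nat) (s1 s2 : {rmorphism algC -> algC}).
Hypothesis H : biquad p1 p2 s1 s2.
Hypothesis hleg :
  (2 <= (legendre p1 p2 == -1%R) + (legendre 2 p1 == -1%R) + (legendre 2 p2 == -1%R))%N.
Variable e3 : algC.
Hypothesis f3 : fund_unit (2 * p1 * p2) e3.
Local Notation rd := (sqrtC (2 * p1 * p2)%:R : algC).
Local Notation Qd := (Qgen [:: rd]).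

(** With norm 1, [t = e3 + e3^-1] and [D = (e3 - e3^-1) sqrt d] are positive integers with
    [D ^ 2 = d (t ^ 2 - 4)]. Descent and splitting then produce a square root of [e3] or of its
    inverse in the quadratic field. *)
Lemma norm_e3 : s1 e3 = - e3^-1.
Proof.
have ne := fund_neq0 f3; have he := fund_mem f3; have ue := fund_aunit f3.
have e1 := fund_gt1 f3.
have e0 : 0 < e3 := lt_trans ltr01 e1.
have hs := Qd_s1 H he; have sd := s1_d H.
have ss : s1 (s1 e3) = e3 by apply: (s1_s1 H); exact: (K_of_K0 (K0_of_Qd he)).
have hq : e3 * s1 e3 \in Crat.
  by apply: (fixed_Q_d H); [sf | rewrite rmorphM ss mulrC].
have hu : aunit (e3 * s1 e3) by apply: aunitM => //; exact: aunit_aut.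
case: (Crat_aunit hq hu) => eN; last by apply: (mulfI ne); rewrite eN mulrN divff.
exfalso.
have es : s1 e3 = e3^-1 by apply: (mulfI ne); rewrite eN divff.
have iv1 : e3^-1 < 1 by rewrite invf_lt1.
have dpos : 0 < rd by rewrite sqrtC_gt0 ltr0n !muln_gt0 !prime_gt0 ?(bq_p1 H) ?(bq_p2 H).
have [t et] : exists t : nat, e3 + e3^-1 = t%:R.
  apply: Crat_Aint_natP; last by rewrite addr_ge0 ?invr_ge0 ?ltW.
    by apply: (fixed_Q_d H); [sf | rewrite rmorphD fmorphV es invrK addrC].
  by rewrite rpredD // aunit_int // aunitV.
have [D eD] : exists D : nat, (e3 - e3^-1) * rd = D%:R.
  apply: Crat_Aint_natP.
  - apply: (fixed_Q_d H); first by sf.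
    by rewrite rmorphM rmorphB fmorphV es invrK sd; ring.
  - apply: rpredM; first by rewrite rpredB // aunit_int // aunitV.
    by apply: (@Aint_root _ 2) => //; rewrite sqrtCK Aint_nat.
  - by rewrite mulr_ge0 ?ltW // subr_gt0 (lt_trans iv1).
have eDt : (D ^ 2 + 4 * (2 * p1 * p2) = 2 * p1 * p2 * t ^ 2)%N.
  apply/eqP; rewrite -(eqr_nat algC) natrD natrM natrX (natrM _ (2 * p1 * p2)) natrX -eD -et.
  rewrite exprMn sqrtCK; apply/eqP; by field.
have [h [b [eh hb]]] := pell_descent (bq_p1 H) (bq_p2 H) (bq_m1 H) (bq_m2 H) (bq_ne H) eDt.
have [r [s hrs]] := @pell_split _ _ _ _ (bq_p1 H) (bq_p2 H) (bq_m1 H) (bq_m2 H) (bq_ne H) hleg hb.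
pose w := r%:R + s%:R * rd; pose w' := r%:R - s%:R * rd.
have wd : w * w' = (r ^ 2)%:R - (2 * p1 * p2 * s ^ 2)%:R.
  rewrite (natrM _ (2 * p1 * p2)) !natrX -[(2 * p1 * p2)%:R]sqrtCK /w /w'; ring.
have ww : (w ^+ 2) * (w' ^+ 2) = 1.
  rewrite -exprMn wd; case: hrs => - [<- <-].
    by rewrite -natr1; ring.
  by rewrite -natr1; ring.
have wp : w ^+ 2 + w' ^+ 2 = e3 + e3^-1.
  have -> : w ^+ 2 + w' ^+ 2 = 2 * ((r ^ 2)%:R + (2 * p1 * p2 * s ^ 2)%:R).
    rewrite (natrM _ (2 * p1 * p2)) !natrX -[(2 * p1 * p2)%:R]sqrtCK /w /w'; ring.
  rewrite et eh; case: hrs => - [<- <-]; rewrite -natr1 natrD natrM; ring.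
(* The pairs [w ^ 2], [w' ^ 2] and [e3], [e3^-1] have the same sum and the same product 1. *)
have : (w ^+ 2 - e3) * (w ^+ 2 - e3^-1) = 0.
  have -> : (w ^+ 2 - e3) * (w ^+ 2 - e3^-1) = w ^+ 2 * w ^+ 2 - (e3 + e3^-1) * w ^+ 2 + 1 by field.
  rewrite -wp -ww; ring.
have hw : Qd w by rewrite /w; sf.
move/eqP; rewrite mulf_eq0 !subr_eq0 => /orP [] /eqP ew.
  by apply: (fund_not_sqr f3 (u := w) (n := 0)) => //; rewrite ew.
by apply: (fund_not_sqr f3 (u := w) (n := -1)) => //; rewrite ew.
Qed.
End NormMinusOne.

(** Each norm is recorded through the conjugate, as the norm divided by the unit. The sign [n2] is
    the norm of [e2], the only one left open. *)
Record units (p1 p2 : nat) (s1 s2 : {rmorphism algC -> algC}) (e1 e2 e3 n2 : algC) : Prop := Units {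
  u_f1 : fund_unit 2 e1; u_f2 : fund_unit (p1 * p2) e2; u_f3 : fund_unit (2 * p1 * p2) e3;
  u_s2e1 : s2 e1 = - e1^-1; u_s1e2 : s1 e2 = n2 / e2; u_s1e3 : s1 e3 = - e3^-1;
  u_n2 : n2 = 1 \/ n2 = -1 }.

Lemma real_sqr_gt0 x : x \is Num.real -> x != 0 -> 0 < x ^+ 2.
Proof. by move=> hx nx; rewrite -(real_normK hx) exprn_gt0 // normr_gt0. Qed.

Lemma int_norm_le2 (z : int) : `|z| <= 2 -> [\/ z = 2, z = 1, z = 0 | z = -1 \/ z = -2].
Proof.
by case: z => [[|[|[|z]]]|[|[|z]]] // _; [constructor 3 | constructor 2 | constructor 1 | constructor 4; left | constructor 4; right].
Qed.

(** * Elements of absolute value 1, and the units of the real biquadratic field *)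

Section UnitGroup.
Variables (p1 p2 : nat) (s1 s2 : {rmorphism algC -> algC}).
Hypothesis H : biquad p1 p2 s1 s2.

Local Notation r2 := (sqrtC 2 : algC).
Local Notation rm := (sqrtC (p1 * p2)%:R : algC).
Local Notation rd := (sqrtC (2 * p1 * p2)%:R : algC).
Local Notation K := (Qgen [:: r2; rm; 'i]).
Local Notation K0 := (Qgen [:: r2; rm]).
Local Notation Qd := (Qgen [:: rd]).
Local Notation sg := (sigma s1 s2).

Lemma units_exist e1 e2 e3 :
  (2 <= (legendre p1 p2 == -1%R) + (legendre 2 p1 == -1%R) + (legendre 2 p2 == -1%R))%N ->
  fund_unit 2 e1 -> fund_unit (p1 * p2) e2 -> fund_unit (2 * p1 * p2) e3 ->
  exists n2 : algC, units p1 p2 s1 s2 e1 e2 e3 n2.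
Proof.
move=> hleg f1 f2 f3; exists (e2 * s1 e2).
have [n _ [_ h1]] := norm_e1_sub H f1.
have he := fund_mem f2; have ne := fund_neq0 f2; have hs := Qm_s1 H he.
split => //; first by rewrite mulrAC divff // mul1r.
  exact: (norm_e3 H hleg f3).
apply: Crat_aunit.
  apply: (fixed_Q_m H); first by sf.
  by rewrite rmorphM (s1_s1 H) 1?mulrC //; exact: (K_of_K0 (K0_of_Qm he)).
have ue := fund_aunit f2; exact: (aunitM ue (aunit_aut s1 ue)).
Qed.

Lemma norm1_le x : x * conjr x = 1 -> `|x + conjr x| <= 2.
Proof.
move=> e; have n1 : `|x| = 1.
  by apply/eqP; rewrite -(@pexpr_eq1 _ _ 2) // normCK e.
have n1' : `|conjr x| = 1 by rewrite norm_conjC n1.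
by apply: le_trans (ler_normD _ _) _; rewrite n1 n1'.
Qed.

Lemma trace_real x : x + conjr x \is Num.real.
Proof. by apply/CrealP; rewrite rmorphD /= conjCK addrC. Qed.

(* With [t = w + conj w] and [t'] its conjugate, [n = (t - t')^2] is a rational integer at most 16 and [2 p1 p2 n] is a square, so [n = 0]: [t] is a rational integer of absolute value at most 2. *)
Lemma norm1_root_of_unity w : K w -> aunit w -> w * conjr w = 1 -> Qd (w + conjr w) ->
  [\/ w ^+ 3 = 1, w ^+ 3 = -1 | w ^+ 2 = -1].
Proof.
move=> kw uw wN; set t := w + conjr w => ht.
have kt := K_of_K0 (K0_of_Qd ht).
have at' : t \in Aint by rewrite rpredD // aunit_int //; exact: aunit_aut.
have hst := Qd_s1 H ht.
have ets : s1 t = s1 w + conjr (s1 w) by rewrite rmorphD (s1_conj H kw).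
have st : `|s1 t| <= 2.
  by rewrite ets; apply: norm1_le; rewrite -(s1_conj H kw) -rmorphM wN rmorph1.
have tr : t \is Num.real by exact: trace_real.
have str : s1 t \is Num.real by rewrite ets; exact: trace_real.
have dr : t - s1 t \is Num.real by rewrite rpredB.
have [n en] : exists n : nat, (t - s1 t) ^+ 2 = n%:R.
  apply: Crat_Aint_natP.
  - apply: (fixed_Q_d H); first by sf.
    by rewrite rmorphXn rmorphB (s1_s1 H kt) -sqrrN opprB.
  - by rewrite rpredX // rpredB // Aint_aut.
  - exact: real_exprn_even_ge0.
have n16 : (n <= 16)%N.
  rewrite -(ler_nat algC) -en -(real_normK dr) (natrX _ 4 2) lerXn2r ?nnegrE //.
  by apply: le_trans (ler_normB _ _) _; rewrite (natrD _ 2 2) lerD // norm1_le.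
have [D eD] : exists D : nat, (2 * p1 * p2 * n = D ^ 2)%N.
  apply: (@Crat_Aint_nat ((t - s1 t) * rd)); last by rewrite exprMn sqrtCK en -natrM mulnC.
  apply: (fixed_Q_d H); first by sf.
  by rewrite rmorphM rmorphB (s1_s1 H kt) (s1_d H); ring.
have pr1 := bq_p1 H; have pr2 := bq_p2 H.
have p1n : (p1 %| n)%N.
  have [//|nd] := boolP (p1 %| n)%N; have [n0|n0] := posnP n; first by move: nd; rewrite n0 dvdn0.
  case: (@logn_sqr_odd p1 D (2 * p2 * n)) => //; first by rewrite -eD; ring.
    by rewrite !muln_gt0 n0 /= prime_gt0.
  by rewrite !Euclid_dvdM // !negb_or nd (prime1mod4_ndvd2 pr1 (bq_m1 H)) prime_ndvd // (bq_ne H).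
have p2n : (p2 %| n)%N.
  have [//|nd] := boolP (p2 %| n)%N; have [n0|n0] := posnP n; first by move: nd; rewrite n0 dvdn0.
  case: (@logn_sqr_odd p2 D (2 * p1 * n)) => //; first by rewrite -eD; ring.
    by rewrite !muln_gt0 n0 /= prime_gt0.
  by rewrite !Euclid_dvdM // !negb_or nd (prime1mod4_ndvd2 pr2 (bq_m2 H)) prime_ndvd // eq_sym (bq_ne H).
have n0 : n = 0%N.
  have : (p1 * p2 %| n)%N by rewrite Gauss_dvd ?p1n ?p2n // prime_coprime // prime_ndvd // (bq_ne H).
  (* Both primes are at least 5, so a nonzero multiple of [p1 p2] is at least 25, beyond the bound
     16. *)
  case: (n) n16 => // n' h /dvdn_leq hl.
  have := hl isT; have := prime1mod4_ge5 pr1 (bq_m1 H); have := prime1mod4_ge5 pr2 (bq_m2 H); nia.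
have fixt : s1 t = t.
  by move/eqP: en; rewrite n0 expf_eq0 subr_eq0 /= => /eqP <-.
have /intrP [z ez] : t \in Num.int by apply: Cint_rat_Aint => //; exact: (fixed_Q_d H).
have z2 : `|z| <= 2 by rewrite -(ler_int algC) intr_norm -ez; exact: norm1_le.
have ew : w ^+ 2 = t * w - 1 by rewrite /t -wN; ring.
have {z2} := int_norm_le2 z2.
have e3w : w ^+ 3 = (t ^+ 2 - 1) * w - t.
  by rewrite exprS ew mulrBr mulr1 mulrCA -expr2 ew; ring.
have dbl s : (w - s) ^+ 2 = 0 -> w = s by move/eqP; rewrite expf_eq0 /= subr_eq0 => /eqP.
(* Now [w] is a root of [X ^ 2 - t X + 1] with [t] equal to 2, 1, 0, -1 or -2, so it is a root of
   unity of order 1, 6, 4, 3 or 2. *)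
case=> [hz|hz|hz|[hz|hz]]; rewrite hz in ez.
- constructor 1; rewrite (dbl 1) ?expr1n //.
  by rewrite sqrrB ew ez; ring.
- constructor 2; rewrite e3w ez; ring.
- constructor 3; rewrite ew ez; ring.
- constructor 1; rewrite e3w ez; ring.
- constructor 2; rewrite (dbl (-1)); first by ring.
  by rewrite sqrrB ew ez; ring.
Qed.
Variables e1 e2 e3 n2 : algC.
Hypothesis UH : units p1 p2 s1 s2 e1 e2 e3 n2.
Let f1 := u_f1 UH. Let f2 := u_f2 UH. Let f3 := u_f3 UH.
Let ne1 := fund_neq0 f1. Let ne2 := fund_neq0 f2. Let ne3 := fund_neq0 f3.

Definition unit_mon a b c := e1 ^ a * e2 ^ b * e3 ^ c.
Local Notation U := unit_mon.

Lemma e1_K0 : K0 e1. Proof. exact: (K0_of_Q2 (fund_mem f1)). Qed.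
Lemma e2_K0 : K0 e2. Proof. exact: (K0_of_Qm (fund_mem f2)). Qed.
Lemma e3_K0 : K0 e3. Proof. exact: (K0_of_Qd (fund_mem f3)). Qed.
Lemma U_K0 a b c : K0 (U a b c).
Proof. by have h1 := e1_K0; have h2 := e2_K0; have h3 := e3_K0; rewrite /unit_mon; sf. Qed.
Lemma U_aunit a b c : aunit (U a b c).
Proof.
rewrite /unit_mon; apply: aunitM; [apply: aunitM|]; apply: aunitXz;
[exact: (fund_aunit f1) | exact: (fund_aunit f2) | exact: (fund_aunit f3)].
Qed.
Lemma U_gt0 a b c : 0 < U a b c.
Proof. by rewrite /unit_mon !mulr_gt0 // exprz_gt0 // (lt_trans ltr01) //; [exact: (fund_gt1 f1) | exact: (fund_gt1 f2) | exact: (fund_gt1 f3)]. Qed.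

Lemma UD a b c a' b' c' : U (a + a') (b + b') (c + c') = U a b c * U a' b' c'.
Proof. by rewrite /unit_mon !expfzDr //; ring. Qed.
Lemma UN a b c : U (- a) (- b) (- c) = (U a b c)^-1.
Proof. by rewrite /unit_mon -!invr_expz !invfM. Qed.
Lemma n2_sign b : n2 ^ b = 1 \/ n2 ^ b = -1.
Proof. by case: (u_n2 UH) => ->; [left; rewrite exp1rz | exact: sign_int]. Qed.

Lemma s1e1 : s1 e1 = e1. Proof. exact: (s1_Q2 H (fund_mem f1)). Qed.
Lemma s2e2 : s2 e2 = e2. Proof. exact: (s2_Qm H (fund_mem f2)). Qed.
Lemma s2e3 : s2 e3 = - e3^-1.
Proof. by rewrite (s1_s2_Qd H (fund_mem f3)) (u_s1e3 UH). Qed.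

Lemma neg_inv_expz x n : (- x^-1) ^ n = (-1) ^ n / x ^ n.
Proof. by rewrite -[- x^-1]mulN1r expfzMl exprz_inv -invr_expz. Qed.

Lemma s1U a b c : s1 (U a b c) = n2 ^ b * (-1) ^ c * (e1 ^ a / (e2 ^ b * e3 ^ c)).
Proof.
rewrite /unit_mon !rmorphM !fmorphXz s1e1 (u_s1e2 UH) (u_s1e3 UH) neg_inv_expz expfzMl exprz_inv -invr_expz invfM; ring.
Qed.
Lemma s2U a b c : s2 (U a b c) = (-1) ^ a * (-1) ^ c * (e2 ^ b / (e1 ^ a * e3 ^ c)).
Proof.
rewrite /unit_mon !rmorphM !fmorphXz s2e2 s2e3 (u_s2e1 UH) !neg_inv_expz invfM; ring.
Qed.
Lemma sgU a b c : sg (U a b c) = (-1) ^ a * n2 ^ b * (e3 ^ c / (e1 ^ a * e2 ^ b)).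
Proof.
have h1 : sg e1 = - e1^-1 by rewrite sgE (u_s2e1 UH) rmorphN fmorphV s1e1.
have h2 : sg e2 = n2 / e2 by rewrite sgE s2e2 (u_s1e2 UH).
have h3 : sg e3 = e3 by apply: (sg_Qd H); exact: (fund_mem f3).
rewrite /unit_mon !rmorphM !fmorphXz h1 h2 h3 neg_inv_expz expfzMl exprz_inv -invr_expz invfM; ring.
Qed.

Lemma U_s1U a b c : U a b c * s1 (U a b c) = n2 ^ b * (-1) ^ c * (e1 ^ a) ^+ 2.
Proof. by rewrite s1U /unit_mon; field; rewrite !expfz_neq0. Qed.
Lemma U_s2U a b c : U a b c * s2 (U a b c) = (-1) ^ a * (-1) ^ c * (e2 ^ b) ^+ 2.
Proof. by rewrite s2U /unit_mon; field; rewrite !expfz_neq0. Qed.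
Lemma U_sgU a b c : U a b c * sg (U a b c) = (-1) ^ a * n2 ^ b * (e3 ^ c) ^+ 2.
Proof. by rewrite sgU /unit_mon; field; rewrite !expfz_neq0. Qed.

Lemma sign_of_sqr s x y : s = 1 \/ s = -1 -> x \is Num.real -> y \is Num.real -> x != 0 ->
  y ^+ 2 = s * x ^+ 2 -> s = 1.
Proof.
case=> [//|->] hx hy nx e.
have := real_exprn_even_ge0 hy (isT : ~~ odd 2).
by rewrite e mulN1r oppr_ge0 lt_geF // real_sqr_gt0.
Qed.

Lemma sign_mul (s t : algC) : s = 1 \/ s = -1 -> t = 1 \/ t = -1 -> s * t = 1 \/ s * t = -1.
Proof. by move=> [] -> [] ->; rewrite ?mul1r ?mulr1 ?mulrNN ?mulr1; [left|right|right|left]. Qed.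

Lemma expz_real x n : x \is Num.real -> x ^ n \is Num.real.
Proof. by move=> h; apply: rpredXz. Qed.

(* A square in the real field [K0] has nonnegative relative norms. *)
Lemma U_sqr_parity y a b c : K0 y -> y ^+ 2 = U a b c ->
  n2 ^ b * (-1) ^ c = 1 /\ (-1 : algC) ^ a * (-1) ^ c = 1.
Proof.
move=> hy e; have h1 := K0_s1 H hy; have h2 := K0_s2 H hy; split.
  apply: (@sign_of_sqr _ (e1 ^ a) (y * s1 y)).
  - by apply: sign_mul; [exact: n2_sign | exact: sign_int].
  - by apply: expz_real; exact: (K0_real e1_K0).
  - by apply: rpredM; [exact: (K0_real hy) | exact: (K0_real h1)].
  - exact: expfz_neq0.
  - by rewrite -U_s1U exprMn -rmorphXn /= e.
apply: (@sign_of_sqr _ (e2 ^ b) (y * s2 y)).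
- by apply: sign_mul; exact: sign_int.
- by apply: expz_real; exact: (K0_real e2_K0).
- by apply: rpredM; [exact: (K0_real hy) | exact: (K0_real h2)].
- exact: expfz_neq0.
- by rewrite -U_s2U exprMn -rmorphXn /= e.
Qed.

Lemma sign_nat (s : bool) : (-1 : algC) ^+ s = 1 \/ (-1 : algC) ^+ s = -1.
Proof. by case: s; [right | left]. Qed.

(* The square of a unit is the product of its norms to two quadratic subfields divided by a conjugate of its norm to the third. *)
Lemma unit_sqr v : K0 v -> aunit v -> exists a b c, v ^+ 2 = U a b c.
Proof.
move=> hv uv; have h1 := K0_s1 H hv; have h2 := K0_s2 H hv; have h3 := K0_sg H hv.
have u1 := aunit_aut s1 uv; have u2 := aunit_aut s2 uv; have u3 := aunit_aut sg uv.
have nv := aunit_neq0 uv; have n1 := aunit_neq0 u1; have nn2 := aunit_neq0 u2; have n3 := aunit_neq0 u3.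
have kv := K_of_K0 hv.
have [||s [a ea]] := fund_gen f1 (u := v * s1 v); last 1 first.
have [||t [b eb]] := fund_gen f2 (u := v * s2 v); last 1 first.
have [||r [c ec]] := fund_gen f3 (u := v * sg v); last 1 first.
- exists a, b, c.
  have e : v ^+ 2 = (v * s1 v) * (v * s2 v) / s1 (v * sg v).
    by rewrite rmorphM sgE (s1_s1 H (K_s2 H kv)); field; rewrite n1 nn2.
  have [sn hsn esn] : exists2 sn, sn = 1 \/ sn = -1 & v ^+ 2 = sn * U a b c.
    exists ((-1) ^+ s * (-1) ^+ t * ((-1) ^+ r * (-1) ^ c)).
      by apply: sign_mul; [apply: sign_mul; exact: sign_nat | apply: sign_mul; [exact: sign_nat | exact: sign_int]].
    rewrite e ea eb ec rmorphM rmorphXn rmorphN rmorph1 fmorphXz (u_s1e3 UH) neg_inv_expz /unit_mon.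
    have e0 := expfz_neq0 c ne3.
    by case: (sign_nat r) => ->; case: (sign_int c) => ->; field; rewrite ?e0 ?oner_neq0 ?oppr_eq0 ?oner_neq0.
  case: hsn => hs; first by rewrite esn hs mul1r.
  have := real_sqr_gt0 (K0_real hv) nv.
  by rewrite esn hs mulN1r oppr_gt0 lt_gtF // U_gt0.
- apply: (fixed_Qd H); first by sf.
  by rewrite rmorphM (sg_sg H kv) mulrC.
- exact: aunitM.
- apply: (fixed_Qm H); first by sf.
  by rewrite rmorphM (s2_s2 H kv) mulrC.
- exact: aunitM.
- apply: (fixed_Q2 H); first by sf.
  by rewrite rmorphM (s1_s1 H kv) mulrC.
- exact: aunitM.
Qed.

(** The relative norm to each quadratic subfield leaves, up to sign, an even power of the
    fundamental unit of that subfield alone. *)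
Lemma U_eq1 a b c : U a b c = 1 -> [/\ a = 0, b = 0 & c = 0].
Proof.
have key (e s : algC) n : 1 < e -> s = 1 \/ s = -1 -> 1 = s * (e ^ n) ^+ 2 -> n = 0.
  move=> h hs e1'; have ep : 0 < e ^ n by rewrite exprz_gt0 // (lt_trans ltr01).
  have s1' : s = 1.
    case: hs e1' => // -> e1'; have : 0 < (e ^ n) ^+ 2 by rewrite exprn_gt0.
    by rewrite -[(e ^ n) ^+ 2]opprK -[- (e ^ n) ^+ 2]mulN1r -e1' ltr0N1.
  have : e ^ (n * 2) = e ^ 0 by rewrite -exprz_exp expz2 expr0z e1' s1' mul1r.
  by move/(expz_inj_gt1 h); lia.
move=> e; have r1 : s1 (U a b c) = 1 by rewrite e rmorph1.
have r2' : s2 (U a b c) = 1 by rewrite e rmorph1.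
have r3 : sg (U a b c) = 1 by rewrite e rmorph1.
split.
- apply: (key _ _ _ (fund_gt1 f1) _ (etrans _ (U_s1U a b c))); last by rewrite r1 e mulr1.
  by apply: sign_mul; [exact: n2_sign | exact: sign_int].
- apply: (key _ _ _ (fund_gt1 f2) _ (etrans _ (U_s2U a b c))); last by rewrite r2' e mulr1.
  by apply: sign_mul; exact: sign_int.
- apply: (key _ _ _ (fund_gt1 f3) _ (etrans _ (U_sgU a b c))); last by rewrite r3 e mulr1.
  by apply: sign_mul; [exact: sign_int | exact: n2_sign].
Qed.

Lemma U_inj a b c a' b' c' : U a b c = U a' b' c' -> [/\ a = a', b = b' & c = c'].
Proof.
move=> e; have : U (a - a') (b - b') (c - c') = 1.
  by rewrite UD UN e divff // aunit_neq0 // U_aunit.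
by move/U_eq1 => [h1 h2 h3]; split; lia.
Qed.

End UnitGroup.

(** * The square root of [theta] *)

Lemma squarefree_dvd_exp (M N j : nat) : (0 < M)%N -> (forall q : nat, prime q -> ~~ (q ^ 2 %| M)%N) ->
  (M %| N ^ j)%N -> (M %| N)%N.
Proof.
move=> M0 sq dv; apply/dvdn_partP => // q; rewrite mem_primes => /and3P [pq _ dq].
have l1 : logn q M = 1%N.
  apply/eqP; rewrite eqn_leq; apply/andP; split; last by rewrite logn_gt0 mem_primes pq M0.
  by rewrite leqNgt -pfactor_dvdn //; exact: sq.
rewrite p_part l1 expn1; have := dvdn_trans dq dv.
case: j {dv} => [|j]; first by rewrite expn0 dvdn1 => /eqP q1; rewrite q1 in pq.
by rewrite Euclid_dvdX // => /andP [].
Qed.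

Lemma dvdn_prime_mul (M q N : nat) : prime q -> (M %| q * N)%N ->
  (M %| N)%N \/ exists2 M', M = (q * M')%N & (M' %| N)%N.
Proof.
move=> pq dv; have [/dvdnP [M' eM]|nd] := boolP (q %| M)%N.
  right; exists M'; first by rewrite eM mulnC.
  by move: dv; rewrite eM mulnC dvdn_pmul2l // prime_gt0.
by left; rewrite Gauss_dvdr // in dv; rewrite coprime_sym prime_coprime.
Qed.

Section SquareClass.
Variables (p1 p2 : nat) (s1 s2 : {rmorphism algC -> algC}).
Hypothesis H : biquad p1 p2 s1 s2.

Local Notation r2 := (sqrtC 2 : algC).
Local Notation rm := (sqrtC (p1 * p2)%:R : algC).
Local Notation rd := (sqrtC (2 * p1 * p2)%:R : algC).
Local Notation K0 := (Qgen [:: r2; rm]).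
Local Notation sg := (sigma s1 s2).

Definition tr x := x + s1 x + s2 x + sg x.

Lemma tr_Crat x : K0 x -> tr x \in Crat.
Proof.
move=> hx; have kx := K_of_K0 hx.
have h1 := K0_s1 H hx; have h2 := K0_s2 H hx; have h3 := K0_sg H hx.
apply: (fixed_Q H); first by rewrite /tr; sf.
  by rewrite /tr !rmorphD !sgE (s1_s1 H kx) (s1_s1 H (K_s2 H kx)); ring.
by rewrite /tr !rmorphD !sgE (s2_s1 H (K_s2 H kx)) (s2_s1 H kx) (s2_s2 H kx); ring.
Qed.

(** Every conjugate of [x] is divisible by [sqrt M], since its square is divisible by [M]. So is the
    trace, a rational integer whose square is then divisible by the squarefree [M]. *)
Lemma tr_dvd x (M : nat) : K0 x -> (0 < M)%N -> (forall q : nat, prime q -> ~~ (q ^ 2 %| M)%N) ->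
  x ^+ 2 / M%:R \in Aint -> tr x / M%:R \in Aint.
Proof.
move=> hx M0 sq hi; set m := sqrtC (M%:R : algC).
have nM : M%:R != 0 :> algC by rewrite pnatr_eq0 -lt0n.
have nm : m != 0 by rewrite sqrtC_eq0.
have key (f : {rmorphism algC -> algC}) : f x / m \in Aint.
  apply: (@Aint_root _ 2) => //; rewrite exprMn exprVn sqrtCK.
  by rewrite -(Aint_aut f) fmorph_div rmorphXn rmorph_nat in hi.
have ht : tr x / m \in Aint.
  by rewrite /tr !mulrDl !rpredD ?key //; exact: (key idfun).
have hq := tr_Crat hx.
have ix : x \in Aint.
  apply: (@Aint_root _ 2) => //; rewrite -[_ ^+ 2](divfK nM); apply: rpredM => //; exact: Aint_nat.
have it : tr x \in Aint by rewrite /tr !rpredD // Aint_aut.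
have /intrP [z ez] : tr x \in Num.int by exact: Cint_rat_Aint.
have /intrP [y ey] : tr x ^+ 2 / M%:R \in Num.int.
  apply: Cint_rat_Aint; first by rewrite rpred_div ?rpredX ?rpred_nat.
  by have -> : tr x ^+ 2 / M%:R = (tr x / m) ^+ 2; [rewrite exprMn exprVn sqrtCK | rewrite rpredX].
have e2 : (`|z| ^ 2 = `|y| * M)%N.
  have : z ^+ 2 = y * M%:Z.
    by apply: (@intr_inj algC); rewrite rmorphXn rmorphM /= -ez -ey divfK.
  by move/(congr1 absz); rewrite abszX abszM.
have /dvdnP [q eq] : (M %| `|z|)%N by apply: (@squarefree_dvd_exp _ _ 2) => //; rewrite e2 dvdn_mull.
have -> : tr x / M%:R = ((-1) ^+ (z < 0)%R * q%:Z)%:~R.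
  apply: (mulIf nM); rewrite divfK // ez {1}(intEsign z) eq.
  by rewrite PoszM !rmorphM /= mulrA.
exact: Aint_int.
Qed.

Lemma sqr_class_min (M : nat) x y : K0 y -> (0 < M)%N -> y ^+ 2 = M%:R * x ->
  exists N z, [/\ K0 z, (0 < N)%N, (forall q : nat, prime q -> ~~ (q ^ 2 %| N)%N) & z ^+ 2 = N%:R * x].
Proof.
elim/ltn_ind: M y => M ih y hy M0 e.
have [/existsP [[q hq] /= /andP [pq dq]]|nq] := boolP [exists q : 'I_M.+1, prime q && (q ^ 2 %| M)%N].
  have /dvdnP [N eN] := dq; have q0 := prime_gt0 pq.
  have N0 : (0 < N)%N by rewrite lt0n; apply: contraTneq M0 => N0; rewrite eN N0.
  have nq : q%:R != 0 :> algC by rewrite pnatr_eq0 -lt0n.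
  apply: (ih N _ (y / q%:R)) => //; first by rewrite eN ltn_Pmulr // -(exp1n 2) ltn_exp2r // prime_gt1.
    by sf.
  by rewrite exprMn e {1}eN natrM natrX; field.
exists M, y; split => // q pq; apply/negP => dq; move/existsP: nq; apply.
have qM : (q < M.+1)%N.
  by rewrite ltnS; apply: leq_trans (dvdn_leq M0 dq); rewrite -{1}(expn1 q) leq_pexp2l // prime_gt0.
by exists (Ordinal qM); rewrite /= pq dq.
Qed.

(** All traces [tr (y * g)] with [g] integral are divisible by [M], so [y / M] is integral up to the
    denominator of the dual basis. Squaring and removing the unit [x] makes [M] divide
    [16 (2 p1 p2) ^ 2]. *)
Lemma sqr_class_dvd (M : nat) x y : K0 y -> (0 < M)%N -> (forall q : nat, prime q -> ~~ (q ^ 2 %| M)%N) ->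
  aunit x -> y ^+ 2 = M%:R * x -> (M %| 2 * p1 * p2)%N.
Proof.
move=> hy M0 sq ux e.
have nM : M%:R != 0 :> algC by rewrite pnatr_eq0 -lt0n.
have i2 : r2 \in Aint by apply: (@Aint_root _ 2) => //; rewrite sqrtCK Aint_nat.
have im : rm \in Aint by apply: (@Aint_root _ 2) => //; rewrite sqrtCK Aint_nat.
have id : rd \in Aint by apply: (@Aint_root _ 2) => //; rewrite sqrtCK Aint_nat.
have tri g : K0 g -> g \in Aint -> tr (y * g) / M%:R \in Aint.
  move=> hg ig; apply: tr_dvd => //; first by sf.
  have -> : (y * g) ^+ 2 / M%:R = x * g ^+ 2 by rewrite exprMn e; field.
  by apply: rpredM; [exact: aunit_int | exact: rpredX].
have h1 := tri 1 ltac:(sf) (rpred1 _); have h2 := tri r2 ltac:(sf) i2; have hm := tri rm ltac:(sf) im.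
have h3 := tri (r2 * rm) ltac:(sf) (rpredM i2 im).
(* The basis 1, [r2], [rm], [r2 * rm] is orthogonal for the trace, so [y] is the sum of the
   [tr (y * g) / (4 * g ^+ 2) * g]; multiplying by [4 * r2 ^+ 2 * rm ^+ 2] clears all
   denominators. *)
have e4 : 4 * (r2 ^+ 2 * rm ^+ 2) * y / M%:R =
    r2 ^+ 2 * rm ^+ 2 * (tr (y * 1) / M%:R) + r2 * rm ^+ 2 * (tr (y * r2) / M%:R)
    + r2 ^+ 2 * rm * (tr (y * rm) / M%:R) + r2 * rm * (tr (y * (r2 * rm)) / M%:R).
  have trM g : tr (y * g) = y * g + s1 y * s1 g + s2 y * s2 g + sg y * sg g.
    by rewrite /tr !(rmorphM _ y).
  by rewrite !trM (rmorphM s1 r2) (rmorphM s2 r2) (rmorphM sg r2) !rmorph1 (s1_2 H) (s1_m H) (s2_2 H) (s2_m H) (sg_2 H) (sg_m H); ring.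
have i4 : 4 * (r2 ^+ 2 * rm ^+ 2) * y / M%:R \in Aint.
  have i22 : r2 ^+ 2 \in Aint by exact: rpredX.
  have imm : rm ^+ 2 \in Aint by exact: rpredX.
  by rewrite e4; apply: rpredD; [apply: rpredD; [apply: rpredD|]|];
    apply: rpredM => //; apply: rpredM.
have ed : r2 ^+ 2 * rm ^+ 2 = (2 * p1 * p2)%:R by rewrite !sqrtCK -natrM mulnA.
have hi : (16 * (2 * p1 * p2) ^ 2)%:R / M%:R \in Aint.
  have -> : (16 * (2 * p1 * p2) ^ 2)%:R / M%:R = (4 * (r2 ^+ 2 * rm ^+ 2) * y / M%:R) ^+ 2 * x^-1.
    have nx := aunit_neq0 ux.
    by rewrite ed natrM natrX; move: e; set d := (2 * p1 * p2)%:R => e; rewrite !exprMn e; field; rewrite nM nx.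
  by apply: rpredM; [exact: rpredX | exact/aunit_int/aunitV].
have /intrP [z ez] : (16 * (2 * p1 * p2) ^ 2)%:R / M%:R \in (Num.int : {pred algC}).
  by apply: Cint_rat_Aint => //; rewrite rpred_div ?rpred_nat.
have ez2 : (16 * (2 * p1 * p2) ^ 2)%:Z = z * M%:Z.
  by apply: (@intr_inj algC); rewrite rmorphM /= -ez divfK.
(* The exponent 6 absorbs the factor 16, which is itself part of [(2 p1 p2) ^ 4]. *)
apply: (@squarefree_dvd_exp M (2 * p1 * p2) 6) => //.
have d16 : (M %| 16 * (2 * p1 * p2) ^ 2)%N.
  by have := congr1 absz ez2; rewrite abszM !absz_nat => ->; rewrite dvdn_mull.
apply: (dvdn_trans d16); apply/dvdnP; exists ((p1 * p2) ^ 4)%N; ring.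
Qed.

(* Only [2], [p1], [p2] ramify in [K0], where [2] and [p1 * p2] are squares. *)
Lemma sqr_class (M : nat) x y : K0 y -> (0 < M)%N -> aunit x -> y ^+ 2 = M%:R * x ->
  exists2 z, K0 z & z ^+ 2 = x \/ z ^+ 2 = p1%:R * x.
Proof.
move=> hy M0 ux e.
have {M y hy M0 e} [N [y [hy N0 sq e]]] := sqr_class_min hy M0 e.
have := sqr_class_dvd hy N0 sq ux e; rewrite (_ : 2 * p1 * p2 = p1 * (2 * (p2 * 1)))%N; last by ring.
have n1 : p1%:R != 0 :> algC by rewrite pnatr_eq0 -lt0n prime_gt0 // (bq_p1 H).
have n2 : p2%:R != 0 :> algC by rewrite pnatr_eq0 -lt0n prime_gt0 // (bq_p2 H).
have nr2 := r2_neq0; have nrm := rm_neq0 H.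
have E2 : r2 ^+ 2 = 2 by rewrite sqrtCK. have Em : rm ^+ 2 = p1%:R * p2%:R by rewrite sqrtCK natrM.
(* The eight divisors of [2 p1 p2]: a factor 2 is removed by [r2], a factor [p1 p2] by [rm], and a
   lone [p2] is traded for [p1] by the multiplier [p1 / rm]. *)
case/(dvdn_prime_mul (bq_p1 H)) => [|[N1 eN]];
case/(dvdn_prime_mul (isT : prime 2)) => [|[N2 eN2]];
case/(dvdn_prime_mul (bq_p2 H)) => [|[N3 eN3]]; rewrite dvdn1 => /eqP eN4; subst; rewrite ?natrM in e.
- by exists y => //; left; rewrite e mul1r.
- exists (p1%:R * y / rm); first by sf.
  by right; rewrite !exprMn exprVn e Em; field; rewrite n1 n2.
- exists (y / r2); first by sf.
  by left; rewrite !exprMn exprVn e E2; field.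
- exists (p1%:R * y / (r2 * rm)); first by sf.
  by right; rewrite !exprMn exprVn exprMn e Em E2; field; rewrite n1 n2.
- by exists y => //; right; rewrite e mulr1.
- exists (y / rm); first by sf.
  by left; rewrite !exprMn exprVn e Em; field; rewrite n1 n2.
- exists (y / r2); first by sf.
  by right; rewrite !exprMn exprVn e E2; field.
- exists (y / (r2 * rm)); first by sf.
  by left; rewrite !exprMn exprVn exprMn e Em E2; field; rewrite n1 n2.
Qed.
End SquareClass.

Lemma mod4_sqr (r : nat) : (r ^ 2 %% 4 = 0 \/ r ^ 2 %% 4 = 1)%N.
Proof.
rewrite -modnXm; have : (r %% 4 < 4)%N by rewrite ltn_mod.
by case: (r %% 4)%N => [|[|[|[|]]]] // _; [left|right|left|right].
Qed.

Lemma sqr_even (P X : nat) : (P ^ 2 = 2 * X)%N -> exists R : nat, P = (2 * R)%N.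
Proof.
move=> e; have : (2 %| P ^ 2)%N by rewrite e dvdn_mulr.
by rewrite Euclid_dvdX // andbT => /dvdnP [R ->]; exists R; rewrite mulnC.
Qed.

(** Both numbers are even, [P = 2 R] and [Q = 2 T]. Eliminating [t] shows that [R ^ 2] and [T ^ 2]
    differ by 2 modulo 4, which squares cannot do. *)
Lemma mod4_absurd (P Q t m : nat) : (m %% 4 = 1)%N ->
  (P ^ 2 = 2 * (t + 2) /\ Q ^ 2 + 4 * m = 2 * (m * t))%N \/
  (P ^ 2 + 4 = 2 * t /\ Q ^ 2 = 2 * (m * (t + 2)))%N -> False.
Proof.
move=> hm h; have [R eR] : exists R : nat, P = (2 * R)%N.
  by case: h => - [h _]; [apply: (@sqr_even _ (t + 2)) | apply: (@sqr_even _ (t - 2)); lia].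
have [T eT] : exists T : nat, Q = (2 * T)%N.
  by case: h => - [_ h]; [apply: (@sqr_even _ (m * t - 2 * m)); lia | apply: (@sqr_even _ (m * (t + 2)))].
have e : (T ^ 2 + 2 * m = m * R ^ 2 \/ T ^ 2 = m * R ^ 2 + 2 * m)%N.
  subst P Q; case: h => - [h1 h2]; [left | right].
    have et : (t = 2 * R ^ 2 - 2 /\ 2 <= 2 * R ^ 2)%N by lia.
    case: et => et hR; have : (m * t = 2 * (m * R ^ 2) - 2 * m /\ 2 * m <= 2 * (m * R ^ 2))%N.
      rewrite et mulnBr mulnCA (mulnC m 2); split => //; nia.
    lia.
  have et : (t = 2 * R ^ 2 + 2)%N by lia.
  by move: h2; rewrite et; lia.
have em : (m * R ^ 2 = m %/ 4 * R ^ 2 * 4 + R ^ 2)%N by rewrite {1}(divn_eq m 4) hm; ring.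
move: e; rewrite em; move: (mod4_sqr R) (mod4_sqr T).
have -> : (m = m %/ 4 * 4 + 1)%N by rewrite {1}(divn_eq m 4) hm.
clear; generalize (m %/ 4 * R ^ 2)%N (R ^ 2)%N (T ^ 2)%N => A B C.
rewrite (divn_eq B 4) (divn_eq C 4) !modnMDl !modn_mod.
move: (B %/ 4)%N (C %/ 4)%N => q q'.
by case=> ->; case=> -> => - []; lia.
Qed.

Section Theta.
Variables (p1 p2 : nat) (s1 s2 : {rmorphism algC -> algC}).
Hypothesis H : biquad p1 p2 s1 s2.
Variables e1 e2 e3 n2 : algC.
Hypothesis UH : units p1 p2 s1 s2 e1 e2 e3 n2.

Local Notation r2 := (sqrtC 2 : algC).
Local Notation rm := (sqrtC (p1 * p2)%:R : algC).
Local Notation rd := (sqrtC (2 * p1 * p2)%:R : algC).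
Local Notation K0 := (Qgen [:: r2; rm]).
Local Notation U := (unit_mon e1 e2 e3).

Let f1 := u_f1 UH. Let f2 := u_f2 UH. Let f3 := u_f3 UH.
Let ne1 := fund_neq0 f1. Let ne2 := fund_neq0 f2. Let ne3 := fund_neq0 f3.
Let ke1 := e1_K0 UH. Let ke2 := e2_K0 UH. Let ke3 := e3_K0 UH.
Let ae1 := fund_aunit f1. Let ae2 := fund_aunit f2. Let ae3 := fund_aunit f3.

(* [nu] is 1 if [e2] has norm -1 and 0 if it has norm 1; [U nu 1 nu] is then the only nontrivial class of units, modulo squares of units, that can become a square in [K0]. *)
Definition normexp : int := if n2 == -1 then 1 else 0.
Local Notation nu := normexp.

Lemma nuP : (n2 = 1 /\ nu = 0) \/ (n2 = -1 /\ nu = 1).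
Proof.
rewrite /normexp; case: (u_n2 UH) => ->; [left|right]; rewrite ?eqxx //.
by rewrite eq_sym eqNr oner_eq0.
Qed.

Lemma sign_mul_even a b : (-1 : algC) ^ a * (-1) ^ b = 1 -> exists q, a = b + 2 * q.
Proof.
move=> h; have : (-1 : algC) ^ (a + b) = 1 by rewrite expfzDr ?oppr_eq0 ?oner_neq0.
by move/sign_even => [q eq]; exists (q - b); lia.
Qed.

Lemma U_sqr_nu y a b c : K0 y -> y ^+ 2 = U a b c ->
  exists q q', a = nu * b + 2 * q /\ c = nu * b + 2 * q'.
Proof.
move=> hy e; have [h1 h2] := U_sqr_parity H UH hy e.
have [q eq] := sign_mul_even h2.
case: nuP => - [en ->]; rewrite en in h1.
  move: h1; rewrite exp1rz mul1r => /sign_even [q' eq'].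
  by exists (q + q'), q'; split; lia.
have [q' eq'] := sign_mul_even h1.
by exists (q - q'), (- q'); split; lia.
Qed.

Lemma U_sqrE a b c : (U a b c) ^+ 2 = U (2 * a) (2 * b) (2 * c).
Proof. by rewrite !mulrDl !mul1r (UD UH) expr2. Qed.

(* Take [y = 1 + e2] if [e2] has norm 1 and [y = e1 e2 e3 + e1 + e2 - e3] otherwise: [y^2 / theta] is then fixed by [s1] and [s2]. *)
Lemma theta_nat_sqr : exists M : nat, exists y, [/\ (0 < M)%N, K0 y & y ^+ 2 = M%:R * U nu 1 nu].
Proof.
have e10 : 1 < e1 := fund_gt1 f1. have e20 : 1 < e2 := fund_gt1 f2. have e30 : 1 < e3 := fund_gt1 f3.
have p1e : 0 < e1 := lt_trans ltr01 e10. have p2e : 0 < e2 := lt_trans ltr01 e20.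
have p3e : 0 < e3 := lt_trans ltr01 e30.
have fin (y : algC) : K0 y -> y \is Num.real -> y != 0 -> y \in Aint ->
    s1 (y ^+ 2 / U nu 1 nu) = y ^+ 2 / U nu 1 nu -> s2 (y ^+ 2 / U nu 1 nu) = y ^+ 2 / U nu 1 nu ->
    exists M : nat, exists y, [/\ (0 < M)%N, K0 y & y ^+ 2 = M%:R * U nu 1 nu].
  move=> hy ry ny iy h1 h2; have hU := U_K0 UH nu 1 nu; have uU := U_aunit UH nu 1 nu.
  have pos : 0 < y ^+ 2 / U nu 1 nu by rewrite divr_gt0 ?real_sqr_gt0 // (U_gt0 UH).
  have [M eM] : exists M : nat, y ^+ 2 / U nu 1 nu = M%:R.
    apply: Crat_Aint_natP; last exact: ltW.
      by apply: (fixed_Q H) => //; sf.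
    by apply: rpredM; [exact: rpredX | exact/aunit_int/aunitV].
  exists M, y; split => //; last by rewrite -eM divfK // aunit_neq0.
  by rewrite -(ltr_nat algC) -eM.
case: nuP => - [en env].
  apply: (fin (1 + e2)).
  - by sf.
  - by rewrite rpredD // ger0_real // ltW.
  - by rewrite gt_eqF // addr_gt0.
  - by rewrite rpredD ?rpred1 ?aunit_int.
  - have h : s1 e2 = e2^-1 by rewrite (u_s1e2 UH) en mul1r.
    rewrite env /unit_mon !expr0z expr1z mul1r mulr1 fmorph_div rmorphXn rmorphD rmorph1 h.
    by field; rewrite ne2.
  - rewrite env /unit_mon !expr0z expr1z mul1r mulr1 fmorph_div rmorphXn rmorphD rmorph1.
    by rewrite (s2e2 H UH).
have h12 : s1 e2 = - e2^-1 by rewrite (u_s1e2 UH) en mulN1r.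
have h11 := s1e1 H UH. have h22 := s2e2 H UH. have h23 := s2e3 H UH.
have h13 := u_s1e3 UH. have h21 := u_s2e1 UH.
apply: (fin (e1 * e2 * e3 + e1 + e2 - e3)).
- by sf.
- by rewrite rpredB ?rpredD ?rpredM // ger0_real // ltW.
- have -> : e1 * e2 * e3 + e1 + e2 - e3 = e3 * (e1 * e2 - 1) + (e1 + e2) by ring.
  rewrite gt_eqF // addr_gt0 ?addr_gt0 // mulr_gt0 // subr_gt0.
  by rewrite -[1]mulr1 ltr_pM ?ler01.
- apply: rpredB; last exact: aunit_int.
  apply: rpredD; last exact: aunit_int.
  apply: rpredD; last exact: aunit_int.
  by apply: rpredM; [apply: rpredM|]; exact: aunit_int.
- rewrite env /unit_mon !expr1z fmorph_div rmorphXn rmorphB !rmorphD !rmorphM h11 h12 h13.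
  by field; rewrite ne1 ne2 ne3 ?oppr_eq0 ?oner_neq0.
- rewrite env /unit_mon !expr1z fmorph_div rmorphXn rmorphB !rmorphD !rmorphM h21 h22 h23.
  by field; rewrite ne1 ne2 ne3 ?oppr_eq0 ?oner_neq0.
Qed.

Lemma theta_sqr_class : exists2 y, K0 y & y ^+ 2 = U nu 1 nu \/ y ^+ 2 = p1%:R * U nu 1 nu.
Proof.
have [M [y [M0 hy e]]] := theta_nat_sqr.
exact: (sqr_class H hy M0 (U_aunit UH _ _ _) e).
Qed.

(** Suppose the norm is 1. If [s2] fixes [y], then [e2] is a square in its own field. Otherwise
    [(y + s1 y) r2] and [(y - s1 y) r2 rm] are rational integers [P] and [Q] up to sign, and
    [y * s1 y] is a sign; their squares, in terms of [t = e2 + e2^-1], contradict [mod4_absurd]. *)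
Lemma sqrt_e2_norm y : K0 y -> y ^+ 2 = e2 -> n2 = -1.
Proof.
move=> hy ey; case: (u_n2 UH) => // en; exfalso.
have ky := K_of_K0 hy; have ky1 := K0_s1 H hy.
have ny : y != 0 by apply: contraNneq ne2 => y0; rewrite -ey y0 expr0n.
have uy : aunit y by apply: (@aunit_root y 2) => //; rewrite ey.
have : s2 y ^+ 2 = y ^+ 2 by rewrite -rmorphXn /= ey (s2e2 H UH).
move/eqP; rewrite eqf_sqr => /orP [] /eqP s2y.
  by apply: (fund_not_sqr f2 (u := y) (n := 0)) => //; exact: (fixed_Qm H).
have h1 : s1 e2 = e2^-1 by rewrite (u_s1e2 UH) en mul1r.
have e2N : (y * s1 y) ^+ 2 = 1 by rewrite exprMn -rmorphXn /= ey h1 divff.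
have iy : y \in Aint by exact: aunit_int.
have is1 : s1 y \in Aint by rewrite Aint_aut.
have i2 : r2 \in Aint by apply: (@Aint_root _ 2) => //; rewrite sqrtCK Aint_nat.
have im : rm \in Aint by apply: (@Aint_root _ 2) => //; rewrite sqrtCK Aint_nat.
have ss : s1 (s1 y) = y by exact: (s1_s1 H).
have s21 : s2 (s1 y) = - s1 y by rewrite (s2_s1 H ky) s2y rmorphN.
have rx x : K0 x -> x \in Aint -> s1 x = x -> s2 x = x -> exists N : nat, x ^+ 2 = (N ^ 2)%:R.
  move=> hx ix h2 h3; have hq := fixed_Q H hx h2 h3.
  have [t et] : exists t : nat, x ^+ 2 = t%:R.
    apply: Crat_Aint_natP; [by rewrite rpredX | by rewrite rpredX |].
    by apply: real_exprn_even_ge0 => //; exact: (K0_real hx).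
  by have [N eN] := @Crat_Aint_nat _ _ hq et; exists N; rewrite et eN.
have [P eP] : exists P : nat, ((y + s1 y) * r2) ^+ 2 = (P ^ 2)%:R.
  apply: rx; [by sf | by rewrite rpredM ?rpredD | |].
    by rewrite rmorphM rmorphD ss (s1_2 H); ring.
  by rewrite rmorphM rmorphD s2y s21 (s2_2 H); ring.
have [Q eQ] : exists Q : nat, ((y - s1 y) * (r2 * rm)) ^+ 2 = (Q ^ 2)%:R.
  apply: rx; [by sf | by rewrite rpredM ?rpredB // rpredM | |].
    by rewrite (rmorphM s1) (rmorphB s1) ss (rmorphM s1 r2) (s1_2 H) (s1_m H); ring.
  by rewrite (rmorphM s2) (rmorphB s2) s2y s21 (rmorphM s2 r2) (s2_2 H) (s2_m H); ring.
have [t et] : exists t : nat, e2 + e2^-1 = t%:R.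
  have e20 : 0 < e2 by exact: (lt_trans ltr01 (fund_gt1 f2)).
  apply: Crat_Aint_natP; last by rewrite addr_ge0 ?invr_ge0 ?ltW.
    apply: (fixed_Q H); first by sf.
      by rewrite rmorphD fmorphV h1 invrK addrC.
    by rewrite rmorphD fmorphV (s2e2 H UH).
  by rewrite rpredD // aunit_int // aunitV.
have ePt : (P ^ 2)%:R = 2 * (t%:R + 2 * (y * s1 y)).
  by rewrite -eP -et exprMn sqrtCK -h1 -ey rmorphXn; ring.
have eQt : (Q ^ 2)%:R = 2 * ((p1 * p2)%:R * (t%:R - 2 * (y * s1 y))).
  rewrite -eQ -et !exprMn !sqrtCK -h1 -ey rmorphXn /=.
  by set m := (p1 * p2)%:R; ring.
have hm : (p1 * p2 %% 4 = 1)%N by rewrite -modnMm (bq_m1 H) (bq_m2 H).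
apply: (@mod4_absurd P Q t _ hm).
move/eqP: e2N; rewrite sqrf_eq1 => /orP [] /eqP eN; rewrite eN in ePt eQt; [left | right];
  split; apply/eqP; rewrite -(eqr_nat algC).
- by rewrite ePt (natrM _ 2 (t + 2)) (natrD _ t 2) mulr1.
- rewrite (natrD _ (Q ^ 2)) eQt (natrM _ 4) (natrM _ 2) (natrM _ (p1 * p2)%N t).
  by set m := (p1 * p2)%:R; apply/eqP; ring.
- by rewrite (natrD _ (P ^ 2)) ePt (natrM _ 2 t); apply/eqP; ring.
- rewrite eQt (natrM _ 2) (natrM _ (p1 * p2)%N (t + 2)) (natrD _ t 2).
  by apply/eqP; ring.
Qed.

Local Notation W := (unit_subgroup e1 e2 e3).

Lemma W_U a b c : W (U a b c).
Proof. by exists false, a, b, c; rewrite expr0 mul1r. Qed.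

Lemma W_opp u : W u -> W (- u).
Proof.
move=> [s [a [b [c ->]]]]; exists (~~ s), a, b, c.
by case: s; rewrite ?expr0 ?expr1; ring.
Qed.

Lemma W_cases u : W u -> exists a b c, u = U a b c \/ u = - U a b c.
Proof.
move=> [s [a [b [c ->]]]]; exists a, b, c.
by case: s; [right | left]; rewrite /unit_mon ?expr0 ?expr1; ring.
Qed.

Lemma W_div u v : W u -> W v -> W (u / v).
Proof.
move=> /W_cases [a [b [c hu]]] /W_cases [a' [b' [c' hv]]].
have e : U a b c / U a' b' c' = U (a - a') (b - b') (c - c') by rewrite -UN -(UD UH).
have h : W (U a b c / U a' b' c') by rewrite e; exact: W_U.
by case: hu => ->; case: hv => ->; rewrite ?invrN ?mulrN ?mulNr ?opprK //; exact: W_opp.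
Qed.

Lemma sqr_U_W y a b c : y ^+ 2 = U (2 * a) (2 * b) (2 * c) -> W y.
Proof.
rewrite -U_sqrE => /eqP; rewrite eqf_sqr => /orP [] /eqP ->; first exact: W_U.
by apply: W_opp; exact: W_U.
Qed.

Lemma W_sqr_even y a b c : W y -> y ^+ 2 = U a b c -> exists q r s, [/\ a = 2 * q, b = 2 * r & c = 2 * s].
Proof.
move=> /W_cases [q [r [s hy]]] e; exists q, r, s.
apply: (U_inj H UH); rewrite -e -U_sqrE.
by case: hy => ->; rewrite ?sqrrN.
Qed.

Lemma index1_W : unit_index K0 W 1 -> forall u, K0 u -> aunit u -> W u.
Proof.
move=> [c [_ [_ h]]] u hu au.
have [i hi] := h u ((is_unitP u (Qgen_subfield _)).2 (conj hu au)).
have [j hj] := h 1 ((is_unitP 1 (Qgen_subfield _)).2 (conj (subfield1 _ (Qgen_subfield _)) aunit1)).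
rewrite (ord1 i) in hi; rewrite (ord1 j) in hj.
have := W_div hi hj.
have nc : c 0 != 0.
  apply/eqP => c0; rewrite c0 invr0 mulr0 in hj; have [a [b [d]]] := W_cases hj.
  have := aunit_neq0 (U_aunit UH a b d).
  by move=> n0 [] /eqP; rewrite eq_sym ?oppr_eq0 (negPf n0).
by rewrite (_ : u / c 0 / (1 / c 0) = u) //; field.
Qed.

Lemma index2_notW : unit_index K0 W 2 -> exists v, [/\ K0 v, aunit v & ~ W v].
Proof.
move=> [c [h1 [h2 _]]]; exists (c 0 / c 1).
have /is_unitP [k0 a0] := h1 0; have /is_unitP [k1 a1] := h1 1.
split; [by sf | exact: aunit_div |].
by move/h2.
Qed.

(** A square root of [theta] would be a unit, hence in [W]; but then the exponent of [e2] in [theta]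
    would be even. *)
Lemma index1_beta : unit_index K0 W 1 -> exists2 y, K0 y & y ^+ 2 = p1%:R * U nu 1 nu.
Proof.
move/index1_W => hW; have [y hy [e|e]] := theta_sqr_class; last by exists y.
have ay : aunit y by apply: (@aunit_root y 2) => //; rewrite e; exact: (U_aunit UH).
have [q [r [s [_ hr _]]]] := W_sqr_even (hW y hy ay) e.
by exfalso; lia.
Qed.

(** Take a unit [v] outside [W] and write [v ^ 2 = U a b c]. The parities of [a] and [c] follow that
    of [b]; an even [b] would put [v] in [W], and an odd [b] gives a square root of [theta] after
    division by a monomial. Norm 1 is ruled out because [theta] would then be [e2]. *)
Lemma index2_eta : unit_index K0 W 2 -> exists2 y, K0 y & y ^+ 2 = U 1 1 1 /\ n2 = -1.
Proof.
move/index2_notW => [v [hv av nW]].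
have [a [b [c e]]] := unit_sqr H UH hv av.
have [q [q' [ea ec]]] := U_sqr_nu hv e.
have [j [t eb]] := int_parity b.
case: t eb => eb; last first.
  case: nW; apply: (@sqr_U_W _ (nu * j + q) j (nu * j + q')).
  by rewrite e ea ec eb; congr (unit_mon _ _ _ _ _ _); lia.
have hu := U_K0 UH (nu * j + q) j (nu * j + q').
have nU := aunit_neq0 (U_aunit UH (nu * j + q) j (nu * j + q')).
have ey : (v / U (nu * j + q) j (nu * j + q')) ^+ 2 = U nu 1 nu.
  rewrite exprMn exprVn U_sqrE e -UN -(UD UH) ea ec eb.
  by congr (unit_mon _ _ _ _ _ _); lia.
exists (v / U (nu * j + q) j (nu * j + q')); first by sf.
case: nuP => - [en env]; last by rewrite ey env.
suff : n2 = -1 by rewrite ey /normexp => ->; rewrite eqxx.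
apply: (@sqrt_e2_norm (v / U (nu * j + q) j (nu * j + q'))); first by sf.
by rewrite ey env /unit_mon !expr0z expr1z; ring.
Qed.
End Theta.

(** * The capitulation kernel *)

Lemma i_sqr : 'i ^+ 2 = -1 :> algC. Proof. exact: sqrCi. Qed.
Lemma aunit_i : aunit 'i.
Proof. by apply: (@aunit_root _ 2) => //; rewrite sqrCi; apply: aunitN; exact: aunit1. Qed.

Definition zeta : algC := (1 + 'i) / sqrtC 2.
Definition alpha0 : algC := 1 + zeta.

Lemma zeta_sqr : zeta ^+ 2 = 'i.
Proof.
rewrite /zeta exprMn exprVn sqrtCK.
have -> : (1 + 'i) ^+ 2 = 1 + 'i ^+ 2 + 2 * 'i :> algC by ring.
by rewrite i_sqr; field.
Qed.

Lemma aunit_zeta : aunit zeta.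
Proof. by apply: (@aunit_root _ 2) => //; rewrite zeta_sqr; exact: aunit_i. Qed.

Lemma sqrt2_zeta : sqrtC 2 = (1 + 'i) / zeta.
Proof.
have nz := aunit_neq0 aunit_zeta; apply: (mulIf nz); rewrite divfK //.
by rewrite /zeta mulrC divfK // sqrtC_eq0 pnatr_eq0.
Qed.

Lemma alpha0_sqr : alpha0 ^+ 2 = (1 + 'i) * (1 + sqrtC 2).
Proof.
have E2 : sqrtC 2 ^+ 2 = 2 :> algC by rewrite sqrtCK.
have n2 : sqrtC 2 != 0 :> algC by rewrite sqrtC_eq0 pnatr_eq0.
have -> : alpha0 ^+ 2 = 1 + 2 * zeta + zeta ^+ 2 by rewrite /alpha0; ring.
by rewrite zeta_sqr -{1}E2 /zeta; field.
Qed.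

Lemma one_plus_i_neq0 : 1 + 'i != 0 :> algC.
Proof.
apply/eqP => h; have : (1 + 'i) * (1 - 'i) = 2 :> algC.
  by have -> : (1 + 'i) * (1 - 'i) = 1 - 'i ^+ 2 :> algC; [ring | rewrite i_sqr; ring].
by rewrite h mul0r => /eqP; rewrite eq_sym pnatr_eq0.
Qed.

Lemma alpha0_neq0 : alpha0 != 0.
Proof.
suff : alpha0 ^+ 2 != 0 by apply: contraNneq => ->; rewrite expr0n.
by rewrite alpha0_sqr mulf_neq0 ?one_plus_i_neq0 // (aunit_neq0 aunit_sqrt2p1).
Qed.

Section RealUnits.
Variables (p1 p2 : nat) (s1 s2 : {rmorphism algC -> algC}).
Hypothesis H : biquad p1 p2 s1 s2.
Variables e1 e2 e3 n2 : algC.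
Hypothesis UH : units p1 p2 s1 s2 e1 e2 e3 n2.

Local Notation r2 := (sqrtC 2 : algC).
Local Notation rm := (sqrtC (p1 * p2)%:R : algC).
Local Notation rd := (sqrtC (2 * p1 * p2)%:R : algC).
Local Notation k := (Qgen [:: rd; 'i]).
Local Notation K := (Qgen [:: r2; rm; 'i]).
Local Notation K0 := (Qgen [:: r2; rm]).
Local Notation Qd := (Qgen [:: rd]).
Local Notation U := (unit_mon e1 e2 e3).

Let f1 := u_f1 UH. Let f2 := u_f2 UH. Let f3 := u_f3 UH.
Let ne1 := fund_neq0 f1. Let ne2 := fund_neq0 f2. Let ne3 := fund_neq0 f3.
Let ke3 := k_of_Qd (fund_mem f3).

Lemma k_real_Qd x : k x -> conjr x = x -> Qd x.
Proof.
move=> hx hc; apply: (fixed_Qd H); last exact: (sg_k H).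
by apply: fixed_K0 => //; exact: K_of_k.
Qed.

Lemma zeta_K : K zeta. Proof. by rewrite /zeta; sf. Qed.
Lemma alpha0_K : K alpha0. Proof. by have h := zeta_K; rewrite /alpha0; sf. Qed.

Lemma r2_notin_Qd : ~ Qd r2.
Proof.
move=> /(sg_Qd H); rewrite (sg_2 H) => /eqP; rewrite eq_sym -addr_eq0 => /eqP h.
have : 2 * r2 = 0 by rewrite -h; ring.
by move/eqP; rewrite mulf_eq0 pnatr_eq0 (negPf r2_neq0).
Qed.

Lemma Qd_unit_gt0 x : Qd x -> aunit x -> 0 < x -> exists c, x = e3 ^ c.
Proof.
move=> hx ux px; have [s [c ec]] := fund_gen f3 hx ux; exists c.
have pe : 0 < e3 ^ c by rewrite exprz_gt0 // (lt_trans ltr01 (fund_gt1 f3)).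
case: s ec => ec; last by rewrite ec mul1r.
by move: px; rewrite ec expr1 mulN1r oppr_gt0 lt_gtF.
Qed.

(** Otherwise [sqrt 2 * x] is a square root of [e3 ^ c] in [K0]. Parity makes [c] even, and then
    [sqrt 2] lies in the field of [sqrt (2 p1 p2)]. *)
Lemma two_e3_not_sqr x c : Qd x -> 2 * x ^+ 2 = e3 ^ c -> False.
Proof.
move=> hx e; have kx := K0_of_Qd hx.
have e' : (r2 * x) ^+ 2 = U 0 0 c by rewrite exprMn sqrtCK e /unit_mon !expr0z !mul1r.
have hrx : K0 (r2 * x) by sf.
have [q [q' [_ ec]]] := U_sqr_nu H UH hrx e'.
have nx : x != 0.
  apply/eqP => x0; move: e; rewrite x0 expr0n mulr0 => /esym/eqP.
  by rewrite expfz_eq0 (negPf ne3) andbF.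
have : (r2 * x) ^+ 2 = (e3 ^ q') ^+ 2.
  by rewrite e' /unit_mon !expr0z !mul1r ec mulr0 add0r mulrC -exprz_exp.
have h3 := fund_mem f3.
move/eqP; rewrite eqf_sqr => /orP [] /eqP er; apply: r2_notin_Qd.
  by have -> : r2 = e3 ^ q' / x; [rewrite -er mulfK | sf].
by have -> : r2 = - e3 ^ q' / x; [rewrite -er mulfK | sf].
Qed.

Lemma conj_normr x : x * conjr x = `|x| ^+ 2. Proof. by rewrite normCK. Qed.
Lemma conjrK x : conjr (conjr x) = x. Proof. exact: conjCK. Qed.

Lemma w2_cases w : w ^+ 2 = -1 -> w = 'i \/ w = - 'i.
Proof. by move/eqP; rewrite -i_sqr eqf_sqr => /orP [] /eqP ->; [left | right]. Qed.

(* [z] is [y ^ 3] times a root of unity. *)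
Lemma unit_sqr_real y x a b : K y -> aunit y -> k x -> y ^+ 2 = x * U a b 0 ->
  exists2 z, K0 z & exists c, z ^+ 2 = U (3 * a) (3 * b) c.
Proof.
move=> ky uy kx e.
have nU := aunit_neq0 (U_aunit UH a b 0); have hU := K_of_K0 (U_K0 UH a b 0).
have cU : conjr (U a b 0) = U a b 0 by apply: (@conj_K0 p1 p2); exact: (U_K0 UH).
have ex : x = y ^+ 2 / U a b 0 by rewrite e mulfK.
have ux : aunit x by rewrite ex; apply: aunit_div; [exact: aunitX | exact: (U_aunit UH)].
have nx := aunit_neq0 ux; have kcx := k_conj kx.
have ny := aunit_neq0 uy; have ncy : conjr y != 0 by rewrite fmorph_eq0.
have ncx : conjr x != 0 by rewrite fmorph_eq0.
pose w := x / conjr x.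
have kw : k w by rewrite /w; sf.
have cw : conjr w = w^-1 by rewrite /w fmorph_div /= conjrK invf_div.
have nw : w != 0 by rewrite /w mulf_neq0 // invr_eq0.
have ww : w * conjr w = 1 by rewrite cw divff.
have uw : aunit w by apply: aunit_div => //; exact: aunit_aut.
have ht : Qd (w + conjr w).
  apply: k_real_Qd; first by rewrite cw; sf.
  by rewrite rmorphD conjrK addrC.
have ekey : (y / conjr y) ^+ 2 = w by rewrite exprMn exprVn -rmorphXn e rmorphM /= cU /w; field; rewrite ncx nU.
have fin t : K t -> t ^+ 4 = 1 \/ t ^+ 4 = -1 -> k (t ^+ 2) -> conjr (t * y ^+ 3) = t * y ^+ 3 ->
    exists2 z, K0 z & exists c, z ^+ 2 = U (3 * a) (3 * b) c.
  move=> kt t4 kt2 hc; have hz : K0 (t * y ^+ 3) by apply: fixed_K0 => //; sf.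
  exists (t * y ^+ 3) => //.
  have ut : aunit t.
    by case: t4 => t4; apply: (@aunit_root t 4) => //; rewrite t4; [exact: aunit1 | apply: aunitN; exact: aunit1].
  have nt := aunit_neq0 ut.
  have U3 : U a b 0 ^+ 3 = U (3 * a) (3 * b) 0.
    by rewrite /unit_mon !exprMn !expr0z expr1n -!(mulrC _ 3) -!exprz_exp.
  have nU3 := aunit_neq0 (U_aunit UH (3 * a) (3 * b) 0).
  have ez : (t * y ^+ 3) ^+ 2 = t ^+ 2 * x ^+ 3 * U (3 * a) (3 * b) 0.
    by rewrite -U3 exprMn -exprM mulnC exprM e !exprMn mulrA.
  have kk : k (t ^+ 2 * x ^+ 3) by sf.
  have hq : Qd (t ^+ 2 * x ^+ 3).
    apply: k_real_Qd => //.
    have -> : t ^+ 2 * x ^+ 3 = (t * y ^+ 3) ^+ 2 / U (3 * a) (3 * b) 0 by rewrite ez mulfK.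
    by rewrite fmorph_div rmorphXn hc (conj_K0 (U_K0 UH _ _ _)).
  have pos : 0 < t ^+ 2 * x ^+ 3.
    have : 0 < (t * y ^+ 3) ^+ 2.
      by apply: real_sqr_gt0; [exact: (K0_real hz) | rewrite mulf_neq0 // expf_neq0].
    by rewrite ez pmulr_lgt0 // (U_gt0 UH).
  have [c ec] := Qd_unit_gt0 hq (aunitM (aunitX 2 ut) (aunitX 3 ux)) pos.
  by exists c; rewrite ez ec /unit_mon !expr0z; ring.
(* Since [q ^ 2 = w ^ 3] is a sign, [q] is one of 1, -1, ['i], [- 'i]. For [t * y ^ 3] to be real,
   the root of unity [t] must satisfy [t ^ 2 = q^-1], which gives 1, ['i], [zeta^-1] and [zeta]. *)
pose q := (y / conjr y) ^+ 3.
have cq : conjr (y ^+ 3) = y ^+ 3 / q by rewrite rmorphXn /q exprMn exprVn; field; rewrite ncy ny.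
have q2 : q ^+ 2 = w ^+ 3 by rewrite /q -exprM mulnC exprM ekey.
have kz := zeta_K; have nz := aunit_neq0 aunit_zeta.
have zi : conjr zeta = zeta / 'i.
  rewrite /zeta fmorph_div rmorphD rmorph1 conjr_i conjr_real ?sqrt_nat_real //.
  by have -> : 1 - 'i = (1 + 'i) / 'i :> algC; [apply: (mulIf (neq0Ci _)); rewrite divfK ?neq0Ci // mulrBl mul1r -expr2 i_sqr; ring | field; rewrite neq0Ci r2_neq0].
have z4 : zeta ^+ 4 = -1 by rewrite (exprM _ 2 2) zeta_sqr i_sqr.
have ki : k 'i by sf.
have i4 : 'i ^+ 4 = 1 :> algC by rewrite (exprM _ 2 2) i_sqr sqrrN expr1n.
have iV : 'i^-1 = - 'i :> algC by apply: (mulfI (neq0Ci _)); rewrite mulfV ?neq0Ci // mulrN -expr2 i_sqr opprK.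
have := norm1_root_of_unity H (K_of_k kw) uw ww ht; case=> hw.
- move: q2; rewrite hw => /eqP; rewrite sqrf_eq1 => /orP [] /eqP eq.
    apply: (fin 1); rewrite ?expr1n; [by sf | by left | by sf |].
    by rewrite mul1r cq eq divr1.
  apply: (fin 'i); [by sf | by left | by sf |].
  by rewrite rmorphM conjr_i cq eq invrN1; ring.
- move: q2; rewrite hw => /w2_cases [] eq.
    apply: (fin zeta^-1); [by sf | | |].
    + by right; rewrite exprVn z4 invrN1.
    + by rewrite exprVn zeta_sqr; sf.
    + rewrite rmorphM fmorphV zi cq eq; field; rewrite nz neq0Ci //.
  apply: (fin zeta); [by sf | by right | by rewrite zeta_sqr; sf |].
  by rewrite rmorphM zi cq eq invrN iV -mulrA mulrCA; have -> : - - 'i = 'i :> algC; [ring | rewrite mulrA mulrCA mulrA; have := i_sqr => ii; rewrite -[RHS]mul1r; have -> : (1 : algC) = - 'i * 'i; [rewrite mulNr -expr2 ii opprK | ring]].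
(* If [w] is ['i] or [- 'i], dividing [x] by [1 + 'i] or [1 - 'i] gives a real [r] of [k] for which
   [2 r ^ 2 = x * conjr x] is a power of [e3]. *)
- exfalso; have [ew|ew] := w2_cases hw.
    have ex' : x = 'i * conjr x by rewrite -ew /w divfK.
    pose r := x / (1 + 'i).
    have n1 := one_plus_i_neq0; have n1' : 1 - 'i != 0 :> algC by have := n1; rewrite -(fmorph_eq0 conjr) rmorphD rmorph1 conjr_i.
    have hr : Qd r.
      apply: k_real_Qd; first by rewrite /r; sf.
      rewrite /r fmorph_div rmorphD rmorph1 conjr_i {2}ex'.
      have hi : (1 + 'i) = 'i * (1 - 'i) :> algC by rewrite mulrBr mulr1 -expr2 i_sqr; ring.
      by rewrite hi; field; rewrite n1' neq0Ci.
    have hr2 : 2 * r ^+ 2 = x * conjr x.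
      have -> : conjr x = x / 'i by rewrite {2}ex' mulrC mulKf // neq0Ci.
      rewrite /r exprMn exprVn.
      have -> : (1 + 'i) ^+ 2 = 2 * 'i :> algC.
        have -> : (1 + 'i) ^+ 2 = 1 + 'i ^+ 2 + 2 * 'i :> algC by ring.
        by rewrite i_sqr; ring.
      by field; rewrite neq0Ci.
    have [|||c ec] := @Qd_unit_gt0 (x * conjr x).
    + by apply: k_real_Qd; [sf | rewrite rmorphM conjrK mulrC].
    + by apply: aunitM => //; exact: aunit_aut.
    + by rewrite conj_normr exprn_gt0 // normr_gt0.
    by apply: (@two_e3_not_sqr r c) => //; rewrite hr2 ec.
  have ex' : x = - 'i * conjr x by rewrite -ew /w divfK.
  pose r := x / (1 - 'i).
  have n1 := one_plus_i_neq0; have n1' : 1 - 'i != 0 :> algC by have := n1; rewrite -(fmorph_eq0 conjr) rmorphD rmorph1 conjr_i.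
  have hr : Qd r.
    apply: k_real_Qd; first by rewrite /r; sf.
    rewrite /r fmorph_div rmorphB rmorph1 conjr_i opprK {2}ex'.
    have hi : (1 - 'i) = - 'i * (1 + 'i) :> algC by rewrite mulrDr mulr1 mulNr -expr2 i_sqr; ring.
    by rewrite hi; field; rewrite n1 neq0Ci.
  have hr2 : 2 * r ^+ 2 = x * conjr x.
    have -> : conjr x = x / - 'i by rewrite {2}ex' mulrC mulKf // oppr_eq0 neq0Ci.
    rewrite /r exprMn exprVn.
    have -> : (1 - 'i) ^+ 2 = - 2 * 'i :> algC.
      have -> : (1 - 'i) ^+ 2 = 1 + 'i ^+ 2 - 2 * 'i :> algC by ring.
      by rewrite i_sqr; ring.
    by field; rewrite neq0Ci.
  have [|||c ec] := @Qd_unit_gt0 (x * conjr x).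
  + by apply: k_real_Qd; [sf | rewrite rmorphM conjrK mulrC].
  + by apply: aunitM => //; exact: aunit_aut.
  + by rewrite conj_normr exprn_gt0 // normr_gt0.
  by apply: (@two_e3_not_sqr r c) => //; rewrite hr2 ec.
Qed.
End RealUnits.

Section CapitulationKernel.
Variables (p1 p2 : nat) (s1 s2 : {rmorphism algC -> algC}).
Hypothesis H : biquad p1 p2 s1 s2.
Variables e1 e2 e3 n2 : algC.
Hypothesis UH : units p1 p2 s1 s2 e1 e2 e3 n2.

Local Notation r2 := (sqrtC 2 : algC).
Local Notation rm := (sqrtC (p1 * p2)%:R : algC).
Local Notation rd := (sqrtC (2 * p1 * p2)%:R : algC).
Local Notation k := (Qgen [:: rd; 'i]).
Local Notation K := (Qgen [:: r2; rm; 'i]).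
Local Notation K0 := (Qgen [:: r2; rm]).
Local Notation Qd := (Qgen [:: rd]).
Local Notation sg := (sigma s1 s2).
Local Notation U := (unit_mon e1 e2 e3).
Local Notation W := (unit_subgroup e1 e2 e3).
Local Notation nu := (normexp n2).

Let f1 := u_f1 UH. Let f2 := u_f2 UH. Let f3 := u_f3 UH.
Let ne1 := fund_neq0 f1. Let ne2 := fund_neq0 f2. Let ne3 := fund_neq0 f3.
Let ke3 : k e3 := k_of_Qd (fund_mem f3).
Let ke1 := K_of_K0 (e1_K0 UH). Let ke2 := K_of_K0 (e2_K0 UH). Let kke3 := K_of_K0 (e3_K0 UH).

(** Depending on the sign of [w ^ 3], the inverse of [u ^ 3] or ['i] times it is real, and the
    factor ['i] is compensated inside [k]. The case [w ^ 2 = -1] is impossible: [sigma] fixes ['i]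
    but inverts [w]. *)
Lemma capit_sqr g : K g -> g != 0 -> aunit (sg g / g) ->
  exists u x v, [/\ K u /\ aunit u, k x, K0 v /\ aunit v & (g / u) ^+ 2 = x * v].
Proof.
move=> kg ng ua; have ksg := K_sg H kg; have ssg := sg_sg H kg.
have nsg : sg g != 0 by rewrite fmorph_eq0.
pose u := sg g / g; have ku : K u by rewrite /u; sf.
have nu0 := aunit_neq0 ua; have su : sg u = u^-1 by rewrite /u fmorph_div ssg invf_div.
have kcu := K_conj ku; have ncu : conjr u != 0 by rewrite fmorph_eq0.
have scu : sg (conjr u) = (conjr u)^-1 by rewrite (sg_conj H ku) su fmorphV.
pose w := u / conjr u.
have kw : K w by rewrite /w; sf.
have cw : conjr w = w^-1 by rewrite /w fmorph_div /= conjrK (invf_div u).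
have sw : sg w = w^-1 by rewrite /w fmorph_div scu su invrK (invf_div u) mulrC.
have nw : w != 0 by rewrite /w mulf_neq0 // invr_eq0.
have ww : w * conjr w = 1 by rewrite cw divff.
have uw : aunit w by apply: aunit_div => //; exact: aunit_aut.
have ht : Qd (w + conjr w).
  apply: (fixed_Qd H); last by rewrite rmorphD cw fmorphV sw invrK addrC.
  by apply: fixed_K0; [rewrite cw; sf | rewrite rmorphD conjrK addrC].
pose x := g * sg g.
have kx : k x by apply: (fixed_k H); [rewrite /x; sf | rewrite rmorphM ssg mulrC].
have ki : k 'i by sf.
have e : (g / u) ^+ 2 = x * (u ^+ 3)^-1 by rewrite /x /u; field; rewrite ng nsg.
have c3 : conjr (u ^+ 3) = u ^+ 3 / w ^+ 3 by rewrite rmorphXn /w; field; rewrite ncu nu0.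
have a3 : aunit (u ^+ 3)^-1 by apply/aunitV/aunitX.
have ni : 'i != 0 :> algC := neq0Ci _.
case: (norm1_root_of_unity H kw uw ww ht) => hw.
- exists u, x, (u ^+ 3)^-1; split => //; split => //.
  by apply: fixed_K0; [sf | rewrite fmorphV c3 hw divr1].
- exists u, (x / 'i), ('i * (u ^+ 3)^-1); split => //; first by sf.
    split; last by apply: aunitM => //; exact: aunit_i.
    apply: fixed_K0; first by sf.
    rewrite rmorphM conjr_i fmorphV c3 hw invrN1.
    have n3 : u ^+ 3 != 0 by rewrite expf_neq0.
    by field.
  by rewrite e; field; rewrite ni nu0.
- exfalso; have siw : sg w = w.
    have ki' : sg 'i = 'i := sg_i H.
    by have [->|->] := w2_cases hw; rewrite ?rmorphN ki'.
  move: hw; rewrite expr2 -{1}siw sw mulVf // => /eqP.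
  by rewrite eq_sym eqNr oner_eq0.
Qed.

Lemma e1_sqrt2 : exists q, 1 + r2 = e1 ^ (2 * q + 1).
Proof.
have [n -> [hn _]] := norm_e1_sub H f1; have [q [t et]] := int_parity n.
case: t et => et; first by exists q; rewrite et.
by move: hn; rewrite et addr0 sign_double => /eqP; rewrite eq_sym eqNr oner_eq0.
Qed.

Lemma odd_bool n : exists q (t : nat), n = 2 * q + t%:Z.
Proof. by have [q [t ->]] := int_parity n; exists q, t. Qed.

(** Powers of [alpha0] and [beta] absorb the odd parts of the exponents and a unit [u] absorbs the
    even parts; [e3] already lies in [k]. The quotient [d] then has its square in [k], so [sigma d]
    is [d] or [- d]. *)
Lemma kernel_reduce x0 beta g x a b : k x0 -> x0 != 0 -> K beta -> beta ^+ 2 = x0 * U nu 1 nu ->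
  K g -> g != 0 -> k x -> g ^+ 2 = x * U a b 0 ->
  exists2 y, k y /\ y != 0 & exists A B : nat, aunit (g / (y * (alpha0 ^+ A * beta ^+ B))).
Proof.
move=> kx0 nx0 kb eb kg ng kx eg.
(* The exponent [B] is the parity of [b]. As [beta ^ 2] also contributes [e1 ^ nu], the exponent [A]
   is the parity of what remains of [a]. *)
have [n en] := e1_sqrt2; have [q [B eB]] := odd_bool b.
have [r [A eA]] := odd_bool (a - nu * B%:Z).
pose u := e1 ^ (r - n * A%:Z) * e2 ^ q.
have ku : K u by rewrite /u; sf.
have au : aunit u by apply: aunitM; apply: aunitXz; [exact: (fund_aunit f1) | exact: (fund_aunit f2)].
have nb : beta != 0.
  apply: contraNneq (mulf_neq0 nx0 (aunit_neq0 (U_aunit UH nu 1 nu))) => b0.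
  by rewrite -eb b0 expr0n.
have na := alpha0_neq0; have ka := @alpha0_K p1 p2.
have nU := aunit_neq0 au.
pose d := g / (alpha0 ^+ A * beta ^+ B * u).
have kd : K d by rewrite /d; sf.
have nab : alpha0 ^+ A * beta ^+ B != 0 by apply: mulf_neq0; exact: expf_neq0.
have nabu := mulf_neq0 nab nU.
have nd : d != 0 by rewrite /d mulf_neq0 // invr_eq0.
have ea1 : alpha0 ^+ 2 = (1 + 'i) * e1 ^ (2 * n + 1) by rewrite alpha0_sqr en.
have n1i := one_plus_i_neq0.
pose z := x / ((1 + 'i) ^+ A * x0 ^+ B * e3 ^ (nu * B%:Z)).
have kz : k z by rewrite /z; sf.
have ed : d ^+ 2 = z.
  have h1 : g ^+ 2 = x * (e1 ^ a * e2 ^ b) by rewrite eg /unit_mon expr0z mulr1.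
  have h2 : (alpha0 ^+ A) ^+ 2 = (1 + 'i) ^+ A * e1 ^ ((2 * n + 1) * A%:Z).
    by rewrite -exprM mulnC exprM ea1 exprMn -exprz_exp.
  have h3 : (beta ^+ B) ^+ 2 = x0 ^+ B * (e1 ^ (nu * B%:Z) * e2 ^ B%:Z * e3 ^ (nu * B%:Z)).
    by rewrite -exprM mulnC exprM eb exprMn /unit_mon !exprMn expr1z -!exprz_exp.
  have h4 : u ^+ 2 = e1 ^ ((r - n * A%:Z) * 2) * e2 ^ (q * 2) by rewrite /u exprMn -!exprz_exp.
  have ha : a = (2 * n + 1) * A%:Z + nu * B%:Z + (r - n * A%:Z) * 2.
    have -> : a = nu * B%:Z + (a - nu * B%:Z) by ring.
    by rewrite eA; ring.
  have hb : b = B%:Z + q * 2 by rewrite eB; ring.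
  rewrite /d /z exprMn exprVn (exprMn 2 (_ * _) u) (exprMn 2 (alpha0 ^+ A)) h1 h2 h3 h4 {1}ha {1}hb !expfzDr //.
  have m1 m := expfz_neq0 m ne1; have m2 m := expfz_neq0 m ne2; have m3 m := expfz_neq0 m ne3.
  set E1 := e1 ^ _; set E2 := e1 ^ _; set E3 := e1 ^ _; set E4 := e2 ^ _; set E5 := e2 ^ _; set E6 := e3 ^ _.
  by field; rewrite ?expf_neq0 // /E1 /E2 /E3 /E4 /E5 /E6 ?m1 ?m2 ?m3.
have eg2 : g = d * (alpha0 ^+ A * beta ^+ B * u) by rewrite /d divfK.
have : sg d ^+ 2 = d ^+ 2 by rewrite -(rmorphXn sg) ed (sg_k H).
move/eqP; rewrite eqf_sqr => /orP [] /eqP sd.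
  exists d; first by split => //; exact: (fixed_k H).
  exists A, B; rewrite (_ : _ / _ = u) // eg2; field.
  by rewrite nd ?expf_neq0.
have [y ky ey] := antifixed_k H kd sd.
have nz := aunit_neq0 aunit_zeta.
have ny : y != 0 by apply: contraNneq nd => y0; rewrite ey y0 mul0r.
(* In this case [d] is [y * sqrt 2], and [sqrt 2] equals [1 + 'i] up to the unit [zeta], so the
   class is still accounted for in [k]. *)
exists (y * (1 + 'i)); first by split; [sf | rewrite mulf_neq0].
exists A, B; rewrite (_ : _ / _ = u / zeta).
  by apply: aunit_div => //; exact: aunit_zeta.
rewrite eg2 ey sqrt2_zeta; field.
by rewrite nz ny n1i ?expf_neq0.
Qed.

Lemma index1_kernel g : unit_index K0 W 1 -> K g -> g != 0 -> aunit (sg g / g) ->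
  exists u x a b, [/\ K u, aunit u, k x & (g / u) ^+ 2 = x * U a b 0].
Proof.
move=> hi kg ng ua; have [u [x [v [[ku au] kx [kv av] e]]]] := capit_sqr kg ng ua.
have [a [b [c hv]]] := W_cases (index1_W UH hi kv av).
have hU : U a b c = e3 ^ c * U a b 0 by rewrite /unit_mon expr0z; ring.
case: hv => hv; [exists u, (x * e3 ^ c), a, b | exists u, (- x * e3 ^ c), a, b];
  by split => //; [sf | rewrite e hv hU; ring].
Qed.

(** As [y ^ 2] is real, [y] or ['i * y] is real and hence lies in the real quadratic field, where no
    odd power of [e3] is a square and no square is negative. *)
Lemma e3_not_sqr_k y c : k y -> y ^+ 2 = e3 ^ (2 * c + 1) \/ y ^+ 2 = - e3 ^ (2 * c + 1) -> False.
Proof.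
move=> ky e; have ce : conjr e3 = e3 by exact: (conj_K0 (e3_K0 UH)).
have cy : conjr y ^+ 2 = y ^+ 2.
  by rewrite -rmorphXn /=; case: e => ->; rewrite ?rmorphN fmorphXz ce.
have pe : 0 < e3 ^ (2 * c + 1) by rewrite exprz_gt0 // (lt_trans ltr01 (fund_gt1 f3)).
have key z : k z -> conjr z = z -> z ^+ 2 = y ^+ 2 \/ z ^+ 2 = - y ^+ 2 -> False.
  move=> kz cz hz; have dz : Qd z by exact: (k_real_Qd H).
  have [ez|ez] : z ^+ 2 = e3 ^ (2 * c + 1) \/ z ^+ 2 = - e3 ^ (2 * c + 1).
    by case: hz => ->; case: e => ->; rewrite ?opprK; [left|right|right|left].
    exact: (fund_not_sqr f3 dz ez).
  have rz : z \is Num.real by exact/CrealP.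
  by have := real_exprn_even_ge0 rz (isT : ~~ odd 2); rewrite ez oppr_ge0 lt_geF.
move/eqP: cy; rewrite eqf_sqr => /orP [] /eqP cy.
  by apply: (key y) => //; left.
apply: (key ('i * y)); [by sf | by rewrite rmorphM conjr_i cy; ring |].
by right; rewrite exprMn i_sqr mulN1r.
Qed.

(** Up to sign [v] is a monomial, possibly times [eta = sqrt (e1 e2 e3)]. If [eta] occurred, the
    norm to [k] of [(g / u) ^ 2 = x * v] would make an odd power of [e3], up to sign, a square in
    [k], because [eta * sigma eta] is [e3] up to sign. *)
Lemma index2_kernel g : unit_index K0 W 2 -> K g -> g != 0 -> aunit (sg g / g) ->
  exists u x a b, [/\ K u, aunit u, k x & (g / u) ^+ 2 = x * U a b 0].
Proof.
move=> hi kg ng ua; have [u [x [v [[ku au] kx [kv av] e]]]] := capit_sqr kg ng ua.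
have [eta keta [eeta en2]] := index2_eta H UH hi.
have env : nu = 1 by case: (nuP UH) => - [h1 h2] //; rewrite /normexp en2 eqxx.
have [a [b [c ev]]] := unit_sqr H UH kv av.
have [q [q' [ea ec]]] := U_sqr_nu H UH kv ev; rewrite env mul1r in ea ec.
have [j [t eb]] := int_parity b.
have nv : 0 != U (q + j) j (q' + j) by rewrite eq_sym (aunit_neq0 (U_aunit UH _ _ _)).
have done_ s : v = s * U (q + j) j (q' + j) -> s = 1 \/ s = -1 ->
    exists u x a b, [/\ K u, aunit u, k x & (g / u) ^+ 2 = x * U a b 0].
  move=> hv hs; exists u, (x * s * e3 ^ (q' + j)), (q + j), j; split => //.
    by case: hs => ->; sf.
  by rewrite e hv /unit_mon expr0z; ring.
case: t eb => eb; last first.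
  have : v ^+ 2 = U (q + j) j (q' + j) ^+ 2.
    by rewrite ev (U_sqrE UH) ea ec eb; congr (unit_mon _ _ _ _ _ _); lia.
  move/eqP; rewrite eqf_sqr => /orP [] /eqP hv.
    by apply: (@done_ 1); [rewrite mul1r | left].
  by apply: (@done_ (-1)); [rewrite mulN1r | right].
exfalso.
have hv2 : v ^+ 2 = (eta * U (q + j) j (q' + j)) ^+ 2.
  rewrite exprMn ev eeta (U_sqrE UH) -(UD UH) ea ec eb.
  by congr (unit_mon _ _ _ _ _ _); lia.
have [s hs hv] : exists2 s, s = 1 \/ s = -1 & v = s * (eta * U (q + j) j (q' + j)).
  move/eqP: hv2; rewrite eqf_sqr => /orP [] /eqP ->; [exists 1 | exists (-1)];
  by [left | right | rewrite ?mul1r ?mulN1r].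
have kh : K (g / u) by sf.
have nh : g / u != 0 by rewrite mulf_neq0 // invr_eq0 aunit_neq0.
have nx : x != 0.
  by apply: contraNneq nh => x0; move/eqP: e; rewrite x0 mul0r expf_eq0 /= => /eqP ->.
have kn : k (g / u * sg (g / u)).
  apply: (fixed_k H); first by have hh := K_sg H kh; sf.
  by rewrite rmorphM (sg_sg H kh) mulrC.
have eN : (g / u * sg (g / u)) ^+ 2 = x ^+ 2 * (v * sg v).
  by rewrite exprMn -(rmorphXn sg) e (rmorphM sg) (sg_k H kx); ring.
have eEta : (eta * sg eta) ^+ 2 = e3 ^+ 2.
  rewrite exprMn -(rmorphXn sg) eeta (U_sgU H UH) en2 !expr1z; ring.
have [t ht eEta'] : exists2 t, t = 1 \/ t = -1 & eta * sg eta = t * e3.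
  move/eqP: eEta; rewrite eqf_sqr => /orP [] /eqP ->; [exists 1 | exists (-1)];
  by [left | right | rewrite ?mul1r ?mulN1r].
have [r hr eU] : exists2 r, r = 1 \/ r = -1 & U (q + j) j (q' + j) * sg (U (q + j) j (q' + j)) = r * (e3 ^ (q' + j)) ^+ 2.
  exists ((-1) ^ (q + j) * n2 ^ j); last exact: (U_sgU H UH).
  by apply: sign_mul; [exact: sign_int | exact: (n2_sign UH)].
have eV : v * sg v = (t * r) * e3 ^ (2 * (q' + j) + 1).
  have -> : e3 ^ (2 * (q' + j) + 1) = (e3 ^ (q' + j)) ^+ 2 * e3.
    by rewrite expfzDr // expr1z -expz2 exprz_exp (mulrC 2).
  have ss : s * s = 1 by case: hs => ->; ring.
  have sgs : sg s = s by case: hs => ->; rewrite ?rmorphN rmorph1.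
  rewrite hv (rmorphM sg s) (rmorphM sg eta) sgs.
  have -> : s * (eta * U (q + j) j (q' + j)) * (s * (sg eta * sg (U (q + j) j (q' + j)))) =
    (s * s) * (eta * sg eta) * (U (q + j) j (q' + j) * sg (U (q + j) j (q' + j))) by ring.
  by rewrite ss eEta' eU; ring.
apply: (@e3_not_sqr_k (g / u * sg (g / u) / x) (q' + j)); first by sf.
rewrite exprMn exprVn eN eV [x ^+ 2 * _]mulrC mulfK ?expf_neq0 //.
by have [->|->] := sign_mul ht hr; [left | right]; ring.
Qed.

(** Squaring the relation and applying [unit_sqr_real] gives a square in [K0] with exponents [3 a]
    and [3 B], where [a] has the parity of [A + nu B]. The parity law forces [A] to be even; for
    [Q = 1] the square root is a monomial up to sign, so [B] is even too. *)
Lemma split_parity x0 beta x y (A B : nat) : k x0 -> x0 != 0 -> beta ^+ 2 = x0 * U nu 1 nu ->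
  k x -> x != 0 -> K y -> aunit y -> alpha0 ^+ A * beta ^+ B = x * y ->
  ~~ odd A /\ (unit_index K0 W 1 -> ~~ odd B).
Proof.
move=> kx0 nx0 eb kx nx ky ay e.
have [n en] := e1_sqrt2.
have ea1 : alpha0 ^+ 2 = (1 + 'i) * e1 ^ (2 * n + 1) by rewrite alpha0_sqr en.
have n1i := one_plus_i_neq0.
pose a := (2 * n + 1) * A%:Z + nu * B%:Z.
pose z := (1 + 'i) ^+ A * x0 ^+ B * e3 ^ (nu * B%:Z) / x ^+ 2.
have kz : k z by rewrite /z; sf.
have ey : y ^+ 2 = z * U a B%:Z 0.
  have h2 : (alpha0 ^+ A) ^+ 2 = (1 + 'i) ^+ A * e1 ^ ((2 * n + 1) * A%:Z).
    by rewrite -exprM mulnC exprM ea1 exprMn -exprz_exp.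
  have h3 : (beta ^+ B) ^+ 2 = x0 ^+ B * (e1 ^ (nu * B%:Z) * e2 ^ B%:Z * e3 ^ (nu * B%:Z)).
    by rewrite -exprM mulnC exprM eb exprMn /unit_mon !exprMn expr1z -!exprz_exp.
  have -> : y ^+ 2 = (x * y) ^+ 2 / x ^+ 2 by field.
  rewrite -e exprMn h2 h3 /z /a /unit_mon expr0z expfzDr //.
  by field.
have [w kw [c ew]] := unit_sqr_real H UH ky ay kz ey.
have [q [q' [h1 h2]]] := U_sqr_nu H UH kw ew.
have oA : ~~ odd A.
  apply/negP => oA; have [A' eA] : exists A' : nat, A = (2 * A' + 1)%N.
    by exists A./2; rewrite -{1}(odd_double_half A) oA mul2n addnC.
  have : 2 * (q - 3 * (2 * n * A'%:Z + n + A'%:Z) - 1) = 1.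
    have -> : 2 * (q - 3 * (2 * n * A'%:Z + n + A'%:Z) - 1) =
      nu * (3 * B%:Z) + 2 * q - nu * (3 * B%:Z) - 6 * (2 * n * A'%:Z + n + A'%:Z) - 2 by ring.
    by rewrite -h1 /a eA PoszD PoszM; ring.
  by clear; move: (q - _ - 1) => X; lia.
split=> // hi; apply/negP => oB.
have [B' eB] : exists B' : nat, B = (2 * B' + 1)%N.
  by exists B./2; rewrite -{1}(odd_double_half B) oB mul2n addnC.
have aw : aunit w by apply: (@aunit_root w 2) => //; rewrite ew; exact: (U_aunit UH).
have [_ [r [_ [_ hr _]]]] := W_sqr_even H UH (index1_W UH hi kw aw) ew.
by move: hr; rewrite eB; lia.
Qed.
End CapitulationKernel.

(** * The primes above [1 + i], [pi1] and [pi2] *)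

Lemma odd_sqr_int q : (2 * q + 1) * (2 * q + 1) = 4 * (q * q + q) + 1 :> int.
Proof. ring. Qed.

Lemma even_sqr_int q : (2 * q) * (2 * q) = 4 * (q * q) :> int.
Proof. ring. Qed.

Lemma sum_sqr_even a b n : a * a + b * b = 4 * n -> (exists q, a = 2 * q) /\ (exists q, b = 2 * q).
Proof.
have [q [t et]] := int_parity a; have [r [s es]] := int_parity b; rewrite {}et {}es.
case: t; case: s; rewrite ?addr0 ?odd_sqr_int ?even_sqr_int; move: (q * q) (r * r) => Q R e;
  by [lia | split; [exists q | exists r]].
Qed.

(** The doubled coordinates are integers by trace, and the norm makes the sum of their squares
    divisible by 4, so both are even. *)
Lemma gauss_int x : Qgen [:: 'i] x -> x \in Aint -> exists a b, x = a%:~R + b%:~R * 'i.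
Proof.
move=> hx ix; have [|u [v [/Qgen_nil hu [/Qgen_nil hv ex]]]] := @Qgen_adjoin [::] 'i x _ hx.
  by rewrite sqrCi; sf.
have iA : 'i \in Aint by exact: (aunit_int aunit_i).
have cx : conjr x = u - v * 'i.
  by rewrite ex rmorphD rmorphM conjr_i !conjr_real ?Creal_Crat //; ring.
have icx : conjr x \in Aint by rewrite Aint_aut.
have /intrP [a ea] : 2 * u \in (Num.int : {pred algC}).
  apply: Cint_rat_Aint; first by rewrite rpredM // rpred_nat.
  have -> : 2 * u = x + conjr x by rewrite cx ex; ring.
  by rewrite rpredD.
have /intrP [b eb] : 2 * v \in (Num.int : {pred algC}).
  apply: Cint_rat_Aint; first by rewrite rpredM // rpred_nat.
  have -> : 2 * v = (conjr x - x) * 'i.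
    have -> : (conjr x - x) * 'i = - (2 * v) * 'i ^+ 2 by rewrite cx ex; ring.
    by rewrite i_sqr; ring.
  by rewrite rpredM // rpredB.
have uv : u ^+ 2 + v ^+ 2 = x * conjr x.
  have -> : x * conjr x = u ^+ 2 - v ^+ 2 * 'i ^+ 2 by rewrite cx ex; ring.
  by rewrite i_sqr; ring.
have /intrP [n en] : u ^+ 2 + v ^+ 2 \in (Num.int : {pred algC}).
  by apply: Cint_rat_Aint; [rewrite rpredD // rpredX | rewrite uv rpredM].
have e : a * a + b * b = 4 * n.
  by apply: (@intr_inj algC); rewrite rmorphD !rmorphM /= -ea -eb -en; ring.
have [[a' ea'] [b' eb']] := sum_sqr_even e.
exists a', b'; rewrite ex; congr (_ + _ * _); apply: (@mulfI _ (2 : algC)); rewrite ?pnatr_eq0 //.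
  by rewrite ea ea' rmorphM.
by rewrite eb eb' rmorphM.
Qed.

Lemma bezout_coprime (m n : nat) : coprime m n -> exists x y : int, x * m%:Z + y * n%:Z = 1.
Proof.
move=> co; have [x [y e]] := Bezoutz m n; exists x, y; rewrite e.
by rewrite /gcdz !absz_nat (eqP co).
Qed.

Section Primes.
Variables (p1 p2 : nat) (s1 s2 : {rmorphism algC -> algC}).
Hypothesis H : biquad p1 p2 s1 s2.

Local Notation rd := (sqrtC (2 * p1 * p2)%:R : algC).
Local Notation k := (Qgen [:: rd; 'i]).

Lemma i_OK : OK k 'i. Proof. by split; [sf | exact: (aunit_int aunit_i)]. Qed.
Lemma rd_OK : OK k rd.
Proof. by split; [sf | apply: (@Aint_root _ 2) => //; rewrite sqrtCK Aint_nat]. Qed.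
Lemma OK_s1 z : OK k z -> OK k (s1 z).
Proof. by move=> [h1 h2]; split; [exact: (k_s1 H h1) | rewrite Aint_aut]. Qed.
Lemma s1_s1_k z : k z -> s1 (s1 z) = z.
Proof. by move=> h; apply: (s1_s1 H); exact: K_of_k. Qed.
Lemma fixed_Qi z : OK k z -> s1 z = z -> exists a b, z = a%:~R + b%:~R * 'i.
Proof.
move=> [h1 h2] h3; apply: gauss_int => //.
apply: (@Qgen_fixed [:: 'i] rd s1) => //; [by rewrite sqrtCK; sf | | exact: (s1_d H) | exact: (rd_neq0 H)].
by move=> s; rewrite inE => /eqP ->; exact: (s1_i H).
Qed.

Section PrimeIdeal.
Variable P : algC -> Prop.
Hypothesis hP : prime_ideal k P.

Lemma pideal_mul x y : OK k x -> P y -> P (x * y).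
Proof. by case: hP => [[[_ [_ [_ h]]] _] _]; exact: h. Qed.
Lemma pideal_add x y : P x -> P y -> P (x + y).
Proof. by case: hP => [[[_ [_ [h _]]] _] _]; exact: h. Qed.
Lemma pideal_OK x : P x -> OK k x.
Proof. by case: hP => [[[h _] _] _]; exact: h. Qed.
Lemma pideal_opp x : P x -> P (- x).
Proof. by case: hP => [[h _] _]; apply: idealN h. Qed.
Lemma pideal_or x y : OK k x -> OK k y -> P (x * y) -> P x \/ P y.
Proof. by case: hP => [_ [_ h]]; exact: h. Qed.
Lemma pideal_sqr x : OK k x -> P (x ^+ 2) -> P x.
Proof. by move=> hx; rewrite expr2 => /(pideal_or hx hx) []. Qed.

Lemma int_normE n : exists m : int, n = m * `|n|%N%:Z.
Proof. by exists ((-1) ^+ (n < 0)%R); exact: intEsign. Qed.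

Lemma norm_int_sign n : exists m : int, `|n|%N%:Z = m * n.
Proof.
exists ((-1) ^+ (n < 0)%R); rewrite {3}(intEsign n) mulrA -signr_addb addbb expr0 mul1r //.
Qed.

Lemma pideal_int (q : nat) (n : int) : prime q -> P q%:R -> P n%:~R -> (q %| `|n|)%N.
Proof.
move=> pq hq hn; apply: contraT => nd.
have [x [y e]] := bezout_coprime (etrans (prime_coprime _ pq) nd).
have [m em] := norm_int_sign n.
case: (hP) => _ [n1 _]; case: n1.
have -> : 1 = x%:~R * q%:R + (y * m)%:~R * n%:~R :> algC.
  by rewrite -[q%:R]/(q%:Z%:~R) -!rmorphM -rmorphD /= -mulrA -em e.
by apply: pideal_add; apply: pideal_mul => //; exact: OK_int.
Qed.
End PrimeIdeal.
End Primes.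

Lemma abs_sum_sqr (p : nat) (e f : int) : p%:Z = e ^+ 2 + (2 * f) ^+ 2 ->
  (p = `|e| ^ 2 + (2 * `|f|) ^ 2)%N.
Proof.
move=> h; have h1 : e ^+ 2 = (`|e| ^ 2)%N%:Z by rewrite -abszX gez0_abs // sqr_ge0.
have h2 : (2 * f) ^+ 2 = ((2 * `|f|) ^ 2)%N%:Z.
  by rewrite -[2%N]/(`|2|%N) -abszM -abszX gez0_abs // sqr_ge0.
by move: h; rewrite h1 h2 -PoszD => - [].
Qed.

Lemma mul_lt_sqr (m n : nat) : (m ^ 2 <= n -> n <= m -> 1 < n -> False)%N.
Proof.
move=> h1 h2 h3; have : (n * n <= n)%N by apply: leq_trans h1; rewrite -mulnn leq_mul.
by rewrite leqNgt ltn_Pmull // ltnW.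
Qed.

Section SplitPrime.
Variables (p1 p2 : nat) (s1 s2 : {rmorphism algC -> algC}).
Hypothesis H : biquad p1 p2 s1 s2.

Local Notation rd := (sqrtC (2 * p1 * p2)%:R : algC).
Local Notation k := (Qgen [:: rd; 'i]).

Variables e f : int.
Hypothesis ef : p1%:Z = e ^+ 2 + (2 * f) ^+ 2.

Definition gpi : algC := e%:~R + 2 * 'i * f%:~R.
Definition gpi' : algC := e%:~R - 2 * 'i * f%:~R.

Let pr1 := bq_p1 H.

Lemma gpi_mul : gpi * gpi' = p1%:R.
Proof.
have -> : gpi * gpi' = e%:~R ^+ 2 - 4 * 'i ^+ 2 * f%:~R ^+ 2 by rewrite /gpi /gpi'; ring.
by rewrite i_sqr -[p1%:R]/(p1%:Z%:~R) ef rmorphD !rmorphXn rmorphM /=; ring.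
Qed.
Lemma gpi_OK : OK k gpi.
Proof.
apply: OK_D; first exact: OK_int.
by apply: OK_M; [apply: OK_M; [exact: (OK_int 2) | exact: i_OK] | exact: OK_int].
Qed.
Lemma gpi'_OK : OK k gpi'.
Proof.
apply: OK_D; [exact: OK_int | apply: OK_N].
by apply: OK_M; [apply: OK_M; [exact: (OK_int 2) | exact: i_OK] | exact: OK_int].
Qed.
Lemma p1_neq0 : p1%:R != 0 :> algC.
Proof. by rewrite pnatr_eq0 -lt0n prime_gt0. Qed.
Lemma gpi_neq0 : gpi != 0.
Proof. by have := p1_neq0; rewrite -gpi_mul mulf_eq0 negb_or => /andP []. Qed.
Lemma gpi'_neq0 : gpi' != 0.
Proof. by have := p1_neq0; rewrite -gpi_mul mulf_eq0 negb_or => /andP []. Qed.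

Lemma p1_ndvd_2f : ~~ (p1 %| 2 * `|f|)%N.
Proof.
have ep := abs_sum_sqr ef; have pg := prime_gt1 pr1.
apply/negP => dv; have [f0|f0] := posnP `|f|%N.
  rewrite f0 muln0 addn0 in ep.
  have : (p1 %| `|e| ^ 2)%N by rewrite -ep.
  rewrite Euclid_dvdX // => /andP [dve _].
  apply: (@mul_lt_sqr `|e|%N p1) => //; first by rewrite -ep.
  apply: dvdn_leq => //; rewrite lt0n; apply: contraTneq pg => e0.
  by rewrite ep e0.
apply: (@mul_lt_sqr (2 * `|f|)%N p1) => //; first by rewrite ep leq_addl.
by apply: dvdn_leq => //; rewrite muln_gt0.
Qed.

Lemma p1_ndvd_2e : ~~ (p1 %| 2 * `|e|)%N.
Proof.
have ep := abs_sum_sqr ef; apply/negP.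
rewrite Euclid_dvdM // (negPf (prime1mod4_ndvd2 pr1 (bq_m1 H))) /= => dv.
have : (p1 %| (2 * `|f|) ^ 2)%N.
  by rewrite -(dvdn_addr _ (dvdn_exp (isT : 0 < 2)%N dv)) -ep.
by rewrite Euclid_dvdX // (negPf p1_ndvd_2f).
Qed.

Variable P : algC -> Prop.
Hypotheses (hP : prime_ideal k P) (Ppi : P gpi).

Lemma P_p1 : P p1%:R.
Proof. by rewrite -gpi_mul mulrC; apply: (pideal_mul hP) => //; exact: gpi'_OK. Qed.

Lemma P_int n : P n%:~R -> (p1 %| `|n|)%N.
Proof. by apply: (pideal_int hP) => //; exact: P_p1. Qed.

(** Subtracting a multiple of [gpi] from [2 f x] leaves a rational integer of [P], a multiple of
    [p1]. So [x / gpi] becomes integral after multiplication by [2 f] and by [p1], which are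
    coprime. *)
Lemma P_gauss x : OK k x -> s1 x = x -> P x -> x / gpi \in Aint.
Proof.
move=> hx sx px; have [a [b ex]] := fixed_Qi H hx sx.
have h1 : P (2 * f * a - e * b)%:~R.
  have -> : (2 * f * a - e * b)%:~R = (2 * f)%:~R * x + (- b)%:~R * gpi :> algC.
    by rewrite ex /gpi rmorphB rmorphN !rmorphM /=; ring.
  by apply: (pideal_add hP); apply: (pideal_mul hP) => //; exact: OK_int.
have /dvdnP [t et] := P_int h1.
have [t' et'] : exists t', 2 * f * a - e * b = t' * p1%:Z.
  have [m em] := int_normE (2 * f * a - e * b); exists (m * t%:Z).
  by rewrite em et PoszM mulrA.
have np := p1_neq0; have npi := gpi_neq0; have npi' := gpi'_neq0.
have exp : x / gpi = x * gpi' / p1%:R by rewrite -gpi_mul; field; rewrite npi npi'.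
have h2 : (2 * f)%:~R * (x / gpi) \in Aint.
  have e1 : (2 * f)%:~R * x = t'%:~R * p1%:R + b%:~R * gpi.
    have : (2 * f * a - e * b)%:~R = (t' * p1%:Z)%:~R :> algC by rewrite et'.
    rewrite rmorphB !rmorphM /= => e2; rewrite ex /gpi -[p1%:R]/(p1%:Z%:~R) -e2; ring.
  have -> : (2 * f)%:~R * (x / gpi) = t'%:~R * gpi' + b%:~R.
    by rewrite mulrA e1 -gpi_mul; field.
  by apply: rpredD; [apply: rpredM; [exact: Aint_int | by case: gpi'_OK] | exact: Aint_int].
have h3 : p1%:R * (x / gpi) \in Aint.
  have -> : p1%:R * (x / gpi) = x * gpi' by rewrite exp mulrC divfK.
  by apply: rpredM; [by case: hx | by case: gpi'_OK].
have co : coprime p1 (2 * `|f|)%N by rewrite prime_coprime // p1_ndvd_2f.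
have [u [v euv]] := bezout_coprime co; have [m em] := norm_int_sign f.
have -> : x / gpi = u%:~R * (p1%:R * (x / gpi)) + (v * m)%:~R * ((2 * f)%:~R * (x / gpi)).
  have h : 1 = u%:~R * p1%:R + (v * m)%:~R * (2 * f)%:~R :> algC.
    have := congr1 (fun n => n%:~R : algC) euv.
    by rewrite /= PoszM em rmorphD !rmorphM /= => eZ; rewrite -[LHS]/(1%:~R : algC) -eZ; ring.
  by rewrite -[LHS]mul1r {1}h; ring.
by apply: rpredD; apply: rpredM => //; exact: Aint_int.
Qed.

Lemma d_split : (2 * p1 * p2)%:R = (2 * p2)%:R * p1%:R :> algC.
Proof. by rewrite -natrM mulnAC. Qed.

Lemma P_d : P (2 * p1 * p2)%:R.
Proof. by rewrite d_split; apply: (pideal_mul hP); [exact: (OK_int (2 * p2)%N) | exact: P_p1]. Qed.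

(* The relative norm, the relative trace and the discriminant of [z] over [Q(i)] all lie in [P]. *)
Lemma P_sqr z : P z -> z ^+ 2 / gpi \in Aint.
Proof.
move=> hz; have oz := pideal_OK hP hz; have oz' := OK_s1 H oz.
have hd := rd_OK p1 p2; have kz : k z by case: oz.
have ss := s1_s1_k H kz; have npi := gpi_neq0; have npi' := gpi'_neq0.
have oN : OK k (z * s1 z) by exact: OK_M.
have oT : OK k (z + s1 z) by exact: OK_D.
have oB : OK k (z - s1 z) by apply: OK_D => //; exact: OK_N.
have sN : s1 (z * s1 z) = z * s1 z by rewrite rmorphM ss mulrC.
have sT : s1 (z + s1 z) = z + s1 z by rewrite rmorphD ss addrC.
have pN : P (z * s1 z) by rewrite mulrC; exact: (pideal_mul hP).
have iN := P_gauss oN sN pN.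
pose D := (z - s1 z) * rd.
have oD : OK k D by exact: OK_M.
have sD : s1 D = D by rewrite /D rmorphM rmorphB ss (s1_d H); ring.
have D2 : D ^+ 2 = (z - s1 z) ^+ 2 * (2 * p1 * p2)%:R by rewrite exprMn sqrtCK.
have oB2 : OK k ((z - s1 z) ^+ 2) by rewrite expr2; exact: OK_M.
have pD : P D.
  by apply: (pideal_sqr hP) => //; rewrite D2; apply: (pideal_mul hP) => //; exact: P_d.
have iD := P_gauss oD sD pD.
have oD1 : OK k (D / gpi) by split => //; case: oD gpi_OK => kD _ [kp _]; sf.
(* One factor [gpi] of [p1] cancels; the cofactor [2 * p2 * gpi'] avoids [P], so the discriminant
   itself lies in [P]. *)
have eB : (z - s1 z) ^+ 2 * ((2 * p2)%:R * gpi') = (D / gpi) ^+ 2 * gpi.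
  have -> : (D / gpi) ^+ 2 * gpi = D ^+ 2 / gpi by field.
  by rewrite D2 d_split -gpi_mul; field.
have o2 : OK k (2 * p2)%:R by exact: (OK_int (2 * p2)%N).
have opi' := gpi'_OK; have o2p : OK k ((2 * p2)%:R * gpi') by exact: OK_M.
have pB2 : P ((z - s1 z) ^+ 2).
  have : P ((z - s1 z) ^+ 2 * ((2 * p2)%:R * gpi')).
    by rewrite eB; apply: (pideal_mul hP) => //; rewrite expr2; exact: OK_M.
  case/(pideal_or hP oB2 o2p) => // /(pideal_or hP o2 opi') [].
    move/(P_int (n := (2 * p2)%N)); rewrite absz_nat Euclid_dvdM //.
    by rewrite (negPf (prime1mod4_ndvd2 pr1 (bq_m1 H))) (negPf (prime_ndvd pr1 (bq_p2 H) (bq_ne H))).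
  move=> h; have : P (2 * e)%:~R.
    have -> : (2 * e)%:~R = gpi + gpi' by rewrite /gpi /gpi' rmorphM /=; ring.
    exact: (pideal_add hP).
  by move/P_int; rewrite abszM (negPf p1_ndvd_2e).
have pT : P (z + s1 z).
  apply: (pideal_sqr hP) => //.
  have -> : (z + s1 z) ^+ 2 = (z - s1 z) ^+ 2 + 4%:~R * (z * s1 z) by ring.
  by apply: (pideal_add hP) => //; apply: (pideal_mul hP) => //; exact: OK_int.
have iT := P_gauss oT sT pT.
(* The equation of [z] over Q(i), whose trace and norm are now both divisible by [gpi]. *)
have -> : z ^+ 2 / gpi = (z + s1 z) / gpi * z - (z * s1 z) / gpi by field.
by apply: rpredB => //; apply: rpredM => //; case: oz.
Qed.

Lemma P_rd : P rd.
Proof. by apply: (pideal_sqr hP); [exact: rd_OK | rewrite sqrtCK; exact: P_d]. Qed.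
End SplitPrime.

Lemma gauss_inj a b a' b' :
  a%:~R + b%:~R * 'i = a'%:~R + b'%:~R * 'i :> algC -> a = a' /\ b = b'.
Proof.
move=> e; have := congr1 conjr e.
rewrite !rmorphD !rmorphM conjr_i !rmorph_int => ce.
have ea : a = a'.
  apply: (@intr_inj algC); apply: (@mulfI _ (2 : algC)); first by rewrite pnatr_eq0.
  have -> : 2 * a%:~R = (a%:~R + b%:~R * 'i) + (a%:~R + b%:~R * - 'i) :> algC by ring.
  by rewrite e ce; ring.
split=> //; apply: (@intr_inj algC); apply: (mulIf (neq0Ci algC)).
by move: e; rewrite ea => /addrI.
Qed.

Lemma diff_sqr_even a b n : a * a - b * b = 2 * n -> exists q, a - b = 2 * q.
Proof.
have [q [t et]] := int_parity a; have [r [s es]] := int_parity b; rewrite {}et {}es.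
case: t; case: s; rewrite ?addr0 ?odd_sqr_int ?even_sqr_int;
  by [exists (q - r); ring | move: (q * q) (r * r) => Q R e; lia].
Qed.

Lemma one_plus_i_sqr : (1 + 'i) ^+ 2 = 2 * 'i :> algC.
Proof.
have -> : (1 + 'i) ^+ 2 = 1 + 'i ^+ 2 + 2 * 'i :> algC by ring.
by rewrite i_sqr; ring.
Qed.

Lemma one_plus_i_norm : (1 + 'i) * (1 - 'i) = 2 :> algC.
Proof.
have -> : (1 + 'i) * (1 - 'i) = 1 - 'i ^+ 2 :> algC by ring.
by rewrite i_sqr; ring.
Qed.

(** * The ideal above 1 + i *)

Section RamifiedPrime.
Variables (p1 p2 : nat) (s1 s2 : {rmorphism algC -> algC}).
Hypothesis H : biquad p1 p2 s1 s2.

Local Notation rd := (sqrtC (2 * p1 * p2)%:R : algC).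
Local Notation k := (Qgen [:: rd; 'i]).

Let m := (p1 * p2)%N.
Let j : int := (m %/ 4)%N%:Z.

Lemma mE : m%:Z = 4 * j + 1.
Proof.
have hm : (m %% 4 = 1)%N by rewrite -modnMm (bq_m1 H) (bq_m2 H).
by rewrite {1}(divn_eq m 4) hm /j PoszD PoszM mulrC.
Qed.

Variable P : algC -> Prop.
Hypotheses (hP : prime_ideal k P) (P1i : P (1 + 'i)).

Let hi := i_OK p1 p2.

Lemma OK_1mi : OK k (1 - 'i). Proof. by apply: OK_D; [exact: OK1 | exact: OK_N]. Qed.

Lemma P_two : P 2.
Proof. by rewrite -one_plus_i_norm mulrC; apply: (pideal_mul hP) => //; exact: OK_1mi. Qed.

Lemma even_gauss_div a b : (exists q, a - b = 2 * q) -> (a%:~R + b%:~R * 'i) / (1 + 'i) \in Aint.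
Proof.
move=> [q eq]; have n1 := one_plus_i_neq0.
have -> : (a%:~R + b%:~R * 'i) / (1 + 'i) = q%:~R * (1 - 'i) + b%:~R :> algC.
  apply: (@mulIf algC (1 + 'i) n1); rewrite divfK // mulrDl -mulrA [(1 - 'i) * _]mulrC one_plus_i_norm.
  have -> : a = 2 * q + b by rewrite -eq; ring.
  by rewrite rmorphD rmorphM /=; ring.
by apply: rpredD; [apply: rpredM; [exact: Aint_int | case: OK_1mi] | exact: Aint_int].
Qed.

Lemma P0_gauss x : OK k x -> s1 x = x -> P x -> x / (1 + 'i) \in Aint.
Proof.
move=> hx sx px; have [a [b ex]] := fixed_Qi H hx sx; rewrite ex; apply: even_gauss_div.
have h1 : P (a - b)%:~R.
  have -> : (a - b)%:~R = x + (- b)%:~R * (1 + 'i) :> algC by rewrite ex rmorphB rmorphN /=; ring.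
  by apply: (pideal_add hP) => //; apply: (pideal_mul hP) => //; exact: OK_int.
have /dvdnP [t et] := pideal_int hP (isT : prime 2) P_two h1.
have [s es] := int_normE (a - b); exists (s * t%:Z).
by rewrite es et PoszM; ring.
Qed.

(** The norm [N] of [z] over Q(i) is divisible by [1 + 'i]; the trace [T = a + b i] needs another
    argument. The Gaussian integer [D] has [D ^ 2 = - i m (T ^ 2 - 4 N)] with [m = p1 p2] odd. Its
    imaginary part is even, so [a ^ 2 - b ^ 2] is even and [1 + 'i] divides [T]. *)
Lemma P0_sqr z : P z -> z ^+ 2 / (1 + 'i) \in Aint.
Proof.
move=> hz; have oz := pideal_OK hP hz; have oz' := OK_s1 H oz.
have hd := rd_OK p1 p2; have kz : k z by case: oz.
have kz' : k (s1 z) by case: oz'.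
have ss := s1_s1_k H kz; have n1 := one_plus_i_neq0; have ni := neq0Ci algC.
have oN : OK k (z * s1 z) by exact: OK_M.
have oT : OK k (z + s1 z) by exact: OK_D.
have oB : OK k (z - s1 z) by apply: OK_D => //; exact: OK_N.
have sN : s1 (z * s1 z) = z * s1 z by rewrite rmorphM ss mulrC.
have sT : s1 (z + s1 z) = z + s1 z by rewrite rmorphD ss addrC.
have pN : P (z * s1 z) by rewrite mulrC; exact: (pideal_mul hP).
have iN := P0_gauss oN sN pN.
pose D := (z - s1 z) * rd / (1 + 'i).
have D2 : D ^+ 2 = - 'i * m%:R * (z - s1 z) ^+ 2.
  rewrite /D exprMn exprVn exprMn sqrtCK one_plus_i_sqr -mulnA natrM -/m.
  have -> : - 'i = 'i^-1 :> algC by apply: (mulfI ni); rewrite mulfV // mulrN -expr2 i_sqr opprK.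
  by field.
have iB : (z - s1 z) ^+ 2 \in Aint by apply: rpredX; case: oB.
have oD : OK k D.
  split; first by rewrite /D; sf.
  apply: (@Aint_root _ 2) => //; rewrite D2; apply: rpredM => //; apply: rpredM; last exact: Aint_nat.
  by rewrite rpredN; case: hi.
have sD : s1 D = D.
  by rewrite /D fmorph_div rmorphM rmorphB ss (s1_d H) rmorphD rmorph1 (s1_i H); field.
have [x [y eD]] := fixed_Qi H oD sD.
have [a [b eT]] := fixed_Qi H oT sT.
have [n [n' eN]] := fixed_Qi H oN sN.
have [M eM] : exists M : int, M = m%:Z by exists m%:Z.
have eMR : m%:R = M%:~R :> algC by rewrite eM.
have iT : (z + s1 z) / (1 + 'i) \in Aint.
  rewrite eT; apply: even_gauss_div.
  have e : (x * x - y * y)%:~R + (2 * (x * y))%:~R * 'i =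
      (M * (2 * a * b - 4 * n'))%:~R + (- M * (a * a - b * b - 4 * n))%:~R * 'i :> algC.
    have h1 : (x * x - y * y)%:~R + (2 * (x * y))%:~R * 'i = D ^+ 2.
      have -> : D ^+ 2 = x%:~R ^+ 2 + y%:~R ^+ 2 * 'i ^+ 2 + 2 * x%:~R * y%:~R * 'i by rewrite eD; ring.
      by rewrite i_sqr rmorphB !rmorphM /=; ring.
    rewrite h1 D2.
    have -> : (z - s1 z) ^+ 2 = (z + s1 z) ^+ 2 - 4 * (z * s1 z) by ring.
    rewrite eT eN eMR !(rmorphM, rmorphN, rmorphB) /=.
    set MR := M%:~R; set A := a%:~R; set B := b%:~R; set N := n%:~R; set N' := n'%:~R.
    have -> : - 'i * MR * ((A + B * 'i) ^+ 2 - 4 * (N + N' * 'i)) =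
      - MR * (A * A + B * B * 'i ^+ 2 - 4 * N) * 'i + MR * (2 * A * B - 4 * N') * - ('i ^+ 2) by ring.
    by rewrite i_sqr; ring.
  have [_ e2] := gauss_inj e.
  apply: (@diff_sqr_even _ _ (2 * n - 2 * j * (a * a - b * b - 4 * n) - x * y)).
  have -> : 2 * (2 * n - 2 * j * (a * a - b * b - 4 * n) - x * y) =
    4 * n - 4 * j * (a * a - b * b - 4 * n) - 2 * (x * y) by ring.
  by rewrite e2 eM mE; ring.
have -> : z ^+ 2 / (1 + 'i) = (z + s1 z) / (1 + 'i) * z - (z * s1 z) / (1 + 'i) by field.
by apply: rpredB => //; apply: rpredM => //; case: oz.
Qed.

Lemma P0_rep : represents k P alpha0.
Proof.
have n1 := one_plus_i_neq0; have na := alpha0_neq0; have ni := neq0Ci algC.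
have us := aunit_sqrt2p1; have ns := aunit_neq0 us.
split; [by case: hP => [[h _] _] | exact: na | |].
  move=> z hz; apply: (@Aint_root _ 2) => //.
  have -> : (z / alpha0) ^+ 2 = z ^+ 2 / (1 + 'i) * (1 + sqrtC 2)^-1.
    by rewrite exprMn exprVn alpha0_sqr invfM mulrA.
  by apply: rpredM; [exact: P0_sqr | exact/aunit_int/aunitV].
exists (1 + 'i); last first.
  have -> : (1 + 'i) / alpha0 ^+ 2 = (1 + sqrtC 2)^-1 by rewrite alpha0_sqr; field; rewrite n1 ns.
  exact: aunitV.
(* An integer of [k] with [w ^ 2 = - 'i * m], so [1 - w ^ 2] is [1 + 'i] plus a multiple of 4; since
   2 is in [P], both [1 + w] and [1 - w] are. *)
pose w := rd / (1 + 'i).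
have w2 : w ^+ 2 = - 'i * m%:R.
  rewrite /w exprMn exprVn sqrtCK one_plus_i_sqr -mulnA natrM -/m.
  have -> : - 'i = 'i^-1 :> algC by apply: (mulfI ni); rewrite mulfV // mulrN -expr2 i_sqr opprK.
  by field.
have kw : k w by rewrite /w; sf.
have ow : OK k w.
  split => //; apply: (@Aint_root _ 2) => //; rewrite w2; apply: rpredM; last exact: Aint_nat.
  by rewrite rpredN; case: hi.
have o1 : OK k 1 by exact: OK1.
have op : OK k (1 + w) by exact: OK_D.
have om : OK k (1 - w) by apply: OK_D => //; exact: OK_N.
have eN : (1 + w) * (1 - w) = (1 + 'i) + (2 * j)%:~R * 'i * 2.
  have -> : (1 + w) * (1 - w) = 1 - w ^+ 2 by ring.
  by rewrite w2 -[m%:R]/(m%:Z%:~R) mE rmorphD !rmorphM /=; ring.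
have oji : OK k ((2 * j)%:~R * 'i) by apply: OK_M => //; exact: OK_int.
have pN : P ((1 + w) * (1 - w)).
  rewrite eN; apply: (pideal_add hP) => //.
  by apply: (pideal_mul hP) => //; exact: P_two.
have p2w : P (2 * w) by rewrite mulrC; apply: (pideal_mul hP) => //; exact: P_two.
have [pp pm] : P (1 + w) /\ P (1 - w).
  case: (pideal_or hP op om pN) => h; split => //.
    have -> : 1 - w = (1 + w) - 2 * w by ring.
    by apply: (pideal_add hP) => //; exact: (pideal_opp hP).
  have -> : 1 + w = (1 - w) + 2 * w by ring.
  exact: (pideal_add hP).
have hI : is_ideal k P by case: hP => [[h _] _].
have [_ [_ [MD MM]]] := ideal_mulP _ _ hI hI.
(* The correction uses [(1 + 'i) ^ 2 = 2 * 'i], which writes the excess [4 j i] as a multiple of a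
   product of elements of [P]. *)
have -> : 1 + 'i = (1 + w) * (1 - w) + (- (2 * j))%:~R * ((1 + 'i) * (1 + 'i)).
  by rewrite eN -expr2 one_plus_i_sqr rmorphN /=; ring.
apply: (MD); first exact: ideal_mul_mem.
by apply: (MM); [exact: OK_int | exact: ideal_mul_mem].
Qed.
End RamifiedPrime.

Section SplitProduct.
Variables (p1 p2 : nat) (s1 s2 : {rmorphism algC -> algC}).
Hypothesis H : biquad p1 p2 s1 s2.

Local Notation rd := (sqrtC (2 * p1 * p2)%:R : algC).
Local Notation k := (Qgen [:: rd; 'i]).

Variables e f : int.
Hypothesis ef : p1%:Z = e ^+ 2 + (2 * f) ^+ 2.
Variables P Q : algC -> Prop.
Hypotheses (hP : prime_ideal k P) (Ppi : P (gpi e f)).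
Hypotheses (hQ : prime_ideal k Q) (Qpi : Q (gpi' e f)).

Let pr1 := bq_p1 H.
Let ef' : p1%:Z = e ^+ 2 + (2 * - f) ^+ 2. Proof. by rewrite mulrN sqrrN. Qed.
Let gpiN : gpi e (- f) = gpi' e f. Proof. by rewrite /gpi /gpi' rmorphN /= mulrN. Qed.
Let Qpi' : Q (gpi e (- f)). Proof. by rewrite gpiN. Qed.

(** It remains to see that [p1] lies in the square of [P Q]. Both [p1 = gpi * gpi'] and [rd] lie in
    [P Q], the latter because [p1] and [gpi + gpi' = 2 e] are coprime; and [p1] is the gcd of
    [p1 ^ 2] and [rd ^ 2 = 2 p1 p2]. *)
Lemma PQ_rep beta x : beta ^+ 2 = p1%:R * x -> aunit x -> represents k (ideal_mul k P Q) beta.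
Proof.
move=> eb ux; have nx := aunit_neq0 ux; have np := p1_neq0 H.
have npi := gpi_neq0 H ef; have npi' := gpi'_neq0 H ef.
have hI : is_ideal k P by case: hP => [[h _] _].
have hJ : is_ideal k Q by case: hQ => [[h _] _].
have nb : beta != 0.
  by apply: contraNneq (mulf_neq0 np nx) => b0; rewrite -eb b0 expr0n.
have hM : is_ideal k (ideal_mul k P Q) by exact: ideal_mulP.
split => //.
  move=> z hz; suff [] : OK k z /\ beta^-1 * z \in Aint by rewrite mulrC.
  apply: (ideal_mul_ind P Q (fun z => OK k z /\ beta^-1 * z \in Aint)) hz; first exact: int_ideal.
  move=> y y' hy hy'; split; first by apply: OK_M; [exact: (pideal_OK hP) | exact: (pideal_OK hQ)].
  apply: (@Aint_root _ 2) => //.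
  have -> : (beta^-1 * (y * y')) ^+ 2 = (y ^+ 2 / gpi e f) * (y' ^+ 2 / gpi' e f) * x^-1.
    by rewrite !exprMn exprVn eb -(gpi_mul ef); field; rewrite nx npi npi'.
  apply: rpredM; last exact/aunit_int/aunitV.
  apply: rpredM; first exact: (P_sqr H ef hP Ppi).
  by rewrite -gpiN; exact: (P_sqr H ef' hQ Qpi').
exists p1%:R; last first.
  have -> : p1%:R / beta ^+ 2 = x^-1 by rewrite eb; field; rewrite np nx.
  exact: aunitV.
have [M1 [M0 [MD MM]]] := hM; have [_ [_ [MD2 MM2]]] := ideal_mulP _ _ hM hM.
have mp : ideal_mul k P Q p1%:R by rewrite -(gpi_mul ef); exact: ideal_mul_mem.
have Pd : P rd by exact: (P_rd ef hP Ppi).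
have Qd : Q rd by exact: (P_rd ef' hQ Qpi').
have co1 : coprime p1 (2 * `|e|)%N by rewrite prime_coprime // (p1_ndvd_2e H ef).
have [u [v euv]] := bezout_coprime co1; have [t et] := norm_int_sign e.
have md : ideal_mul k P Q rd.
  have er : rd = (v * t)%:~R * (gpi e f * rd) + ((v * t)%:~R * (rd * gpi' e f) + (u%:~R * rd) * p1%:R).
    have h : 1 = u%:~R * p1%:R + (v * t)%:~R * (2 * e)%:~R :> algC.
      have := congr1 (fun n => n%:~R : algC) euv.
      by rewrite /= PoszM et rmorphD !rmorphM /= => eZ; rewrite -[LHS]/(1%:~R : algC) -eZ; ring.
    have e2 : (2 * e)%:~R = gpi e f + gpi' e f by rewrite /gpi /gpi' rmorphM /=; ring.
    by rewrite -[LHS]mul1r {1}h e2; ring.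
  suff : ideal_mul k P Q ((v * t)%:~R * (gpi e f * rd) + ((v * t)%:~R * (rd * gpi' e f) + (u%:~R * rd) * p1%:R)).
    by rewrite -er.
  have q1 : ideal_mul k P Q (gpi e f * rd) by exact: ideal_mul_mem.
  have q2 : ideal_mul k P Q (rd * gpi' e f) by exact: ideal_mul_mem.
  apply: (MD); first by apply: (MM _ _ _ q1); exact: OK_int.
  apply: (MD); first by apply: (MM _ _ _ q2); exact: OK_int.
  by apply: (MM) => //; apply: OK_M; [exact: OK_int | exact: rd_OK].
have co2 : coprime p1 (2 * p2)%N.
  rewrite prime_coprime // Euclid_dvdM // negb_or (prime1mod4_ndvd2 pr1 (bq_m1 H)) /=.
  exact: (prime_ndvd pr1 (bq_p2 H) (bq_ne H)).
have [u' [v' euv']] := bezout_coprime co2.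
have -> : p1%:R = u'%:~R * (p1%:R * p1%:R) + v'%:~R * (rd * rd) :> algC.
  rewrite -[rd * rd]expr2 sqrtCK d_split.
  have := congr1 (fun n => n%:~R : algC) euv'.
  rewrite /= rmorphD !rmorphM /= => eZ.
  have h : 1 = u'%:~R * p1%:R + v'%:~R * (2 * p2)%:R :> algC by rewrite -[LHS]/(1%:~R : algC) -eZ.
  by rewrite -[LHS]mul1r {1}h; ring.
have q1 : ideal_mul k (ideal_mul k P Q) (ideal_mul k P Q) (p1%:R * p1%:R) by exact: ideal_mul_mem.
have q2 : ideal_mul k (ideal_mul k P Q) (ideal_mul k P Q) (rd * rd) by exact: ideal_mul_mem.
by apply: (MD2); [apply: (MM2 _ _ _ q1) | apply: (MM2 _ _ _ q2)]; exact: OK_int.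
Qed.
End SplitProduct.

(** * From generators to ideal classes *)

Section CapitulatingClasses.
Variables (p1 p2 : nat) (s1 s2 : {rmorphism algC -> algC}).
Hypothesis H : biquad p1 p2 s1 s2.
Variables e1 e2 e3 n2 : algC.
Hypothesis UH : units p1 p2 s1 s2 e1 e2 e3 n2.

Local Notation r2 := (sqrtC 2 : algC).
Local Notation rm := (sqrtC (p1 * p2)%:R : algC).
Local Notation rd := (sqrtC (2 * p1 * p2)%:R : algC).
Local Notation k := (Qgen [:: rd; 'i]).
Local Notation K := (Qgen [:: r2; rm; 'i]).
Local Notation K0 := (Qgen [:: r2; rm]).
Local Notation sg := (sigma s1 s2).
Local Notation U := (unit_mon e1 e2 e3).
Local Notation W := (unit_subgroup e1 e2 e3).
Local Notation nu := (normexp n2).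

Let kK x : k x -> K x := @K_of_k p1 p2 x.

Lemma cap_of_equiv I J g : is_ideal k I -> represents k J g -> K g -> ideal_equiv k I J ->
  in_2part k I /\ capitulates K I.
Proof.
move=> hI r kg [x [kx [nx h]]].
have q : represents k I (g / x) by exact: (rep_scale _ _ _ _ hI r kx nx h).
split; first exact: (rep_in_2part _ _ q).
by apply: (rep_capitulates kK _ _ q); have := kK kx => kx'; sf.
Qed.

Lemma cap_generator I : nz_ideal k I -> in_2part k I -> capitulates K I ->
  exists g, [/\ OK K g, g != 0, forall z, I z <-> OK k z /\ z / g \in Aint & aunit (sg g / g)].
Proof.
move=> hI h2 hc; have [g [og ng hg hgen]] := capitulates_gen kK _ hI h2 hc.
exists g; split => //; case: (hI) => hid _.
apply: (capitulates_aut kK I g sg hid og ng hgen); first by move=> x; exact: (sg_k H).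
  by move=> x; exact: (K_sg H).
by apply: (sg_sg H); case: og.
Qed.

Variables x0 beta : algC.
Hypotheses (kx0 : k x0) (nx0 : x0 != 0) (kb : K beta) (eb : beta ^+ 2 = x0 * U nu 1 nu).

Let gam (A B : nat) := alpha0 ^+ A * beta ^+ B.

Lemma beta_neq0 : beta != 0.
Proof.
apply: contraNneq (mulf_neq0 nx0 (aunit_neq0 (U_aunit UH nu 1 nu))) => b0.
by rewrite -eb b0 expr0n.
Qed.

Lemma gam_neq0 A B : gam A B != 0.
Proof. by rewrite /gam; apply: mulf_neq0; apply: expf_neq0; [exact: alpha0_neq0 | exact: beta_neq0]. Qed.

Lemma gam_K A B : K (gam A B).
Proof. by have h := @alpha0_K p1 p2; rewrite /gam; sf. Qed.

Lemma gam_sqr A B : gam A B ^+ 2 =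
  ((1 + 'i) ^+ A * x0 ^+ B) * ((1 + r2) ^+ A * U nu 1 nu ^+ B).
Proof.
rewrite /gam exprMn -[(alpha0 ^+ A) ^+ 2]exprM -[(beta ^+ B) ^+ 2]exprM !(mulnC _ 2) !exprM.
by rewrite alpha0_sqr eb (exprMn A) (exprMn B); ring.
Qed.

(** The squares of [alpha0] and [beta] are elements of [k] times units, so only the parities of the
    exponents matter for the class. *)
Lemma gam_mod2 g x (A B : nat) : k x -> x != 0 -> aunit (g / (x * gam A B)) ->
  exists2 y, k y /\ y != 0 & aunit (g / (y * gam (odd A) (odd B))).
Proof.
move=> kx nx hu; have n1 := one_plus_i_neq0.
have us : aunit (gam A./2 B./2 ^+ 2 / ((1 + 'i) ^+ A./2 * x0 ^+ B./2)).
  rewrite gam_sqr mulrC mulKf ?mulf_neq0 ?expf_neq0 //.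
  by apply: aunitM; apply: aunitX; [exact: aunit_sqrt2p1 | exact: (U_aunit UH)].
exists (x * ((1 + 'i) ^+ A./2 * x0 ^+ B./2)); first by split; [sf | rewrite !mulf_neq0 ?expf_neq0].
have e : gam A B = gam (odd A) (odd B) * gam A./2 B./2 ^+ 2.
  rewrite /gam -{1}(odd_double_half A) -{1}(odd_double_half B) !exprD -!muln2 !exprM.
  by rewrite (exprMn 2); ring.
have -> : g / (x * ((1 + 'i) ^+ A./2 * x0 ^+ B./2) * gam (odd A) (odd B)) =
    (g / (x * gam A B)) * (gam A./2 B./2 ^+ 2 / ((1 + 'i) ^+ A./2 * x0 ^+ B./2)).
  have h1 := gam_neq0 A./2 B./2; have h2 := gam_neq0 (odd A) (odd B).
  have h3 := expf_neq0 A./2 n1; have h4 := expf_neq0 B./2 nx0.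
  by rewrite e; field; rewrite h1 h2 h3 h4 nx.
exact: aunitM.
Qed.

(** Multiplying the quotient by [gam A B ^+ 2], which lies in [k] up to a unit, turns it into a
    product with exponents [A + A'] and [B + B'], to which [split_parity] applies. *)
Lemma gam_distinct x (A B A' B' : nat) : k x -> x != 0 -> aunit (gam A' B' / (x * gam A B)) ->
  ~~ odd (A + A') /\ (unit_index K0 W 1 -> ~~ odd (B + B')).
Proof.
move=> kx nx hu; have n1 := one_plus_i_neq0.
have h1 := gam_neq0 A B; have h2 := gam_neq0 A' B'.
have k1 := gam_K A B; have k2 := gam_K A' B'; have kx' := kK kx.
have ku := K_of_K0 (U_K0 UH nu 1 nu).
pose y := (1 + r2) ^+ A * U nu 1 nu ^+ B * (gam A' B' / (x * gam A B)).
apply: (@split_parity p1 p2 s1 s2 H e1 e2 e3 n2 UH x0 beta (x * ((1 + 'i) ^+ A * x0 ^+ B)) y) => //.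
- by sf.
- by rewrite !mulf_neq0 ?expf_neq0.
- by rewrite /y; sf.
- apply: aunitM => //; apply: aunitM; apply: aunitX; [exact: aunit_sqrt2p1 | exact: (U_aunit UH)].
have -> : alpha0 ^+ (A + A') * beta ^+ (B + B') = gam A B * gam A' B' by rewrite /gam !exprD; ring.
have -> : x * ((1 + 'i) ^+ A * x0 ^+ B) * y = x * gam A B ^+ 2 * (gam A' B' / (x * gam A B)).
  by rewrite gam_sqr /y; ring.
by field; rewrite h1 nx.
Qed.

(** The common conclusion of [index1_kernel] and [index2_kernel], which lets both values of [Q]
    share the next lemma. *)
Hypothesis kernel : forall g, K g -> g != 0 -> aunit (sg g / g) ->
  exists u x a b, [/\ K u, aunit u, k x & (g / u) ^+ 2 = x * U a b 0].

Lemma cap_gam I : nz_ideal k I -> in_2part k I -> capitulates K I ->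
  exists g (A B : bool), exists2 y, k y /\ y != 0 & [/\ OK K g, g != 0,
    forall z, I z <-> OK k z /\ z / g \in Aint & aunit (g / (y * gam A B))].
Proof.
move=> hI h2 hc; have [g [og ng hg ug]] := cap_generator hI h2 hc.
have kg : K g by case: og.
have [u [x [a [b [ku au kx e]]]]] := kernel kg ng ug.
have nu0 := aunit_neq0 au.
have kgu : K (g / u) by sf.
have ngu : g / u != 0 by rewrite mulf_neq0 // invr_eq0.
have [y [ky ny] [A [B hu]]] := kernel_reduce H UH kx0 nx0 kb eb kgu ngu kx e.
have hu' : aunit (g / (y * gam A B)).
  have -> : g / (y * gam A B) = (g / u / (y * (alpha0 ^+ A * beta ^+ B))) * u.
    by rewrite -/(gam A B); have h := gam_neq0 A B; field; rewrite h nu0 ny.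
  exact: aunitM.
have [y' ky' hy'] := gam_mod2 ky ny hu'.
by exists g, (odd A), (odd B), y'.
Qed.
End CapitulatingClasses.

Section Count.
Variables (F : algC -> Prop) (P : (algC -> Prop) -> Prop).

Lemma num_classes_bool (J : bool -> algC -> Prop) :
  (forall b : bool, nz_ideal F (J b) /\ P (J b)) ->
  (forall b b' : bool, ideal_equiv F (J b) (J b') -> b = b') ->
  (forall I, nz_ideal F I -> P I -> exists b : bool, ideal_equiv F I (J b)) -> num_classes F P 2.
Proof.
move=> h1 h2 h3; exists (fun i : 'I_2 => J (odd i)); split; first by move=> i; exact: h1.
split=> [i j /h2|I hI pI].
  by case: i => [[|[|i]] hi]; case: j => [[|[|j]] hj] //= _; apply: val_inj.
have [b hb] := h3 I hI pI; have hlt : (b < 2)%N by case: (b).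
by exists (Ordinal hlt); case: b hb hlt.
Qed.

Lemma num_classes_bool2 (J : bool -> bool -> algC -> Prop) :
  (forall a b : bool, nz_ideal F (J a b) /\ P (J a b)) ->
  (forall a b a' b' : bool, ideal_equiv F (J a b) (J a' b') -> a = a' /\ b = b') ->
  (forall I, nz_ideal F I -> P I -> exists a b : bool, ideal_equiv F I (J a b)) -> num_classes F P 4.
Proof.
move=> h1 h2 h3; exists (fun i : 'I_4 => J (1 < i)%N (odd i)); split; first by move=> i; exact: h1.
split=> [i j /h2|I hI pI].
  by case: i => [[|[|[|[|i]]]] hi]; case: j => [[|[|[|[|j]]]] hj] //= []; move=> *; apply: val_inj.
have [a [b hb]] := h3 I hI pI.
have hlt : (a.*2 + b < 4)%N by case: (a); case: (b).
by exists (Ordinal hlt); case: a hb hlt; case: b.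
Qed.
End Count.

Unset Implicit Arguments.

Theorem mainTheorem12 (p1 p2 : nat) :
  prime p1 -> prime p2 -> (p1 %% 4 = 1)%N -> (p2 %% 4 = 1)%N ->
  (2 <= (legendre p1 p2 == -1%R) + (legendre 2 p1 == -1%R) + (legendre 2 p2 == -1%R))%N ->
  forall e f : int, (p1%:Z = e ^+ 2 + (2 * f) ^+ 2) ->
  forall eps1 eps2 eps3 : algC,
    fund_unit 2 eps1 -> fund_unit (p1 * p2) eps2 -> fund_unit (2 * p1 * p2) eps3 ->
  let k := Qgen [:: sqrtC (2 * p1 * p2)%:R; 'i] in
  let K3 := Qgen [:: sqrtC 2; sqrtC (p1 * p2)%:R; 'i] in
  let K0 := Qgen [:: sqrtC 2; sqrtC (p1 * p2)%:R] in
  let pi1 : algC := e%:~R + 2 * 'i * f%:~R in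
  let pi2 : algC := e%:~R - 2 * 'i * f%:~R in
  forall H0 H1 H2 : algC -> Prop,
    prime_ideal k H0 -> H0 (1 + 'i) ->
    prime_ideal k H1 -> H1 pi1 ->
    prime_ideal k H2 -> H2 pi2 ->
  let cap := fun I => in_2part k I /\ capitulates K3 I in
  (unit_index K0 (unit_subgroup eps1 eps2 eps3) 1 ->
     num_classes k cap 4 /\
     forall I, nz_ideal k I ->
       (cap I <-> exists a b : nat,
          ideal_equiv k I (ideal_mul k (ideal_pow k H0 a) (ideal_pow k (ideal_mul k H1 H2) b))))
  /\
  (unit_index K0 (unit_subgroup eps1 eps2 eps3) 2 ->
     num_classes k cap 2 /\
     forall I, nz_ideal k I ->
       (cap I <-> exists a : nat, ideal_equiv k I (ideal_pow k H0 a))).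
Proof.
move=> pr1 pr2 m1 m2 hleg e f ef e1 e2 e3 f1 f2 f3 k K3 K0 pi1 pi2 H0 H1 H2 hH0 H0i hH1 H1pi hH2 H2pi cap.
have ne := fund_unit_ne f2.
have [s1 [s2 H]] := @biquad_exists p1 p2 pr1 pr2 m1 m2 ne.
have [n2 UH] := units_exist H hleg f1 f2 f3.
have r0 : represents k H0 alpha0 by exact: (P0_rep H hH0 H0i).
have ka := @alpha0_K p1 p2.
split=> hi.
  have [beta kb0 eb] := index1_beta H UH hi.
  have kb : K3 beta by exact: (K_of_K0 kb0).
  have r12 : represents k (ideal_mul k H1 H2) beta.
    exact: (PQ_rep H ef hH1 H1pi hH2 H2pi eb (U_aunit UH _ _ _)).
  have np : p1%:R != 0 :> algC by exact: (p1_neq0 H).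
  have kp : k p1%:R by rewrite /k; sf.
  pose J (a b : nat) := ideal_mul k (ideal_pow k H0 a) (ideal_pow k (ideal_mul k H1 H2) b).
  have rJ (a b : nat) : represents k (J a b) (alpha0 ^+ a * beta ^+ b).
    by apply: rep_mul; apply: rep_pow.
  have kJ (a b : nat) : K3 (alpha0 ^+ a * beta ^+ b) by rewrite /K3; sf.
  have capJ I (a b : nat) : is_ideal k I -> ideal_equiv k I (J a b) -> cap I.
    by move=> hI hJ; exact: (cap_of_equiv hI (rJ a b) (kJ a b) hJ).
  have cls I : nz_ideal k I -> cap I -> exists a b : bool, ideal_equiv k I (J a b).
    move=> hI [h2 hc].
    have [g [a [b [y [ky ny] [og ng hg hu]]]]] :=
      cap_gam H UH kp np kb eb (fun g => index1_kernel H UH (g := g) hi) hI h2 hc.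
    exists a, b; exact: (capitulates_equiv _ _ _ _ _ hI og ng hg (rJ a b) ky ny hu).
  split; last first.
    move=> I hI; split; first by move/(cls I hI) => [a [b h]]; exists a, b.
    by move=> [a [b h]]; apply: capJ h; case: hI.
  apply: (num_classes_bool2 (J := fun a b : bool => J a b)) => //.
    move=> a b; split; first exact: (rep_nz _ _ (rJ a b)).
    by split; [exact: (rep_in_2part _ _ (rJ a b)) | exact: (rep_capitulates (@K_of_k p1 p2) _ _ (rJ a b) (kJ a b))].
  move=> a b a' b' h.
  have [x [kx nx] hu] := equiv_rep _ _ _ _ (rJ a b) (rJ a' b') h.
  have [oA oB] := gam_distinct H UH kp np kb eb kx nx hu.
  by move: oA (oB hi); case: (a); case: (a'); case: (b); case: (b').
have [eta kb0 [eb en2]] := index2_eta H UH hi.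
have env : normexp n2 = 1 by case: (nuP UH) => - [h1 h2] //; rewrite /normexp en2 eqxx.
have kb : K3 eta by exact: (K_of_K0 kb0).
have k1 : k 1 by rewrite /k; sf.
have n1 : 1 != 0 :> algC by exact: oner_neq0.
(* For [Q = 2] the role of [beta] is played by [eta] with [x0 = 1]. As [eta] is a unit, its powers
   do not affect the ideal and only [H0] remains. *)
have eb' : eta ^+ 2 = 1 * unit_mon e1 e2 e3 (normexp n2) 1 (normexp n2) by rewrite mul1r env.
have ueta : aunit eta by apply: (@aunit_root eta 2) => //; rewrite eb; exact: (U_aunit UH).
have rJ (a : nat) : represents k (ideal_pow k H0 a) (alpha0 ^+ a) by exact: rep_pow.
have kJ (a : nat) : K3 (alpha0 ^+ a) by rewrite /K3; sf.
have cls I : nz_ideal k I -> cap I -> exists a : bool, ideal_equiv k I (ideal_pow k H0 a).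
  move=> hI [h2 hc].
  have [g [a [b [y [ky ny] [og ng hg hu]]]]] :=
    cap_gam H UH k1 n1 kb eb' (fun g => index2_kernel H UH (g := g) hi) hI h2 hc.
  have hu' : aunit (g / (y * alpha0 ^+ a)).
    have -> : g / (y * alpha0 ^+ a) = g / (y * (alpha0 ^+ a * eta ^+ b)) * eta ^+ b.
      by field; rewrite ny !expf_neq0 ?alpha0_neq0 // (aunit_neq0 ueta).
    by apply: aunitM => //; exact: aunitX.
  exists a; exact: (capitulates_equiv _ _ _ _ _ hI og ng hg (rJ a) ky ny hu').
split; last first.
  move=> I hI; split; first by move/(cls I hI) => [a h]; exists a.
  by move=> [a h]; case: (hI) => hid _; exact: (cap_of_equiv hid (rJ a) (kJ a) h).
apply: (num_classes_bool (J := fun a : bool => ideal_pow k H0 a)) => //.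
  move=> a; split; first exact: (rep_nz _ _ (rJ a)).
  by split; [exact: (rep_in_2part _ _ (rJ a)) | exact: (rep_capitulates (@K_of_k p1 p2) _ _ (rJ a) (kJ a))].
move=> a a' h.
have [x [kx nx] hu] := equiv_rep _ _ _ _ (rJ a) (rJ a') h.
(* The factors [eta ^+ 0] give the quotient the two-exponent form that [gam_distinct] expects. *)
have hu' : aunit (alpha0 ^+ a' * eta ^+ 0 / (x * (alpha0 ^+ a * eta ^+ 0))) by rewrite !expr0 !mulr1.
have [oA _] := gam_distinct H UH k1 n1 kb eb' kx nx hu'.
by move: oA; case: (a); case: (a').
Qed.
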